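(* Two fine symbols represent isometric lattices if and only if one can be obtained from the other by a finite sequence of sign walking, giver permutation and giver conversion operations.
   Context: $\mathbb{Z}_2$ denotes the $2$-adic integers and $\mathbb{Q}_2$ its fraction field. A lattice is a finitely generated free $\mathbb{Z}_2$-module with a nondegenerate symmetric bilinear form valued in $\mathbb{Q}_2$; $\langle a_1,\dots,a_n\rangle$ is the lattice with diagonal Gram matrix $\mathrm{diag}(a_1,\dots,a_n)$. For $q$ a power of $2$ (possibly with negative exponent) define the following ''terms'' with scale $q$: $q^{+2}_{\rm II}$ is the lattice with Gram matrix $q\begin{pmatrix}0&1\\1&0\end{pmatrix}$ and $q^{-2}_{\rm II}$ the lattice with Gram matrix $q\begin{pmatrix}2&1\\1&2\end{pmatrix}$ (type II); $q^{+}_G=\langle q\rangle$, $q^-_G=\langle -3q\rangle$ (givers), $q^+_R=\langle -q\rangle$, $q^-_R=\langle 3q\rangle$ (receivers); givers and receivers have type I. The superscript $\pm$ is the sign of the term; the subscript $G$ or $R$ is its label. A fine symbol is an unordered list of such terms such that a term $q^{\pm2}_{\rm II}$ occurs only if every term of scale $q$ has type II; it represents the orthogonal direct sum of its terms. A compartment of a fine symbol is a maximal set of its type I terms whose set of scales is of the form $\{2^a,2^{a+1},\dots,2^b\}$. The operations are: Sign walking: choose two terms satisfying one of (0) same scale; (1) scales differ by a factor $2$ and one has type I, the other type II; (2) scales differ by a factor $2$ and both are givers or both are receivers; (3) scales differ by a factor $4$ and both have type I; then negate the signs of both terms (keeping scales), and in case (2) also change both from givers to receivers or vice versa (in the other cases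 keeping the labels). Giver permutation: within one compartment, permute the labels $G,R$ among its terms, keeping scales and signs. Giver conversion: within one compartment, change four terms labelled $G$ to label $R$, or four terms labelled $R$ to label $G$, keeping scales and signs. *)

(* Defs.v *)
(* MathComp, with the classical axioms of mathcomp.classical.boolp for the
   choice structure and the inverse on Z_2. *)
From HB Require Import structures.
From mathcomp Require Import all_boot all_order all_fingroup all_algebra.
From mathcomp Require Import boolp.
From mathcomp Require Import finmap multiset.
From Stdlib Require Import Relation_Operators.

Set Implicit Arguments.
Unset Strict Implicit.
Unset Printing Implicit Defensive.

Import Order.TTheory GRing.Theory Num.Theory.
Local Open Scope ring_scope.

(* Z_2 is the inverse limit of the rings Z/2^n: an element is the sequence of
   its residues [x n], taken in [0, 2^n), and coherence makes [x n] the
   reduction of [x n.+1]. *)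
Record Z2 := MkZ2 {
  residue :> nat -> nat;
  residueP : forall n, (residue n.+1 %% 2 ^ n = residue n)%N }.

HB.instance Definition _ := gen_eqMixin Z2.
HB.instance Definition _ := gen_choiceMixin Z2.

Lemma Z2_eq (x y : Z2) : (forall n, x n = y n) -> x = y.
Proof.
case: x y => [x xP] [y yP] /= /funext xy; move: xP yP; rewrite xy => xP yP.
by congr MkZ2; apply: Prop_irrelevance.
Qed.

Lemma residue_mod (x : Z2) n : (x n %% 2 ^ n = x n)%N.
Proof. by rewrite -(residueP x n) modn_mod. Qed.

Lemma residue_le (x : Z2) m n : (m <= n)%N -> (x n %% 2 ^ m = x m)%N.
Proof.
move=> /subnK <-; elim: (n - m)%N => [|k IHk]; first exact: residue_mod.
by rewrite -IHk addSn -(residueP x (k + m)) modn_dvdm // dvdn_exp2l // leq_addl.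
Qed.

Lemma modn_pow2 a n : (a %% 2 ^ n.+1 %% 2 ^ n = a %% 2 ^ n)%N.
Proof. by rewrite modn_dvdm // dvdn_exp2l. Qed.

Fact nat_Z2_subproof a n : (a %% 2 ^ n.+1 %% 2 ^ n = a %% 2 ^ n)%N.
Proof. exact: modn_pow2. Qed.
Definition nat_Z2 a := MkZ2 (nat_Z2_subproof a).

Fact Z2_add_subproof (x y : Z2) n :
  ((x n.+1 + y n.+1) %% 2 ^ n.+1 %% 2 ^ n = (x n + y n) %% 2 ^ n)%N.
Proof. by rewrite modn_pow2 -modnDm !residueP. Qed.
Definition Z2_add x y := MkZ2 (Z2_add_subproof x y).

Fact Z2_mul_subproof (x y : Z2) n :
  ((x n.+1 * y n.+1) %% 2 ^ n.+1 %% 2 ^ n = (x n * y n) %% 2 ^ n)%N.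
Proof. by rewrite modn_pow2 -modnMm !residueP. Qed.
Definition Z2_mul x y := MkZ2 (Z2_mul_subproof x y).

(* The residue of [- x] is that of [(2^n - 1) * x]. *)
Fact Z2_opp_subproof (x : Z2) n :
  (((2 ^ n.+1).-1 * x n.+1) %% 2 ^ n.+1 %% 2 ^ n
     = ((2 ^ n).-1 * x n) %% 2 ^ n)%N.
Proof.
rewrite modn_pow2 -modnMm residueP -[in RHS]modnMml; congr (_ * _ %% _)%N.
have p_gt0 : (0 < 2 ^ n)%N by rewrite expn_gt0.
rewrite expnS mul2n -addnn -{1}(prednK p_gt0) addSn /=.
by rewrite -modnDmr modnn addn0.
Qed.
Definition Z2_opp x := MkZ2 (Z2_opp_subproof x).

Fact Z2_addA : associative Z2_add.
Proof. by move=> x y z; apply: Z2_eq => n /=; rewrite modnDmr modnDml addnA. Qed.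

Fact Z2_addC : commutative Z2_add.
Proof. by move=> x y; apply: Z2_eq => n /=; rewrite addnC. Qed.

Fact Z2_add0 : left_id (nat_Z2 0) Z2_add.
Proof. by move=> x; apply: Z2_eq => n /=; rewrite modnDml residue_mod. Qed.

Fact Z2_addN : left_inverse (nat_Z2 0) Z2_opp Z2_add.
Proof.
move=> x; apply: Z2_eq => n /=; rewrite modnDml -mulSnr prednK ?expn_gt0 //.
by rewrite modnMr mod0n.
Qed.

HB.instance Definition _ :=
  GRing.isZmodule.Build Z2 Z2_addA Z2_addC Z2_add0 Z2_addN.

Fact Z2_mulA : associative Z2_mul.
Proof. by move=> x y z; apply: Z2_eq => n /=; rewrite modnMmr modnMml mulnA. Qed.

Fact Z2_mulC : commutative Z2_mul.
Proof. by move=> x y; apply: Z2_eq => n /=; rewrite mulnC. Qed.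

Fact Z2_mul1 : left_id (nat_Z2 1) Z2_mul.
Proof. by move=> x; apply: Z2_eq => n /=; rewrite modnMml mul1n residue_mod. Qed.

Fact Z2_mulD : left_distributive Z2_mul Z2_add.
Proof.
by move=> x y z; apply: Z2_eq => n /=; rewrite modnMml mulnDl modnDm.
Qed.

Fact Z2_1neq0 : nat_Z2 1 != nat_Z2 0.
Proof. by apply/eqP => /(congr1 (fun x : Z2 => x 1%N)). Qed.

HB.instance Definition _ :=
  GRing.Zmodule_isComNzRing.Build Z2 Z2_mulA Z2_mulC Z2_mul1 Z2_mulD Z2_1neq0.

Definition Z2_unit : pred Z2 := fun x => `[< exists y, y * x = 1 >].

Definition Z2_inv (x : Z2) : Z2 :=
  if pselect (exists y, y * x = 1) is left xU then projT1 (cid xU) else x.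

Fact Z2_mulV : {in Z2_unit, left_inverse 1 Z2_inv *%R}.
Proof.
move=> x /asboolP xU; rewrite /Z2_inv; case: pselect => [xU'|//].
exact: (projT2 (cid xU')).
Qed.

Fact Z2_unitP (x y : Z2) : y * x = 1 -> Z2_unit x.
Proof. by move=> yx; apply/asboolP; exists y. Qed.

Fact Z2_inv_out : {in [predC Z2_unit], Z2_inv =1 id}.
Proof.
move=> x /negP xNU; rewrite /Z2_inv; case: pselect => // xU.
by case: xNU; apply/asboolP.
Qed.

HB.instance Definition _ :=
  GRing.ComNzRing_hasMulInverse.Build Z2 Z2_mulV Z2_unitP Z2_inv_out.

Lemma Z2_neq0 (x : Z2) : x != 0 -> exists n, x n != 0%N.
Proof.
move=> x0; apply: contrapT => xN; case/eqP: x0; apply: Z2_eq => n /=.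
by rewrite mod0n; apply: contrapT => /eqP xn; apply: xN; exists n.
Qed.

Fact Z2_integral : GRing.integral_domain_axiom Z2.
Proof.
move=> x y xy0; apply/norP => -[/Z2_neq0 [a xa] /Z2_neq0 [b yb]].
have: (2 ^ (a + b) %| x (a + b) * y (a + b))%N.
  rewrite /dvdn; have /(congr1 (fun z : Z2 => z (a + b)%N)) /= := xy0.
  by rewrite mod0n => ->.
have nx : ~~ (2 ^ a %| x (a + b))%N by rewrite /dvdn residue_le ?leq_addr.
have ny : ~~ (2 ^ b %| y (a + b))%N by rewrite /dvdn residue_le ?leq_addl.
have x0 : (0 < x (a + b))%N by case: (x (a + b)%N) nx => //; rewrite dvdn0.
have y0 : (0 < y (a + b))%N by case: (y (a + b)%N) ny => //; rewrite dvdn0.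
move: nx ny; rewrite !pfactor_dvdn ?muln_gt0 ?x0 ?y0 // lognM // -!ltnNge.
by move=> nx ny; rewrite leqNgt -addSn leq_add // ltnW.
Qed.

HB.instance Definition _ :=
  GRing.ComUnitRing_isIntegral.Build Z2 Z2_integral.

Notation Q2 := {fraction Z2}.
Notation toQ2 := (@FracField.tofrac Z2).

Record lattice := Lattice {
  lat_mod :> lmodType Z2;
  lat_form : lat_mod -> lat_mod -> Q2;
  lat_free : exists n (f : {linear 'rV[Z2]_n -> lat_mod}), bijective f;
  lat_linear : forall z a x y,
    lat_form (a *: x + y) z = toQ2 a * lat_form x z + lat_form y z;
  lat_sym : forall x y, lat_form x y = lat_form y x;
  lat_nondeg : forall x, (forall y, lat_form x y = 0) -> x = 0 }.

Definition isometric (L M : lattice) : Prop :=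
  exists2 f : {linear L -> M}, bijective f &
    forall x y, lat_form (f x) (f y) = lat_form x y.

Section GramLattice.
Variables (n : nat) (G : 'M[Q2]_n).
Hypotheses (Gsym : G^T = G) (Gdet : \det G != 0).

Definition gram_form (x y : 'rV[Z2]_n) : Q2 :=
  (map_mx toQ2 x *m G *m (map_mx toQ2 y)^T) 0 0.

Fact gram_free :
  exists m (f : {linear 'rV[Z2]_m -> 'rV[Z2]_n}), bijective f.
Proof. by exists n, idfun; exists id. Qed.

Fact gram_linear z a x y :
  gram_form (a *: x + y) z = toQ2 a * gram_form x z + gram_form y z.
Proof.
by rewrite /gram_form map_mxD map_mxZ !mulmxDl -!scalemxAl !mxE.
Qed.

Fact gram_sym x y : gram_form x y = gram_form y x.
Proof.
have tr (A : 'M[Q2]_1) : A 0 0 = A^T 0 0 by rewrite mxE.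
by rewrite /gram_form tr !trmx_mul trmxK Gsym mulmxA.
Qed.

Fact gram_nondeg x : (forall y, gram_form x y = 0) -> x = 0.
Proof.
move=> x0; have xG0 : map_mx toQ2 x *m G = 0.
  apply/rowP => j; rewrite [RHS]mxE -(x0 (delta_mx 0 j)) /gram_form.
  by rewrite map_delta_mx trmx_delta -colE [RHS]mxE.
have Gu : G \in unitmx by rewrite unitmxE unitfE.
have : map_mx toQ2 x = 0 by rewrite -(mulmxK Gu (map_mx _ _)) xG0 mul0mx.
move=> /matrixP x'0; apply/matrixP => i j; apply/eqP.
by have /eqP := x'0 i j; rewrite !mxE tofrac_eq0.
Qed.

Definition gram_lattice : lattice :=
  Lattice gram_free gram_linear gram_sym gram_nondeg.

End GramLattice.

Section OrthSum.
Variables L M : lattice.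

Definition orth_form (x y : L * M) : Q2 :=
  lat_form x.1 y.1 + lat_form x.2 y.2.

Fact orth_free :
  exists n (f : {linear 'rV[Z2]_n -> (L * M)%type}), bijective f.
Proof.
have [m [f [f' fK f'K]]] := lat_free L; have [n [g [g' gK g'K]]] := lat_free M.
pose h (x : 'rV[Z2]_(m + n)) : (L * M)%type := (f (lsubmx x), g (rsubmx x)).
have h_lin : linear h by move=> a x y; rewrite /h !linearP.
pose hL := GRing.isLinear.Build _ _ _ _ h h_lin.
pose H : {linear 'rV[Z2]_(m + n) -> (L * M)%type} := HB.pack h hL.
exists (m + n)%N, H; exists (fun u => row_mx (f' u.1) (g' u.2)) => [x|[u v]].
  by rewrite /= fK gK hsubmxK.
by rewrite /= /h row_mxKl row_mxKr f'K g'K.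
Qed.

Fact orth_linear z a x y :
  orth_form (a *: x + y) z = toQ2 a * orth_form x z + orth_form y z.
Proof. by rewrite /orth_form !lat_linear mulrDr addrACA. Qed.

Fact orth_sym x y : orth_form x y = orth_form y x.
Proof. by congr (_ + _); apply: lat_sym. Qed.

Lemma lat_form0 (N : lattice) (x : N) : lat_form x 0 = 0.
Proof.
rewrite lat_sym; have := lat_linear x (-1) 0 0.
by rewrite scaler0 addr0 rmorphN1 mulN1r addNr.
Qed.

Fact orth_nondeg x : (forall y, orth_form x y = 0) -> x = 0.
Proof.
case: x => x1 x2 x0; congr (_, _); apply: lat_nondeg => y.
  by have := x0 (y, 0); rewrite /orth_form /= lat_form0 addr0.
by have := x0 (0, y); rewrite /orth_form /= lat_form0 add0r.
Qed.

Definition orth_sum : lattice :=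
  Lattice orth_free orth_linear orth_sym orth_nondeg.

End OrthSum.

Fact zero_gram_sym : (0 : 'M[Q2]_0)^T = 0. Proof. exact: trmx0. Qed.
Fact zero_gram_det : \det (0 : 'M[Q2]_0) != 0.
Proof. by rewrite det_mx00 oner_eq0. Qed.
Definition zero_lattice : lattice := gram_lattice zero_gram_sym zero_gram_det.

Variant kind := TypeII | Giver | Receiver.

Definition kind_code k : option bool :=
  match k with TypeII => None | Giver => Some true | Receiver => Some false end.
Definition kind_decode o :=
  match o with None => TypeII | Some b => if b then Giver else Receiver end.
Lemma kind_codeK : cancel kind_code kind_decode. Proof. by case. Qed.
HB.instance Definition _ := Choice.copy kind (can_type kind_codeK).

(* The term of scale [2 ^ expo t]; [minus t] holds when its sign is [-]. *)
Record term := Term { expo : int; minus : bool; kind_of : kind }.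

Definition term_code t := (expo t, minus t, kind_of t).
Definition term_decode c := let: (e, m, k) := c in Term e m k.
Lemma term_codeK : cancel term_code term_decode. Proof. by case. Qed.
HB.instance Definition _ := Choice.copy term (can_type term_codeK).

Definition scale (t : term) : Q2 := 2%:R ^ expo t.

Definition type_I (t : term) : bool := kind_of t != TypeII.

(* [gram_II] is meant for terms of type II, [gram_I] for terms of type I. *)
Definition gram_II (t : term) : 'M[Q2]_2 :=
  scale t *: \matrix_(i, j) (if i != j then 1 else if minus t then 2%:R else 0).

Definition gram_I (t : term) : 'M[Q2]_1 :=
  ((match kind_of t, minus t with
    | Receiver, false => - 1
    | Receiver, true => 3%:R
    | _, false => 1
    | _, true => - 3%:R
    end) * scale t)%:M.

Lemma Q2_nat_neq0 n : n.+1%:R != 0 :> Q2.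
Proof.
have natE m : m%:R = nat_Z2 m.
  elim: m => // m IHm; rewrite -natr1 IHm; apply: Z2_eq => k /=.
  by rewrite modnDm addn1.
rewrite -(rmorph_nat toQ2) tofrac_eq0 natE; apply/eqP.
move=> /(congr1 (fun x : Z2 => x n.+1)) /=.
by rewrite mod0n modn_small // ltn_expl.
Qed.

Lemma scale_neq0 t : scale t != 0.
Proof. by rewrite expfz_neq0 // Q2_nat_neq0. Qed.

Fact gram_II_sym t : (gram_II t)^T = gram_II t.
Proof. by apply/matrixP => i j; rewrite !mxE [j == i]eq_sym. Qed.

Fact gram_II_det t : \det (gram_II t) != 0.
Proof.
rewrite detZ mulf_neq0 ?expf_neq0 ?scale_neq0 //.
rewrite (expand_det_row _ 0) !big_ord_recl big_ord0 /cofactor !det_mx11 !mxE /=.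
case: (minus t); rewrite ?mul0r ?add0r ?addr0 !(expr0, expr1, mul1r, mulN1r).
  have -> : 2%:R * 2%:R - 1 = 3%:R :> Q2 by rewrite -natrM -(natrB _ (_ : 1 <= 4)%N).
  exact: Q2_nat_neq0.
by rewrite oppr_eq0 oner_eq0.
Qed.

Fact gram_I_sym t : (gram_I t)^T = gram_I t.
Proof. exact: tr_scalar_mx. Qed.

Fact gram_I_det t : \det (gram_I t) != 0.
Proof.
rewrite det_scalar1 mulf_neq0 ?scale_neq0 //.
by case: (kind_of t) (minus t) => -[]; rewrite ?oppr_eq0 ?oner_eq0 ?Q2_nat_neq0.
Qed.

Definition term_lattice (t : term) : lattice :=
  if type_I t then gram_lattice (gram_I_sym t) (gram_I_det t)
  else gram_lattice (gram_II_sym t) (gram_II_det t).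

Local Open Scope mset_scope.

Definition fine_symbol (S : {mset term}) : Prop :=
  forall t u, t \in S -> u \in S ->
    ~~ type_I t -> expo u = expo t -> ~~ type_I u.

(* A multiset is summed in the order of its enumeration; another order gives an
   isometric lattice. *)
Definition symbol_lattice (S : {mset term}) : lattice :=
  foldr orth_sum zero_lattice (map term_lattice (enum_mset S)).

Definition negate (t : term) : term :=
  Term (expo t) (~~ minus t) (kind_of t).

Definition switch_label (t : term) : term :=
  Term (expo t) (minus t)
    (match kind_of t with
     | TypeII => TypeII | Giver => Receiver | Receiver => Giver
     end).

(* The operations act on an indexing of the terms of a symbol; they keep the
   scale and the type of every term, so they turn fine symbols into fine
   symbols. *)

Variant walk_pair (t u t' u' : term) : Prop :=
| WalkSame of expo t = expo u & t' = negate t & u' = negate u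
| WalkTypes of `|expo t - expo u| = 1 & type_I t != type_I u
    & t' = negate t & u' = negate u
| WalkLabels of `|expo t - expo u| = 1 & type_I t & kind_of t = kind_of u
    & t' = switch_label (negate t) & u' = switch_label (negate u)
| WalkFour of `|expo t - expo u| = 2 & type_I t & type_I u
    & t' = negate t & u' = negate u.

Section Operations.
Variable n : nat.
Implicit Types (s t : n.-tuple term) (C D A : {set 'I_n}).

Definition sign_walking s t : Prop :=
  exists i j : 'I_n,
    [/\ i != j,
        walk_pair (tnth s i) (tnth s j) (tnth t i) (tnth t j)
      & forall k, k != i -> k != j -> tnth t k = tnth s k].

Definition consecutive_type_I s C : Prop :=
  (forall i, i \in C -> type_I (tnth s i)) /\
  exists2 ab : int * int, ab.1 <= ab.2 &
    forall e : int,
      (exists2 i, i \in C & expo (tnth s i) = e) <-> ab.1 <= e <= ab.2.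

Definition compartment s C : Prop :=
  consecutive_type_I s C /\
  forall D, consecutive_type_I s D -> C \subset D -> D = C.

Definition giver_permutation s t : Prop :=
  exists C (p : 'S_n),
    [/\ compartment s C, perm_on C p
      & forall i, tnth t i = Term (expo (tnth s i)) (minus (tnth s i))
                                   (kind_of (tnth s (p i)))].

Definition giver_conversion s t : Prop :=
  exists C A (l : kind),
    [/\ compartment s C, A \subset C, #|A| = 4%N,
        (forall i, i \in A -> kind_of (tnth s i) = l)
      & forall i, tnth t i =
          if i \in A then switch_label (tnth s i) else tnth s i].

End Operations.

Definition operation (S S' : {mset term}) : Prop :=
  exists n (s t : n.-tuple term),
    [/\ S = seq_mset s, S' = seq_mset t
      & [\/ sign_walking s t, giver_permutation s t
          | giver_conversion s t]].

Definition obtained_from : {mset term} -> {mset term} -> Prop :=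
  clos_refl_trans {mset term} operation.

(* Main.v *)
(* Each operation is an isometry between lattices of rank at most four: a change
   of basis identifies the Gram matrices up to units congruent to 1 modulo 8,
   which are squares by Hensel's lemma.

   Conversely, the Gauss sums of level K (sums of exp(2 pi i (x, x) / 2^K.+1) over
   the lattice modulo a power of 2) are isometry invariants, multiplicative on
   orthogonal sums.  Such a sum vanishes exactly when there is a type I term of
   scale 2^K; otherwise its phase gives, modulo 4, the sum over the terms of scale
   2^e < 2^K of their number of receivers plus 2 (K - e - 1) for each minus sign
   (2 (K - e) for type II).  Hence the parity of the number of minus signs of
   scale at most 2^K is an invariant when neither 2^K nor 2^K.+1 is the scale of a
   type I term, that is when no sign walk crosses the boundary between the two
   scales, and the number of receivers of a compartment changes by 2 modulo 4
   when a sign crosses an internal boundary.  Two symbols of the same lattice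
   have the same scales, types and dimensions.  Their signs are made to agree from
   the lowest scale upwards: the invariants supply the next sign walk, and then the
   labels of each compartment have the same number of receivers modulo 4. *)
From HB Require Import structures.
Require Import Defs.
From mathcomp Require Import all_boot finmap multiset.
From mathcomp Require Import all_order all_fingroup all_algebra all_field.
From mathcomp Require Import boolp ring zify.
From Stdlib Require Import Relation_Operators.

Set Implicit Arguments.
Unset Strict Implicit.
Unset Printing Implicit Defensive.

Import Order.TTheory GRing.Theory Num.Theory.
Local Open Scope ring_scope.

(** A Gauss sum that vanishes has no phase, so the levels occupied by type I terms give no equation
    on signs or labels. Inside a compartment the invariants therefore leave some freedom, which the
    operations have to exhaust; the equations come from the levels that bound the compartments.
    Scales and dimensions come from a second count: the vectors of L / 2^k L orthogonal to L modulo
    2^k number 2 to the power of the sum of d min (e, k) over the terms of dimension d and scale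
    2^e. Second differences in k isolate the dimension of each scale, and the vanishing of Gauss
    sums tells its type. The connection is a descent towards a fixed target. A wrong sign at level e
    costs B - e, where B exceeds all levels, so that pushing the lowest wrong sign upwards lowers
    the total cost even when it spoils a higher sign. As the operations are isometries, all
    invariants remain available after each of them. *)

(** * Isometries and orthogonal sums *)

Lemma isometric_intro (L M : lattice) (f : L -> M) :
    linear f -> (forall y, exists x, f x = y) ->
    (forall x y, lat_form (f x) (f y) = lat_form x y) ->
  isometric L M.
Proof.
move=> f_lin f_surj f_form.
pose F : {linear L -> M} := HB.pack f (GRing.isLinear.Build _ _ _ _ f f_lin).
have [g gP] := choice f_surj.
(* Injectivity comes from nondegeneracy: a vector with zero image is orthogonal to the whole
   lattice. *)
have F_inj : injective F.
  move=> x y /eqP; rewrite -subr_eq0 -linearB => /eqP Fxy0.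
  apply/eqP; rewrite -subr_eq0; apply/eqP/lat_nondeg => z.
  by rewrite -f_form -[f (x - y)]/(F (x - y)) Fxy0 lat_sym lat_form0.
exists F => //; exists g => x; last exact: gP.
by apply: F_inj; exact: gP.
Qed.

Lemma isometric_refl L : isometric L L.
Proof. by apply: (@isometric_intro _ _ id) => // y; exists y. Qed.

Lemma isometric_sym L M : isometric L M -> isometric M L.
Proof.
move=> [f [g fK gK] f_form]; apply: (@isometric_intro _ _ g).
- exact: can2_linear fK gK.
- by move=> x; exists (f x).
- by move=> x y; rewrite -f_form !gK.
Qed.

Lemma isometric_trans M L N : isometric L M -> isometric M N -> isometric L N.
Proof.
move=> [f [f' fK f'K] f_form] [g [g' gK g'K] g_form].
apply: (@isometric_intro _ _ (g \o f)) => [a x y|y|x y] /=.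
- by rewrite !linearP.
- by exists (f' (g' y)); rewrite f'K.
- by rewrite g_form.
Qed.

Lemma orth_sum_isometric L L' M M' :
  isometric L L' -> isometric M M' -> isometric (orth_sum L M) (orth_sum L' M').
Proof.
move=> [f [f' fK f'K] f_form] [g [g' gK g'K] g_form].
apply: (@isometric_intro (orth_sum L M) (orth_sum L' M')
          (fun u => (f u.1, g u.2))) => [a x y|y|x y] /=.
- by rewrite !linearP.
- by exists (f' y.1, g' y.2); rewrite /= f'K g'K; case: y.
- by rewrite /orth_form /= f_form g_form.
Qed.

Lemma orth_sumC L M : isometric (orth_sum L M) (orth_sum M L).
Proof.
apply: (@isometric_intro (orth_sum L M) (orth_sum M L)
          (fun u => (u.2, u.1))) => [a x y|y|x y] //=.
- by exists (y.2, y.1); case: y.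
- by rewrite /orth_form /= addrC.
Qed.

Lemma orth_sumA L M N :
  isometric (orth_sum L (orth_sum M N)) (orth_sum (orth_sum L M) N).
Proof.
apply: (@isometric_intro (orth_sum L (orth_sum M N))
          (orth_sum (orth_sum L M) N)
          (fun u => ((u.1, u.2.1), u.2.2))) => [a x y|y|x y] //=.
- by exists (y.1.1, (y.1.2, y.2)); case: y => -[].
- by rewrite /orth_form /= /orth_form /= addrA.
Qed.

Lemma orth_sumCA L M N :
  isometric (orth_sum L (orth_sum M N)) (orth_sum M (orth_sum L N)).
Proof.
apply: isometric_trans (orth_sumA _ _ _) _.
apply: isometric_trans (isometric_sym (orth_sumA _ _ _)).
exact: orth_sum_isometric (orth_sumC _ _) (isometric_refl _).
Qed.

Definition lattice_of (s : seq term) : lattice :=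
  foldr orth_sum zero_lattice (map term_lattice s).

Lemma orth_sum0 L : isometric (orth_sum L zero_lattice) L.
Proof.
apply: (@isometric_intro (orth_sum L zero_lattice) L (fun u => u.1))
  => [a x y|y|x y] //=.
- by exists (y, 0).
- by rewrite /orth_form /= /gram_form mulmx0 mul0mx mxE addr0.
Qed.

Lemma orth_sum0l L : isometric (orth_sum zero_lattice L) L.
Proof. exact: isometric_trans (orth_sumC _ _) (orth_sum0 L). Qed.

Lemma lattice_of_cat s t :
  isometric (lattice_of (s ++ t)) (orth_sum (lattice_of s) (lattice_of t)).
Proof.
elim: s => [|x s IHs] /=; first exact: isometric_sym (orth_sum0l _).
apply: isometric_trans (orth_sumA _ _ _).
exact: orth_sum_isometric (isometric_refl _) IHs.
Qed.

Lemma lattice_of_perm s t : perm_eq s t -> isometric (lattice_of s) (lattice_of t).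
Proof.
elim: s t => [|x s IHs] t st.
  by move: st; rewrite perm_sym => /perm_nilP ->; exact: isometric_refl.
have xt : x \in t by rewrite -(perm_mem st) mem_head.
have [t1 [t2 tE]] : exists t1 t2, t = t1 ++ x :: t2.
  by case/splitPr: xt => t1 t2; exists t1, t2.
rewrite tE in st *.
have {}st : perm_eq s (t1 ++ t2).
  by rewrite -(perm_cons x) (perm_trans st) // -cat1s perm_catCA.
apply: isometric_trans (orth_sum_isometric (isometric_refl _) (IHs _ st)) _.
apply: isometric_sym; apply: isometric_trans (lattice_of_cat _ _) _.
apply: isometric_trans (orth_sumCA _ _ _) _.
exact: orth_sum_isometric (isometric_refl _) (isometric_sym (lattice_of_cat _ _)).
Qed.

Lemma symbol_lattice_seq s : isometric (symbol_lattice (seq_mset s)) (lattice_of s).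
Proof. exact/lattice_of_perm/perm_eq_seq_mset. Qed.

Lemma perm_eq_tuple_split n (s : n.-tuple term) (r : seq 'I_n) : uniq r ->
  perm_eq s ([seq tnth s k | k <- r] ++
             [seq tnth s k | k <- [seq k <- enum 'I_n | k \notin r]]).
Proof.
move=> r_uniq; rewrite -map_cat -[X in perm_eq X _](map_tnth_enum s).
apply/perm_map/uniq_perm; first exact: enum_uniq.
  rewrite cat_uniq r_uniq filter_uniq ?enum_uniq // andbT; apply/hasPn => k.
  by rewrite mem_filter => /andP[].
by move=> k; rewrite mem_cat mem_filter mem_enum andbT orbN.
Qed.

(** Reordering brings the terms at the indices [r] to the front, and the remaining summands are
    common to both sides. This reduces every operation to the few terms that it changes. *)
Lemma local_isometric n (s t : n.-tuple term) (r : seq 'I_n) :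
    uniq r -> (forall k, k \notin r -> tnth t k = tnth s k) ->
    isometric (lattice_of [seq tnth s k | k <- r]) (lattice_of [seq tnth t k | k <- r]) ->
  isometric (lattice_of s) (lattice_of t).
Proof.
move=> r_uniq st r_iso.
apply: isometric_trans (lattice_of_perm (perm_eq_tuple_split s r_uniq)) _.
apply: isometric_trans (lattice_of_cat _ _) _; apply: isometric_sym.
apply: isometric_trans (lattice_of_perm (perm_eq_tuple_split t r_uniq)) _.
apply: isometric_trans (lattice_of_cat _ _) _; apply: isometric_sym.
have -> : [seq tnth t k | k <- [seq k <- enum 'I_n | k \notin r]] =
          [seq tnth s k | k <- [seq k <- enum 'I_n | k \notin r]].
  by apply/eq_in_map => k; rewrite mem_filter => /andP[/st].
exact: orth_sum_isometric r_iso (isometric_refl _).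
Qed.

Lemma lattice_of2 x y :
  isometric (lattice_of [:: x; y]) (orth_sum (term_lattice x) (term_lattice y)).
Proof. exact: orth_sum_isometric (isometric_refl _) (orth_sum0 _). Qed.


(** * Hensel's lemma, units and squares of Z_2 *)

Lemma residueD (x y : Z2) n : (x + y) n = ((x n + y n) %% 2 ^ n)%N.
Proof. by []. Qed.

Lemma residueM (x y : Z2) n : (x * y) n = ((x n * y n) %% 2 ^ n)%N.
Proof. by []. Qed.

Lemma residue0 (x : Z2) : x 0%N = 0%N.
Proof. by rewrite -(residue_mod x 0) modn1. Qed.

Lemma residue_double (x : Z2) n : (2%:R * x) n.+1 = (2 * x n)%N.
Proof.
rewrite mulr_natl mulr2n /= addnn -muln2 mulnC expnS -muln_modr.
by rewrite -(residueP x n).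
Qed.

(* The fixpoint is the limit of the iterates of [f] at [0]: the first [n]
   binary digits are settled after [n] steps. *)
Lemma contraction_fixpoint (f : Z2 -> Z2) :
    (forall (x y : Z2) n, x n = y n -> f x n.+1 = f y n.+1) ->
  exists r, f r = r.
Proof.
move=> f_contr; pose u n := iter n f 0.
have uS n : u n.+1 n = u n n.
  by elim: n => [|n IHn]; [rewrite !residue0 | exact: f_contr].
have uP n : (u n.+1 n.+1 %% 2 ^ n = u n n)%N by rewrite residueP uS.
exists (MkZ2 uP); apply: Z2_eq => -[|n]; first by rewrite !residue0.
by apply: f_contr.
Qed.

(** The factor 2 makes the right-hand side a contraction in [r]. This shape serves both for inverses
    of odd elements (c = 0) and for square roots of elements congruent to 1 modulo 8 (q = 0). *)
Lemma Z2_hensel (p q c : Z2) : exists r, r = p + 2%:R * (q * r + c * r ^+ 2).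
Proof.
have [x y n xy|r rE] := @contraction_fixpoint (fun r => p + 2%:R * (q * r + c * r ^+ 2)).
  by rewrite !residueD !residue_double !residueD !expr2 !residueM xy.
by exists r; rewrite rE.
Qed.

Lemma Z2_odd_unit (m : Z2) : 1 + 2%:R * m \is a GRing.unit.
Proof.
have [y yE] := Z2_hensel 1 (- m) 0; apply/unitrPr; exists y.
by rewrite mulrDl mul1r {1}yE; ring.
Qed.

Lemma Z2_sqrt (m : Z2) : exists s, s ^+ 2 = 1 + 8%:R * m.
Proof.
have [r rE] := Z2_hensel m 0 (- 1); exists (1 + 4%:R * r).
have -> : (1 + 4%:R * r) ^+ 2 = 1 + 8%:R * (r + 2%:R * r ^+ 2) by ring.
by rewrite {1}rE; ring.
Qed.

Lemma Z2_odd_int_unit (z : int) : (z %% 2)%Z = 1 -> z%:~R \is a @GRing.unit Z2.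
Proof.
move=> z_odd; rewrite (divz_eq z 2) z_odd addrC rmorphD rmorphM mulrC.
exact: Z2_odd_unit.
Qed.

(** * Isometries in low rank *)

Definition rv1 (p : Z2) : 'rV[Z2]_1 := \row_i p.
Definition rv2 (p q : Z2) : 'rV[Z2]_2 := \row_i (if i == 0 then p else q).

Definition e0 (x : 'rV[Z2]_1) : Z2 := x 0 0.
Definition b0 (x : 'rV[Z2]_2) : Z2 := x 0 0.
Definition b1 (x : 'rV[Z2]_2) : Z2 := x 0 1.

Lemma e0_rv1 p : e0 (rv1 p) = p. Proof. by rewrite /e0 mxE. Qed.
Lemma b0_rv2 p q : b0 (rv2 p q) = p. Proof. by rewrite /b0 mxE. Qed.
Lemma b1_rv2 p q : b1 (rv2 p q) = q. Proof. by rewrite /b1 mxE. Qed.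

Lemma e0_linear a x y : e0 (a *: x + y) = a * e0 x + e0 y.
Proof. by rewrite /e0 !mxE. Qed.
Lemma b0_linear a x y : b0 (a *: x + y) = a * b0 x + b0 y.
Proof. by rewrite /b0 !mxE. Qed.
Lemma b1_linear a x y : b1 (a *: x + y) = a * b1 x + b1 y.
Proof. by rewrite /b1 !mxE. Qed.

Definition coordE :=
  (e0_rv1, b0_rv2, b1_rv2, e0_linear, b0_linear, b1_linear).

Lemma rv1_eta (x : 'rV[Z2]_1) : rv1 (e0 x) = x.
Proof. by apply/rowP => i; rewrite mxE /e0 ord1. Qed.

Lemma ord2P (P : 'I_2 -> Prop) : P 0 -> P 1 -> forall i, P i.
Proof.
move=> P0 P1 [[|[|//]] lt_i2]; [move: P0 | move: P1];
  by congr P; apply: val_inj.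
Qed.

Lemma rv2_eta (x : 'rV[Z2]_2) : rv2 (b0 x) (b1 x) = x.
Proof. by apply/rowP; apply: ord2P; rewrite mxE. Qed.

Lemma rv1_ind (P : 'rV[Z2]_1 -> Prop) : (forall p, P (rv1 p)) -> forall x, P x.
Proof. by move=> Prv x; rewrite -(rv1_eta x). Qed.

Lemma rv2_ind (P : 'rV[Z2]_2 -> Prop) : (forall p q, P (rv2 p q)) -> forall x, P x.
Proof. by move=> Prv x; rewrite -(rv2_eta x). Qed.

Lemma rv1_linear a p q : rv1 (a * p + q) = a *: rv1 p + rv1 q.
Proof. by apply/rowP => i; rewrite !mxE. Qed.

Lemma rv2_linear a p q p' q' :
  rv2 (a * p + p') (a * q + q') = a *: rv2 p q + rv2 p' q'.
Proof. by apply/rowP => i; rewrite !mxE; case: ifP. Qed.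

Fact unary_sym (q : Q2) : (q%:M : 'M_1)^T = q%:M.
Proof. exact: tr_scalar_mx. Qed.

Fact unary_det (q : Q2) : q != 0 -> \det (q%:M : 'M_1) != 0.
Proof. by rewrite det_scalar1. Qed.

Definition unary q (q_neq0 : q != 0) : lattice :=
  gram_lattice (unary_sym q) (unary_det q_neq0).

(** Unlike in [gram_II], the scale is an arbitrary element of Q_2, so that it may absorb a unit such
    as - 1. *)
Definition binary_gram m (q : Q2) : 'M[Q2]_2 :=
  q *: \matrix_(i, j) (if i != j then 1 else if m then 2%:R else 0).

Fact binary_gram_sym m q : (binary_gram m q)^T = binary_gram m q.
Proof. by apply/matrixP => i j; rewrite !mxE [j == i]eq_sym. Qed.

Fact binary_gram_det m q : q != 0 -> \det (binary_gram m q) != 0.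
Proof.
move=> q0; rewrite detZ mulf_neq0 ?expf_neq0 //.
have := gram_II_det (Term 0 m TypeII); rewrite /gram_II detZ.
by apply: contraNneq => ->; rewrite mulr0.
Qed.

Definition binary m q (q_neq0 : q != 0) : lattice :=
  gram_lattice (binary_gram_sym m q) (binary_gram_det m q_neq0).

Lemma unary_form q (q0 : q != 0) (x y : unary q0) :
  lat_form x y = q * toQ2 (e0 x * e0 y).
Proof.
rewrite /= /gram_form mul_mx_scalar -scalemxAl mxE.
by rewrite mxE big_ord1 !mxE -rmorphM.
Qed.

Lemma binary_form m q (q0 : q != 0) (x y : binary m q0) :
  lat_form x y = q * toQ2 (b0 x * b1 y + b1 x * b0 y +
    (if m then 2%:R else 0) * (b0 x * b0 y + b1 x * b1 y)).
Proof.
have lift01 : lift ord0 ord0 = 1 :> 'I_2 by exact: val_inj.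
rewrite /b0 /b1 /= /gram_form mxE !big_ord_recl big_ord0.
rewrite !mxE !big_ord_recl !big_ord0 !mxE /= lift01.
move: (x 0 0) (x 0 1) (y 0 0) (y 0 1) => x0 x1 y0 y1 {x y}.
rewrite !rmorphD !rmorphM rmorphD !rmorphM.
have -> : (if m then 2%:R else 0 : Q2) = toQ2 (if m then 2%:R else 0).
  by case: m; rewrite ?rmorph0 ?rmorph_nat.
rewrite /=.
move: (FracField.tofrac x0) (FracField.tofrac x1) (FracField.tofrac y0)
  (FracField.tofrac y1) (FracField.tofrac _) => {x0 x1 y0 y1} x0 x1 y0 y1 c.
by ring.
Qed.

Lemma gram_lattice_eq n (G G' : 'M[Q2]_n) sG dG sG' dG' : G = G' ->
  isometric (@gram_lattice n G sG dG) (@gram_lattice n G' sG' dG').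
Proof.
move=> GG'; subst G'.
by apply: (@isometric_intro (gram_lattice sG dG) (gram_lattice sG' dG') id) => // y; exists y.
Qed.

Lemma scaleQM (q : Q2) (a p : Z2) : q * toQ2 a * toQ2 p = q * toQ2 (a * p).
Proof. by rewrite -mulrA -rmorphM. Qed.

Lemma scaleQD (q : Q2) (a p : Z2) : q * toQ2 a + q * toQ2 p = q * toQ2 (a + p).
Proof. by rewrite -mulrDr -rmorphD. Qed.

Definition formE := (unary_form, binary_form, scaleQM, scaleQD).

Lemma unary_isometric (q : Q2) (a b s : Z2) (qa : q * toQ2 a != 0)
    (qb : q * toQ2 b != 0) :
  s \is a GRing.unit -> a = b * s ^+ 2 -> isometric (unary qa) (unary qb).
Proof.
move=> s_unit aE; apply: (@isometric_intro (unary qa) (unary qb) (fun x => s *: x)).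
- by move=> c x y; rewrite scalerDr !scalerA (mulrC s).
- by move=> y; exists (s^-1 *: y); rewrite scalerA divrr ?scale1r.
- by move=> x y; rewrite !formE /e0 !mxE; congr (_ * toQ2 _); rewrite aE; ring.
Qed.

(* The form is the norm of Z_2[w], w a primitive 6th root of unity.  Multiplying
   by [2 + w], of norm 7, and dividing by a square root of -7 reverses its sign. *)
Lemma binary_isometric_opp (q : Q2) (q0 : q != 0) (q0' : - q != 0) :
  isometric (binary true q0') (binary true q0).
Proof.
have [s s2] := Z2_sqrt (- 1).
have s_unit : s \is a GRing.unit.
  have := Z2_odd_unit (- 4%:R); rewrite -(@unitrX_pos _ s 2) ?s2 //.
  by congr (_ \is a GRing.unit); ring.
have [k kE] : exists k : Z2, - 7%:R * k ^+ 2 = 1.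
  exists s^-1; have -> : - 7%:R = s ^+ 2 by rewrite s2; ring.
  by rewrite -exprMn divrr ?expr1n.
apply: (@isometric_intro (binary true q0') (binary true q0) (fun x =>
  rv2 (k * (2%:R * b0 x - b1 x)) (k * (b0 x + 3%:R * b1 x)))).
- move=> c; elim/rv2_ind => x0 x1; elim/rv2_ind => y0 y1.
  by rewrite !coordE -rv2_linear; congr rv2; ring.
- elim/rv2_ind => y0 y1.
  exists (rv2 (- k * (3%:R * y0 + y1)) (- k * (2%:R * y1 - y0))).
  by rewrite !coordE; congr rv2; rewrite -[RHS]mul1r -[X in _ = X * _]kE; ring.
- elim/rv2_ind => x0 x1; elim/rv2_ind => y0 y1.
  rewrite !formE !coordE mulNr -mulrN -rmorphN; congr (_ * toQ2 _).
  by rewrite -[RHS]mul1r -[X in _ = X * _]kE; ring.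
Qed.

(* The vector (1, w) has unit norm n, and (- h b w, a) spans its orthogonal. *)
Lemma unary2_isometric (q : Q2) (a b h w : Z2) (n := a + h * b * w ^+ 2)
    (qn : q * toQ2 n != 0) (qn' : q * toQ2 (a * b * n * h) != 0)
    (qa : q * toQ2 a != 0) (qb : q * toQ2 (b * h) != 0) :
  n \is a GRing.unit ->
  isometric (orth_sum (unary qn) (unary qn')) (orth_sum (unary qa) (unary qb)).
Proof.
move=> n_unit; have [k nk] : exists k : Z2, n * k = 1 by exists n^-1; rewrite divrr.
apply: (@isometric_intro (orth_sum (unary qn) (unary qn'))
    (orth_sum (unary qa) (unary qb)) (fun u =>
  (rv1 (e0 u.1 - h * b * w * e0 u.2), rv1 (w * e0 u.1 + a * e0 u.2)))).
- move=> c [x x'] [y y'] /=; rewrite !coordE; congr (_, _);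
    rewrite -rv1_linear; congr rv1;
    move: (e0 x) (e0 x') (e0 y) (e0 y') => {x x' y y'} x x' y y'; ring.
- move=> [y1 y2]; elim/rv1_ind: y1 => y1; elim/rv1_ind: y2 => y2.
  exists (rv1 (k * (a * y1 + h * b * w * y2)), rv1 (k * (y2 - w * y1))).
  rewrite /= !coordE.
  by congr (rv1 _, rv1 _); rewrite -[RHS]mul1r -[X in _ = X * _]nk /n; ring.
- move=> [x x'] [y y']; rewrite /= /orth_form !formE !coordE; congr (_ * toQ2 _).
  by move: (e0 x) (e0 x') (e0 y) (e0 y') => {x x' y y'} x x' y y'; rewrite /n; ring.
Qed.

(* The vector v = (1; g, g d) has norm g n, and its orthogonal is spanned by
   (- h; - p, - d (1 + p)) and (0; 1, - d), with Gram matrix - h d (2 1; 1 2).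
   For d = 1, -1 and p = 0, 1, the unit a runs through -1, 1, -3, 3 and n through
   the unit of the same label and opposite sign. *)
Lemma unary_binary_isometric (q : Q2) (g h d p : Z2) (a := - d * (1 + 2%:R * p))
    (n := a + 4%:R * d)
    (qn : q * toQ2 (g * n) != 0) (qd : q * toQ2 (h * - d) != 0)
    (qa : q * toQ2 (g * a) != 0) (qh : q * toQ2 h != 0) :
    g * h = 2%:R -> d * d = 1 -> p * p = p -> n \is a GRing.unit ->
  isometric (orth_sum (unary qn) (binary true qd)) (orth_sum (unary qa) (binary false qh)).
Proof.
move=> gh d2 p2 n_unit; have [k nk] : exists k : Z2, n * k = 1.
  by exists n^-1; rewrite divrr.
pose r := d * (1 + p).
apply: (@isometric_intro (orth_sum (unary qn) (binary true qd))
    (orth_sum (unary qa) (binary false qh)) (fun u =>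
  (rv1 (e0 u.1 - h * b0 u.2),
   rv2 (g * e0 u.1 - p * b0 u.2 + b1 u.2)
       (g * d * e0 u.1 - r * b0 u.2 - d * b1 u.2)))).
- move=> c [x x'] [y y'] /=; rewrite !coordE.
  move: (e0 x) (b0 x') (b1 x') (e0 y) (b0 y') (b1 y') => {x x' y y'} x x' x'' y y' y''.
  congr (_, _); first by rewrite -rv1_linear; congr rv1; ring.
  by rewrite -rv2_linear; congr rv2; ring.
- move=> [y z]; elim/rv1_ind: y => y; elim/rv2_ind: z => z0 z1.
  exists (rv1 (k * (a * y + h * (d * z0 + z1))),
     rv2 (k * (d * z0 + z1 - 2%:R * g * d * y))
         (z0 - g * (k * (a * y + h * (d * z0 + z1))) +
          p * (k * (d * z0 + z1 - 2%:R * g * d * y)))).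
  rewrite /= !coordE; congr (rv1 _, rv2 _ _).
  + by rewrite -[RHS]mul1r -[X in _ = X * _]nk /n; ring: gh.
  + by ring.
  + transitivity (n * k * (z1 + d * z0) - d * z0); last by rewrite nk; ring.
    by rewrite /n /r /a; ring: gh d2 p2.
- move=> [x x'] [y y']; rewrite /= /orth_form !formE !coordE; congr (_ * toQ2 _).
  move: (e0 x) (b0 x') (b1 x') (e0 y) (b0 y') (b1 y') => {x x' y y'} x x' x'' y y' y''.
  by rewrite /n /r /a; ring: gh d2 p2.
Qed.

Lemma Z2_unit3 : 3%:R \is a @GRing.unit Z2.
Proof. by have := Z2_odd_unit 1; congr (_ \is a GRing.unit); ring. Qed.

(* In the double hyperbolic plane, (1, 1; 0, 0) and (0, 1; 1, 1) span a copy of the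
   form [true] of scale q, whose orthogonal is the form [true] of scale - q. *)
Lemma binary_hyperbolic_isometric (q : Q2) (q0 : q != 0) (q0' : - q != 0) :
  isometric (orth_sum (binary true q0) (binary true q0'))
            (orth_sum (binary false q0) (binary false q0)).
Proof.
have [k k3] : exists k : Z2, 3%:R * k = 1 by exists 3%:R^-1; rewrite divrr ?Z2_unit3.
apply: (@isometric_intro (orth_sum (binary true q0) (binary true q0'))
  (orth_sum (binary false q0) (binary false q0)) (fun u =>
  (rv2 (b0 u.1 - b0 u.2 - b1 u.2) (b0 u.1 + b1 u.1 + b0 u.2 + b1 u.2),
   rv2 (b1 u.1 + b0 u.2) (b1 u.1 + b1 u.2)))).
- move=> c [x x'] [y y'] /=; rewrite !coordE.
  move: (b0 x) (b1 x) (b0 x') (b1 x') (b0 y) (b1 y) (b0 y') (b1 y')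
    => {x x' y y'} x0 x1 x0' x1' y0 y1 y0' y1'.
  by congr (_, _); rewrite -rv2_linear; congr rv2; ring.
- move=> [y z]; elim/rv2_ind: y => y0 y1; elim/rv2_ind: z => z0 z1.
  pose x0 := k * (y0 + 2%:R * y1 - z0 - z1).
  have x03 : 3%:R * x0 = y0 + 2%:R * y1 - z0 - z1 by rewrite /x0 mulrA k3 mul1r.
  pose x1 := y0 + y1 - 2%:R * x0.
  exists (rv2 x0 x1, rv2 (z0 - x1) (z1 - x1)).
  rewrite /= !coordE; congr (rv2 _ _, rv2 _ _); rewrite /x1; try ring.
    have -> : z0 = y0 + 2%:R * y1 - z1 - 3%:R * x0 by rewrite x03; ring.
    by ring.
  have -> : z0 = y0 + 2%:R * y1 - z1 - 3%:R * x0 by rewrite x03; ring.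
  by ring.
- move=> [x x'] [y y']; rewrite /= /orth_form !formE !coordE.
  rewrite mulNr -[- (q * _)]mulrN -rmorphN scaleQD; congr (_ * toQ2 _).
  move: (b0 x) (b1 x) (b0 x') (b1 x') (b0 y) (b1 y) (b0 y') (b1 y')
    => {x x' y y'} x0 x1 x0' x1' y0 y1 y0' y1'.
  by ring.
Qed.

Lemma orth_formE L M (x y : orth_sum L M) :
  lat_form x y = lat_form x.1 y.1 + lat_form x.2 y.2.
Proof. by []. Qed.

(* The sum-zero vectors of a diagonal cube form a root lattice A_2. *)
Lemma unary3_isometric (q : Q2) (q0 : q != 0) (q3 : q * toQ2 3%:R != 0) :
  isometric (orth_sum (unary q3) (binary true q0))
    (orth_sum (unary q0) (orth_sum (unary q0) (unary q0))).
Proof.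
have [k k3] : exists k : Z2, 3%:R * k = 1 by exists 3%:R^-1; rewrite divrr ?Z2_unit3.
apply: (@isometric_intro (orth_sum (unary q3) (binary true q0))
    (orth_sum (unary q0) (orth_sum (unary q0) (unary q0))) (fun u =>
  (rv1 (e0 u.1 + b0 u.2 + b1 u.2), (rv1 (e0 u.1 - b0 u.2), rv1 (e0 u.1 - b1 u.2))))).
- move=> c [x x'] [y y'] /=; rewrite !coordE.
  move: (e0 x) (b0 x') (b1 x') (e0 y) (b0 y') (b1 y') => {x x' y y'} x x' x'' y y' y''.
  by congr (_, (_, _)); rewrite -rv1_linear; congr rv1; ring.
- move=> [y [z t]]; elim/rv1_ind: y => y; elim/rv1_ind: z => z; elim/rv1_ind: t => t.
  pose x := k * (y + z + t).
  have x3 : 3%:R * x = y + z + t by rewrite /x mulrA k3 mul1r.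
  exists (rv1 x, rv2 (x - z) (x - t)).
  rewrite /= !coordE; congr (rv1 _, (rv1 _, rv1 _)); try ring.
  by transitivity (3%:R * x - z - t); [ring | rewrite x3; ring].
- move=> [x x'] [y y']; rewrite !orth_formE !formE /= !coordE.
  congr (_ * toQ2 _).
  move: (e0 x) (b0 x') (b1 x') (e0 y) (b0 y') (b1 y') => {x x' y y'} x x' x'' y y' y''.
  by ring.
Qed.

(** * The operations are isometries *)

(** An integer rather than an element of Z_2, so that congruences modulo 8 between concrete units
    are decided by computation. The value is junk for type II. *)
Definition unit_of (t : term) : int :=
  match kind_of t, minus t with
  | Receiver, false => - 1
  | Receiver, true => 3
  | _, false => 1
  | _, true => - 3
  end.

Lemma gram_I_unit t : gram_I t = (scale t * toQ2 (unit_of t)%:~R)%:M.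
Proof.
rewrite /gram_I mulrC rmorph_int; congr (_ * _)%:M.
by rewrite /unit_of; case: (kind_of t) (minus t) => -[]; rewrite // rmorphN.
Qed.

Lemma term_unary t q (a : Z2) (qa : q * toQ2 a != 0) :
    type_I t -> scale t * toQ2 (unit_of t)%:~R = q * toQ2 a ->
  isometric (term_lattice t) (unary qa).
Proof.
move=> tI tE; rewrite /term_lattice tI; apply: gram_lattice_eq.
by rewrite gram_I_unit tE.
Qed.

Lemma term_binary t q (q0 : q != 0) : ~~ type_I t -> scale t = q ->
  isometric (term_lattice t) (binary (minus t) q0).
Proof.
move=> /negPf tII tE; rewrite /term_lattice tII; apply: gram_lattice_eq.
by rewrite /gram_II /binary_gram tE.
Qed.

Lemma scale_shift t u (d : nat) : expo u = expo t + d%:Z ->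
  scale u = scale t * toQ2 (2%:R ^+ d).
Proof.
move=> uE; rewrite /scale uE expfzDr ?Q2_nat_neq0 //.
by rewrite rmorphXn rmorph_nat -exprnP.
Qed.

Lemma Z2_neq0_unit (x : Z2) : x \is a GRing.unit -> x != 0.
Proof. by apply: contraTneq => ->; rewrite unitr0. Qed.

Lemma Z2_pow2_neq0 d : 2%:R ^+ d != 0 :> Z2.
Proof.
rewrite expf_neq0 // -(tofrac_eq0 (2%:R : Z2)) rmorph_nat.
exact: Q2_nat_neq0.
Qed.

(** Odd squares are 1 modulo 8, so this says that x and y are odd and congruent modulo 8. *)
Definition inv_mod8 (x y : int) : bool := ((x * y)%R %% 8)%Z == 1.

Lemma inv_mod8_odd x y : inv_mod8 x y -> (x %% 2)%Z = 1 /\ (y %% 2)%Z = 1.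
Proof. rewrite /inv_mod8 => /eqP; nia. Qed.

Lemma inv_mod8_unit x y : inv_mod8 x y ->
  x%:~R \is a @GRing.unit Z2 /\ y%:~R \is a @GRing.unit Z2.
Proof. by move=> /inv_mod8_odd[]; split; apply: Z2_odd_int_unit. Qed.

(** The product x y is 1 modulo 8, hence a square, and x / y is this square divided by y^2. *)
Lemma inv_mod8_square x y : inv_mod8 x y ->
  exists2 s : Z2, s \is a GRing.unit & x%:~R = y%:~R * s ^+ 2.
Proof.
move=> xy; have [x_unit y_unit] := inv_mod8_unit xy.
move/eqP: xy => xy; have [s sE] := Z2_sqrt ((x * y)%R %/ 8)%Z%:~R.
have {}sE : s ^+ 2 = x%:~R * y%:~R.
  rewrite sE -rmorphM [in RHS](divz_eq (x * y) 8) xy.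
  by rewrite rmorphD rmorphM; ring.
have s_unit : s \is a GRing.unit by rewrite -(@unitrX_pos _ s 2) // sE unitrM x_unit.
exists (s / y%:~R); first by rewrite unitrMr ?unitrV.
have -> : (s / y%:~R) ^+ 2 = x%:~R / y%:~R.
  by rewrite expr_div_n sE expr2 invrM // mulrA mulrK.
by rewrite mulrCA divrr ?mulr1.
Qed.

(** With a and b the units of [t] and [u], the vector (1, w) has norm n up to the scale, and its
    orthogonal has unit a b n. An isometry between two type I pairs is thus reduced to the choice of
    [w] and two congruences modulo 8. *)
Lemma type_I_pair (t u t' u' : term) (d : nat) (w : int)
    (n := unit_of t + 2 ^+ d * unit_of u * w ^+ 2) :
    type_I t -> type_I u -> type_I t' -> type_I u' ->
    expo u = expo t + d%:Z -> expo t' = expo t -> expo u' = expo u ->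
    inv_mod8 n (unit_of t') -> inv_mod8 (unit_of t * unit_of u * n) (unit_of u') ->
  isometric (orth_sum (term_lattice t) (term_lattice u))
            (orth_sum (term_lattice t') (term_lattice u')).
Proof.
move=> tI uI t'I u'I ud t'E u'E nt' nu'.
have [n_unit t'_unit] := inv_mod8_unit nt'.
have [nn_unit u'_unit] := inv_mod8_unit nu'.
have [s s_unit sE] := inv_mod8_square nt'.
have [r r_unit rE] := inv_mod8_square nu'.
have q0 := scale_neq0 t; set q := scale t in q0 *.
pose h : Z2 := 2%:R ^+ d; have h0 : h != 0 := Z2_pow2_neq0 d.
have uq : scale u = q * toQ2 h := scale_shift ud.
have t'q : scale t' = q by rewrite /scale t'E.
have u'q : scale u' = q * toQ2 h by rewrite -uq /scale u'E.
have neq0 (x : Z2) : x \is a GRing.unit -> q * toQ2 x != 0.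
  by move=> x_unit; rewrite mulf_neq0 // tofrac_eq0 Z2_neq0_unit.
have neq0' (x : Z2) : x \is a GRing.unit -> q * toQ2 (x * h) != 0.
  by move=> x_unit; rewrite mulf_neq0 // tofrac_eq0 mulf_neq0 // Z2_neq0_unit.
pose a : Z2 := (unit_of t)%:~R; pose b : Z2 := (unit_of u)%:~R.
have [a_unit b_unit] : a \is a GRing.unit /\ b \is a GRing.unit.
  by move: nn_unit; rewrite !rmorphM !unitrM => /andP[/andP[]].
have nE : n%:~R = a + h * b * w%:~R ^+ 2 :> Z2.
  by rewrite /n rmorphD !rmorphM !rmorphXn.
have n'_unit : a + h * b * w%:~R ^+ 2 \is a GRing.unit by rewrite -nE.
have nn'_unit : a * b * (a + h * b * w%:~R ^+ 2) \is a GRing.unit.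
  by rewrite !unitrM a_unit b_unit.
apply: (@isometric_trans (orth_sum (unary (neq0 _ a_unit)) (unary (neq0' _ b_unit)))).
  apply: orth_sum_isometric; apply: term_unary => //.
  by rewrite uq -mulrA -rmorphM [h * _]mulrC.
apply: isometric_trans (isometric_sym (@unary2_isometric q a b h w%:~R
  (neq0 _ n'_unit) (neq0' _ nn'_unit) _ _ n'_unit)) _.
apply: isometric_sym.
apply: (@isometric_trans (orth_sum (unary (neq0 _ t'_unit)) (unary (neq0' _ u'_unit)))).
  apply: orth_sum_isometric; apply: term_unary => //; first by rewrite t'q.
  by rewrite u'q -mulrA -rmorphM [h * _]mulrC.
apply: isometric_sym; apply: orth_sum_isometric.
  by apply: (@unary_isometric _ _ _ s) => //; rewrite -nE.
apply: (@unary_isometric _ _ _ r) => //.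
by rewrite [RHS]mulrAC -rE -nE !rmorphM.
Qed.

Definition iso2 t u t' u' : Prop :=
  isometric (orth_sum (term_lattice t) (term_lattice u))
            (orth_sum (term_lattice t') (term_lattice u')).

Lemma iso2C t u t' u' : iso2 u t u' t' -> iso2 t u t' u'.
Proof.
move=> ut; apply: isometric_trans (orth_sumC _ _) _.
exact: isometric_trans ut (orth_sumC _ _).
Qed.

Lemma iso2_swap t u : iso2 t u u t. Proof. exact: orth_sumC. Qed.

Lemma negateK : involutive negate. Proof. by case=> e m k; rewrite /negate /= negbK. Qed.

Definition relabel (t : term) k := Term (expo t) (minus t) k.

(** In both cases [w] is chosen so that 2^d w^2 = 4: adding 4 b to the unit a, with b odd, reverses
    the sign of the term and keeps its label. *)
Lemma walk_type_I t u (d : nat) : type_I t -> type_I u ->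
  expo u = expo t + d%:Z -> (d == 0)%N || (d == 2)%N ->
  iso2 t u (negate t) (negate u).
Proof.
case: t u => [e m k] [e' m' k'] tI uI /= ud.
case/orP => /eqP d_eq; [have := 2%:Z | have := 1%:Z] => w0.
  by apply: (@type_I_pair _ _ _ _ d 2) => //; rewrite d_eq;
    case: k m k' m' {ud} tI uI => -[] [] [].
by apply: (@type_I_pair _ _ _ _ d 1) => //; rewrite d_eq;
  case: k m k' m' {ud} tI uI => -[] [] [].
Qed.

(** Equal labels mean b = a modulo 4, so the new unit a + 2 b is 3 a modulo 8, and multiplication by
    3 reverses both sign and label. *)
Lemma walk_labels_pair t u : type_I t -> kind_of t = kind_of u ->
  expo u = expo t + 1 ->
  iso2 t u (switch_label (negate t)) (switch_label (negate u)).
Proof.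
case: t u => [e m k] [e' m' k'] tI /= <- ud.
by apply: (@type_I_pair _ _ _ _ 1 1) => //; case: k m m' tI => -[] [].
Qed.

(** Different labels mean b = - a modulo 4, so the new unit a + 2 b is - a modulo 8: the label
    changes and the sign stays. *)
Lemma relabel_pair_adj t u : type_I t -> type_I u -> expo u = expo t + 1 ->
  iso2 t u (relabel t (kind_of u)) (relabel u (kind_of t)).
Proof.
case: t u => [e m k] [e' m' k'] tI uI /= ud.
have [<-|k'k] := eqVneq k k'; first exact: isometric_refl.
by apply: (@type_I_pair _ _ _ _ 1 1) => //; case: k m k' m' {ud} tI uI k'k => -[] [] [].
Qed.

(** At equal scales an exchange of labels is an exchange of the two terms, preceded by a sign walk
    when their signs differ. *)
Lemma relabel_pair_same t u : type_I t -> type_I u -> expo u = expo t ->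
  iso2 t u (relabel t (kind_of u)) (relabel u (kind_of t)).
Proof.
case: t u => [e m k] [e' m' k'] tI uI /= ->.
have [<-|m'm] := eqVneq m m'; first exact: iso2_swap.
have wk := @walk_type_I (Term e m k) (Term e m' k') 0 tI uI (esym (addr0 e)) isT.
apply: isometric_trans wk _; apply: isometric_trans (iso2_swap _ _) _.
rewrite /relabel /negate /=.
have -> : ~~ m' = m by clear -m'm; case: m m' m'm => -[].
have -> : ~~ m = m' by clear -m'm; case: m m' m'm => -[].
exact: isometric_refl.
Qed.

Lemma relabel_pair t u : type_I t -> type_I u -> `|expo t - expo u| <= 1 ->
  iso2 t u (relabel t (kind_of u)) (relabel u (kind_of t)).
Proof.
move=> tI uI tu.
have [ut|[ut|ut]] : expo u = expo t \/ expo u = expo t + 1 \/ expo t = expo u + 1.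
  by lia.
- exact: relabel_pair_same.
- exact: relabel_pair_adj.
- exact/iso2C/relabel_pair_adj.
Qed.

(** Two hyperbolic planes split into the form [true] of scale q and the same form of scale - q, and
    the latter is isometric to the one of scale q. *)
Lemma negate_binary_pair t u : ~~ type_I t -> ~~ type_I u -> expo u = expo t ->
  iso2 t u (negate t) (negate u).
Proof.
suff pair e : iso2 (Term e false TypeII) (Term e false TypeII)
                   (Term e true TypeII) (Term e true TypeII).
  case: t u => [e m []] // [_ m' []] // _ _ /= ->; rewrite /negate /=.
  case: m m' => -[] /=; try exact: iso2_swap; last exact: pair.
  exact/isometric_sym/pair.
have q0 := scale_neq0 (Term e true TypeII).
have q0' : - scale (Term e true TypeII) != 0 by rewrite oppr_eq0.
have T m := @term_binary (Term e m TypeII) _ q0 isT (erefl _).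
apply: isometric_trans (orth_sum_isometric (T _) (T _)) _.
apply: isometric_trans (isometric_sym (binary_hyperbolic_isometric q0 q0')) _.
apply: isometric_sym.
apply: isometric_trans (orth_sum_isometric (T _) (T _)) _.
apply: orth_sum_isometric (isometric_refl _) _.
exact/isometric_sym/binary_isometric_opp.
Qed.

Lemma binary_sign_isometric (q : Q2) (e : Z2) (q0 : q != 0) (qe : q * toQ2 e != 0) :
  e = 1 \/ e = - 1 -> isometric (binary true qe) (binary true q0).
Proof.
case=> eE; subst e.
  by apply: gram_lattice_eq; rewrite rmorph1 mulr1.
have q0' : - q != 0 by rewrite oppr_eq0.
apply: isometric_trans (binary_isometric_opp q0 q0').
by apply: gram_lattice_eq; rewrite rmorphN1 mulrN1.
Qed.

(** The two factors g and h with g h = 2 treat at once the type I term of twice and of half the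
    scale of the type II term; q is the smaller scale in the applications. *)
Lemma walk_types_aux t e (q : Q2) (g h : Z2) : q != 0 -> type_I t ->
    g * h = 2%:R -> scale t = q * toQ2 g ->
    2%:R ^ e = q * toQ2 h ->
  iso2 t (Term e false TypeII) (negate t) (Term e true TypeII).
Proof.
move=> q0 tI gh tE uE.
have [g0 h0] : g != 0 /\ h != 0.
  have := Z2_pow2_neq0 1; rewrite expr1 -gh mulf_eq0 negb_or.
  by move=> /andP.
have gz0 (z : Z2) : z \is a GRing.unit -> q * toQ2 (g * z) != 0.
  by move=> zu; rewrite mulf_neq0 // tofrac_eq0 mulf_neq0 // Z2_neq0_unit.
have hz0 (z : Z2) : z \is a GRing.unit -> q * toQ2 (h * z) != 0.
  by move=> zu; rewrite mulf_neq0 // tofrac_eq0 mulf_neq0 // Z2_neq0_unit.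
have qh : q * toQ2 h != 0 by rewrite mulf_neq0 // tofrac_eq0.
have core (d p : Z2) (z z' : int) : d = 1 \/ d = - 1 -> p * p = p ->
    unit_of t = z -> unit_of (negate t) = z' ->
    z%:~R = - d * (1 + 2%:R * p) -> z'%:~R = - d * (1 + 2%:R * p) + 4%:R * d ->
    z'%:~R \is a @GRing.unit Z2 -> z%:~R \is a @GRing.unit Z2 ->
  iso2 t (Term e false TypeII) (negate t) (Term e true TypeII).
  move=> d1 p2 tz tz' zE z'E z'_unit z_unit.
  have d2 : d * d = 1 by case: d1 => ->; ring.
  have d_unit : - d \is a GRing.unit by case: d1 => ->; rewrite ?opprK ?unitrN unitr1.
  have n_unit : - d * (1 + 2%:R * p) + 4%:R * d \is a GRing.unit by rewrite -z'E.
  have a_unit : - d * (1 + 2%:R * p) \is a GRing.unit by rewrite -zE.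
  apply: isometric_trans (orth_sum_isometric (@term_unary t _ _ (gz0 _ a_unit) tI _)
    (@term_binary (Term e false TypeII) _ qh isT uE)) _.
    by rewrite tE tz zE -mulrA -rmorphM.
  apply: isometric_trans (isometric_sym (@unary_binary_isometric q g h d p
    (gz0 _ n_unit) (hz0 _ d_unit) _ _ gh d2 p2 n_unit)) _.
  apply: isometric_sym.
  apply: isometric_trans (orth_sum_isometric
    (@term_unary (negate t) _ _ (gz0 _ n_unit) tI _)
    (@term_binary (Term e true TypeII) _ qh isT uE)) _.
    by rewrite -[scale (negate t)]/(scale t) tE tz' z'E -mulrA -rmorphM.
  apply: orth_sum_isometric (isometric_refl _) _; apply: isometric_sym.
  have qd : q * toQ2 h * toQ2 (- d) != 0 by rewrite scaleQM hz0.
  apply: isometric_trans (@binary_sign_isometric (q * toQ2 h) (- d) qh qd _).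
    by apply: gram_lattice_eq; rewrite scaleQM.
  by case: d1 => ->; [right | left; rewrite opprK].
have odd z : (z %% 2)%Z = 1 -> z%:~R \is a @GRing.unit Z2 := @Z2_odd_int_unit z.
case: (t) tI core => [? [] []] //= _ core.
- by apply: (core 1 1 (- 3) 1 (or_introl erefl) _ erefl erefl _ _
    (odd 1 erefl) (odd (- 3) erefl)); ring.
- by apply: (core (- 1) 1 3 (- 1) (or_intror erefl) _ erefl erefl _ _
    (odd (- 1) erefl) (odd 3 erefl)); ring.
- by apply: (core (- 1) 0 1 (- 3) (or_intror erefl) _ erefl erefl _ _
    (odd (- 3) erefl) (odd 1 erefl)); ring.
- by apply: (core 1 0 (- 1) 3 (or_introl erefl) _ erefl erefl _ _
    (odd 3 erefl) (odd (- 1) erefl)); ring.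
Qed.

Lemma walk_types_plus t e : type_I t -> `|expo t - e| = 1 ->
  iso2 t (Term e false TypeII) (negate t) (Term e true TypeII).
Proof.
move=> tI te.
have [tE|eE] : expo t = e + 1%:Z \/ e = expo t + 1%:Z by lia.
  have q0 := scale_neq0 (Term e true TypeII).
  have tq : scale t = 2%:R ^ e * toQ2 2%:R.
    by rewrite (@scale_shift (Term e true TypeII) t 1) // expr1.
  have qq : 2%:R ^ e = 2%:R ^ e * toQ2 1 by rewrite rmorph1 mulr1.
  exact: walk_types_aux q0 tI (mulr1 _) tq qq.
have tq : scale t = scale t * toQ2 1 by rewrite rmorph1 mulr1.
have eq : 2%:R ^ e = scale t * toQ2 2%:R.
  by have := @scale_shift t (Term e true TypeII) 1 eE; rewrite expr1.
exact: walk_types_aux (scale_neq0 t) tI (mul1r _) tq eq.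
Qed.

Lemma walk_types_I t u : type_I t -> ~~ type_I u -> `|expo t - expo u| = 1 ->
  iso2 t u (negate t) (negate u).
Proof.
case: u => e [] [] //= tI _ te; last exact: walk_types_plus.
have := @walk_types_plus (negate t) e tI te; rewrite negateK.
exact: isometric_sym.
Qed.

(** The hypothesis is fineness: it excludes a walk between a type I and a type II term of the same
    scale. *)
Lemma walk_pair_isometric t u t' u' : (expo t = expo u -> type_I t = type_I u) ->
  walk_pair t u t' u' -> iso2 t u t' u'.
Proof.
move=> fine_tu; case=> [tu -> ->|tu tuI -> ->|tu tI tuk -> ->|tu tI uI -> ->].
- have tuI := fine_tu tu; case tI: (type_I t); rewrite tI in tuI.
    by apply: (@walk_type_I _ _ 0) => //; rewrite ?addr0.
  by apply: negate_binary_pair; rewrite ?tI -?tuI.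
- case tI: (type_I t); rewrite tI in tuI; first by apply: walk_types_I; case: (type_I u) tuI.
  by apply: iso2C; apply: walk_types_I; rewrite ?tI //; [case: (type_I u) tuI | lia].
- have [ut|ut] : expo u = expo t + 1 \/ expo t = expo u + 1 by lia.
    exact: walk_labels_pair.
  by apply: iso2C; apply: walk_labels_pair => //; rewrite /type_I -tuk.
- have [ut|ut] : expo u = expo t + 2%N \/ expo t = expo u + 2%N by lia.
    exact: (@walk_type_I _ _ 2).
  by apply: iso2C; exact: (@walk_type_I _ _ 2).
Qed.

Lemma iso2_cat t u t' u' r : iso2 t u t' u' ->
  isometric (lattice_of (t :: u :: r)) (lattice_of (t' :: u' :: r)).
Proof.
move=> tu; apply: isometric_trans (orth_sumA _ _ _) _.
apply: isometric_trans (isometric_sym (orth_sumA _ _ _)).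
exact: orth_sum_isometric tu (isometric_refl _).
Qed.

Lemma pair_isometric n (s t : n.-tuple term) (i j : 'I_n) : i != j ->
    (forall k, k != i -> k != j -> tnth t k = tnth s k) ->
    iso2 (tnth s i) (tnth s j) (tnth t i) (tnth t j) ->
  isometric (lattice_of s) (lattice_of t).
Proof.
move=> ij st st_ij; apply: (@local_isometric _ _ _ [:: i; j]).
- by rewrite /= inE ij.
- by move=> k; rewrite !inE negb_or => /andP[]; exact: st.
- exact: iso2_cat.
Qed.

(** * Permutation and conversion of labels in a compartment *)

Definition relabel_tuple n (s : n.-tuple term) (p : 'S_n) : n.-tuple term :=
  [tuple relabel (tnth s i) (kind_of (tnth s (p i))) | i < n].

Lemma relabel_tupleM n (s : n.-tuple term) (p p' : 'S_n) :
  relabel_tuple (relabel_tuple s p) p' = relabel_tuple s (p' * p)%g.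
Proof. by apply: eq_from_tnth => i; rewrite !tnth_mktuple permM. Qed.

Lemma relabel_tuple1 n (s : n.-tuple term) : relabel_tuple s 1%g = s.
Proof.
by apply: eq_from_tnth => i; rewrite tnth_mktuple perm1; case: (tnth s i).
Qed.

Lemma perm_on_mem n (C : {set 'I_n}) (p : 'S_n) i : perm_on C p -> i \in C -> p i \in C.
Proof. by move=> pC iC; rewrite perm_closed. Qed.

Lemma type_I_relabel n (s : n.-tuple term) (p : 'S_n) i :
  type_I (tnth (relabel_tuple s p) i) = type_I (tnth s (p i)).
Proof. by rewrite tnth_mktuple. Qed.

Lemma consecutive_relabel n (s : n.-tuple term) C (p : 'S_n) : perm_on C p ->
  consecutive_type_I s C -> consecutive_type_I (relabel_tuple s p) C.
Proof.
move=> pC [CI [ab ab_le abP]]; split=> [i iC|].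
  by rewrite type_I_relabel CI // perm_on_mem.
exists ab => // e; rewrite -abP.
by split=> -[i iC]; rewrite ?tnth_mktuple /= => ie; exists i; rewrite ?tnth_mktuple.
Qed.

Lemma relabel_tperm_adj n (s : n.-tuple term) (i j : 'I_n) :
    type_I (tnth s i) -> type_I (tnth s j) ->
    `|expo (tnth s i) - expo (tnth s j)| <= 1 ->
  isometric (lattice_of s) (lattice_of (relabel_tuple s (tperm i j))).
Proof.
move=> iI jI ij_adj; have [<-|ij] := eqVneq i j.
  by rewrite tperm1 relabel_tuple1; exact: isometric_refl.
apply: (@pair_isometric _ _ _ i j ij) => [k ki kj|].
  by rewrite tnth_mktuple tpermD 1?eq_sym //; case: (tnth s k).
by rewrite !tnth_mktuple tpermL tpermR; exact: relabel_pair.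
Qed.

Lemma perm_on_tperm n (C : {set 'I_n}) i j : i \in C -> j \in C -> perm_on C (tperm i j).
Proof.
move=> iC jC; apply/subsetP => k; rewrite inE.
by case: tpermP => [->|->|]; rewrite ?eqxx.
Qed.

(** Labels at distant scales are exchanged through a term [l] of intermediate scale, which exists
    because the scales of [C] form an interval. Conjugation writes the transposition as three others
    between closer scales. *)
Lemma relabel_tperm n (s : n.-tuple term) C (i j : 'I_n) :
    consecutive_type_I s C -> i \in C -> j \in C ->
  isometric (lattice_of s) (lattice_of (relabel_tuple s (tperm i j))).
Proof.
have [d] := ubnP `|expo (tnth s i) - expo (tnth s j)|%N.
elim: d s i j => // d IHd s i j ij_d sC iC jC.
have [CI [ab ab_le abP]] := sC.
have [ij_adj|ij_far] := lerP `|expo (tnth s i) - expo (tnth s j)| 1.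
  by apply: relabel_tperm_adj => //; exact: CI.
have [l lC [il lj ile lje]] : exists2 l, l \in C &
    [/\ (`|expo (tnth s i) - expo (tnth s l)| < d)%N,
    (`|expo (tnth s l) - expo (tnth s j)| < d)%N,
    expo (tnth s i) != expo (tnth s l) & expo (tnth s l) != expo (tnth s j)].
  have [lo lo_def] : exists lo, lo = Num.min (expo (tnth s i)) (expo (tnth s j)).
    by eexists.
  have /(abP _).1 iab : exists2 k, k \in C & expo (tnth s k) = expo (tnth s i) by exists i.
  have /(abP _).1 jab : exists2 k, k \in C & expo (tnth s k) = expo (tnth s j) by exists j.
  have [l lC lE] : exists2 l, l \in C & expo (tnth s l) = lo + 1.
    by apply/(abP _).2; lia.
  by exists l => //; split; lia.
have il' : i != l by apply: contraNneq ile => ->.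
have lj' : l != j by apply: contraNneq lje => ->.
have ij : i != j by apply: contraTneq ij_far => ->; rewrite subrr normr0.
have -> : tperm i j = (tperm i l * (tperm l j * tperm i l))%g.
  rewrite -[X in (X * _)%g]tpermV -/(conjg _ _) tpermJ tpermR.
  by rewrite tpermD.
rewrite -2!relabel_tupleM.
have e_relabel (s' : n.-tuple term) p k :
    expo (tnth (relabel_tuple s' p) k) = expo (tnth s' k).
  by rewrite tnth_mktuple.
pose s1 := relabel_tuple s (tperm i l).
have s1C : consecutive_type_I s1 C by apply: consecutive_relabel => //; exact: perm_on_tperm.
pose s2 := relabel_tuple s1 (tperm l j).
have s2C : consecutive_type_I s2 C by apply: consecutive_relabel => //; exact: perm_on_tperm.
apply: isometric_trans (IHd s i l il sC iC lC) _.
apply: (@isometric_trans (lattice_of s2)).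
  by apply: IHd => //; rewrite /s2 /s1 !e_relabel.
by apply: IHd => //; rewrite /s2 /s1 !e_relabel.
Qed.

Lemma relabel_isometric n (s : n.-tuple term) C (p : 'S_n) :
    consecutive_type_I s C -> perm_on C p ->
  isometric (lattice_of s) (lattice_of (relabel_tuple s p)).
Proof.
have [d] := ubnP #|[set x | p x != x]|.
elim: d p s => // d IHd p s p_d sC pC.
have [/eqP p1|[x]] := set_0Vmem [set x | p x != x].
  have -> : p = 1%g.
    apply/permP => x; rewrite perm1; apply/eqP.
    by have /eqP/setP/(_ x) := p1; rewrite !inE => /negbFE.
  by rewrite relabel_tuple1; exact: isometric_refl.
rewrite inE => px.
have xC : x \in C by apply: (subsetP pC); rewrite inE.
have pxC : p x \in C by rewrite perm_on_mem.
have tC := perm_on_tperm xC pxC.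
(* [p'] fixes [p x] as well as every point fixed by [p]. *)
pose p' := (tperm x (p x) * p)%g.
have -> : p = (tperm x (p x) * p')%g by rewrite /p' mulgA tperm2 mul1g.
have p'C : perm_on C p' by rewrite /p' perm_onM.
rewrite -relabel_tupleM.
apply: isometric_trans (IHd p' s _ sC p'C) _.
  rewrite -ltnS; apply: leq_trans p_d; rewrite ltnS.
  apply/proper_card/properP; split.
    apply/subsetP => y; rewrite !inE /p' permM; apply: contraNneq => py.
    case: tpermP => [yx|->|_ _]; rewrite ?py //.
    by case/eqP: px; rewrite -yx py.
  exists (p x); rewrite !inE; first by rewrite (inj_eq perm_inj).
  by rewrite /p' permM tpermR eqxx.
exact: relabel_tperm (consecutive_relabel p'C sC) xC pxC.
Qed.

Definition switch_kind k :=
  match k with TypeII => TypeII | Giver => Receiver | Receiver => Giver end.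

Lemma switch_kindK : involutive switch_kind. Proof. by case. Qed.

Lemma perm_on_two_points n (C : {set 'I_n}) (i j x y : 'I_n) :
    i \in C -> j \in C -> x \in C -> y \in C -> i != j -> x != y ->
  exists p : 'S_n, [/\ perm_on C p, p x = i & p y = j].
Proof.
move=> iC jC xC yC ij xy; pose z := tperm x i y.
have zC : z \in C by rewrite /z; case: tpermP.
(* The first factor sends [x] to [i] and [y] to [z]; the second sends [z] to [j] and leaves [i]
   alone. *)
exists (tperm x i * tperm z j)%g; split.
- by rewrite perm_onM // perm_on_tperm.
- rewrite permM tpermL tpermD //; last by rewrite eq_sym.
  by rewrite -(tpermL x i) (inj_eq perm_inj) eq_sym.
- by rewrite permM -/z tpermL.
Qed.

Definition alter n (s : n.-tuple term) (X K : {set 'I_n}) : n.-tuple term :=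
  [tuple Term (expo (tnth s i)) (minus (tnth s i) (+) (i \in X))
    (if i \in K then switch_kind (kind_of (tnth s i)) else kind_of (tnth s i)) | i < n].

Lemma alter_consecutive n (s : n.-tuple term) X K C :
  consecutive_type_I s C -> consecutive_type_I (alter s X K) C.
Proof.
move=> [CI [ab ab_le abP]]; split=> [i /CI|].
  by rewrite tnth_mktuple /type_I /=; case: ifP; case: kind_of.
exists ab => // e; rewrite -abP.
by split=> -[i iC]; rewrite ?tnth_mktuple /= => ie; exists i; rewrite ?tnth_mktuple.
Qed.

Lemma alter2 n (s : n.-tuple term) (X K K' : {set 'I_n}) : [disjoint K & K'] ->
  alter (alter s X K) X K' = alter s set0 (K :|: K').
Proof.
move=> KK'; apply: eq_from_tnth => i; rewrite !tnth_mktuple /= !inE.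
rewrite -addbA addbb; congr Term.
have := disjointFr KK' (x := i); case: (i \in K) => [->|_] //=.
Qed.

(* The labels of i and j are first moved to x and y, where a sign walk flips them,
   and then moved back. *)
Lemma flip_isometric n (s : n.-tuple term) C (i j x y : 'I_n) :
    consecutive_type_I s C -> i \in C -> j \in C -> x \in C -> y \in C ->
    i != j -> kind_of (tnth s i) = kind_of (tnth s j) ->
    expo (tnth s y) = expo (tnth s x) + 1 ->
  isometric (lattice_of s) (lattice_of (alter s [set x; y] [set i; j])).
Proof.
move=> sC iC jC xC yC ij ij_kind xy_expo.
have xy : x != y by apply: contra_eqN xy_expo => /eqP ->; lia.
have [p [pC px py]] := perm_on_two_points iC jC xC yC ij xy.
have pVC : perm_on C p^-1%g by rewrite perm_onV.
apply: isometric_trans (relabel_isometric sC pC) _.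
set s1 := relabel_tuple s p.
pose s2 : n.-tuple term := alter s1 [set x; y] [set x; y].
have s2C : consecutive_type_I s2 C by apply/alter_consecutive/consecutive_relabel.
apply: (@isometric_trans (lattice_of s2)).
  apply: (@pair_isometric _ _ _ x y xy) => [k kx ky|].
    by rewrite tnth_mktuple !inE (negPf kx) (negPf ky) addbF; case: (tnth s1 k).
  rewrite !tnth_mktuple !inE !eqxx orbT !addbT.
  apply: (@walk_labels_pair (relabel (tnth s x) _) (relabel (tnth s y) _)) => //=.
    by rewrite px; case: sC => CI _; exact: CI.
  by rewrite px py.
have -> : alter s [set x; y] [set i; j] = relabel_tuple s2 p^-1%g.
  apply: eq_from_tnth => k; rewrite !tnth_mktuple /=; congr Term.
  rewrite permKV !inE.
  have -> : (k == i) || (k == j) = ((p^-1)%g k == x) || ((p^-1)%g k == y).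
    by rewrite -px -py -![(p^-1)%g k == _](inj_eq (@perm_inj _ p)) permKV.
  by [].
exact: relabel_isometric s2C pVC.
Qed.

Lemma iso_walk_list e k m1 m2 r : k != TypeII ->
  isometric (lattice_of [:: Term e m1 k, Term e m2 k & r])
            (lattice_of [:: Term e (~~ m1) k, Term e (~~ m2) k & r]).
Proof.
move=> kI; apply: iso2_cat.
exact: (@walk_type_I (Term e m1 k) (Term e m2 k) 0 kI kI (esym (addr0 e)) isT).
Qed.

(** Sign walks at equal scale gather all minus signs on the last term. The resulting sign [m] is the
    same for both labels, so it serves before and after a conversion. *)
Lemma collect_signs e k m1 m2 m3 m4 : k != TypeII ->
  exists m, forall k', (k' == k) || (k' == switch_kind k) ->
  isometric (lattice_of [:: Term e m1 k'; Term e m2 k'; Term e m3 k'; Term e m4 k'])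
    (lattice_of [:: Term e false k'; Term e false k'; Term e false k'; Term e m k']).
Proof.
move=> kI; exists (m1 (+) m2 (+) m3 (+) m4) => k' k'k.
have {k kI k'k} k'I : k' != TypeII by case: k k' kI k'k => -[].
have W := @iso_walk_list e k' _ _ _ k'I.
pose T m := Term e m k'.
have perm24 a b c d : isometric (lattice_of [:: a; b; c; d]) (lattice_of [:: a; d; c; b]).
  by apply: lattice_of_perm; apply/seq.permP => p /=; lia.
have perm12 a b c d : isometric (lattice_of [:: a; b; c; d]) (lattice_of [:: b; a; c; d]).
  by apply: lattice_of_perm; apply/seq.permP => p /=; lia.
have perm13 a b c d : isometric (lattice_of [:: a; b; c; d]) (lattice_of [:: c; b; a; d]).
  by apply: lattice_of_perm; apply/seq.permP => p /=; lia.
have S1 a b c d : isometric (lattice_of [:: T a; T b; T c; T d])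
    (lattice_of [:: T false; T b; T c; T (a (+) d)]).
  case: a => /=; last exact: isometric_refl.
  apply: isometric_trans (perm24 _ _ _ _) _.
  by apply: isometric_trans (W _ _ _) _; exact: perm24.
have S2 a b c d : isometric (lattice_of [:: T a; T b; T c; T d])
    (lattice_of [:: T a; T false; T c; T (b (+) d)]).
  apply: isometric_trans (perm12 _ _ _ _) _.
  by apply: isometric_trans (S1 _ _ _ _) _; exact: perm12.
have S3 a b c d : isometric (lattice_of [:: T a; T b; T c; T d])
    (lattice_of [:: T a; T b; T false; T (c (+) d)]).
  apply: isometric_trans (perm13 _ _ _ _) _.
  by apply: isometric_trans (S1 _ _ _ _) _; exact: perm13.
apply: isometric_trans (S1 _ _ _ _) _.
apply: isometric_trans (S2 _ _ _ _) _.
apply: isometric_trans (S3 _ _ _ _) _.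
rewrite -/(T _); have -> : m3 (+) (m2 (+) (m1 (+) m4)) = m1 (+) m2 (+) m3 (+) m4.
  by case: m1 m2 m3 m4 => -[] [] [].
exact: isometric_refl.
Qed.

(* Thanks to this, a conversion of four labels becomes an exchange of two. *)
Lemma three_equal_units e k m : k != TypeII ->
  isometric (lattice_of [:: Term e false k; Term e false k; Term e false k; m])
    (lattice_of [:: Term e true TypeII; Term e true (switch_kind k); m]).
Proof.
move=> kI; pose t := Term e false k; pose z : Z2 := (unit_of t)%:~R.
have z1 : z = 1 \/ z = - 1.
  rewrite /z /unit_of /=; case: (k) kI => //= _; first by left.
  by right.
have q0 := scale_neq0 t.
have qz : scale t * toQ2 z != 0.
  by rewrite mulf_neq0 // tofrac_eq0; case: z1 => ->; rewrite ?oppr_eq0 oner_eq0.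
have qz1 : scale t * toQ2 z * toQ2 1 != 0 by rewrite rmorph1 mulr1.
have three0 : 3%:R != 0 :> Z2 by rewrite Z2_neq0_unit ?Z2_unit3.
have q3 : scale t * toQ2 z * toQ2 3%:R != 0.
  by rewrite mulf_neq0 // tofrac_eq0.
have tI : isometric (term_lattice t) (unary qz) by exact: term_unary.
apply: isometric_trans (@lattice_of_cat [:: t; t; t] [:: m]) _.
apply: isometric_sym.
apply: isometric_trans (@lattice_of_cat [:: _; _] [:: m]) _.
apply: isometric_sym; apply: orth_sum_isometric (isometric_refl _).
apply: isometric_trans (orth_sum_isometric tI (orth_sum_isometric tI
  (isometric_trans (orth_sum0 _) tI))) _.
apply: isometric_trans (isometric_sym (unary3_isometric qz q3)) _.
apply: isometric_sym; apply: isometric_trans (lattice_of2 _ _) _.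
apply: isometric_trans (orth_sumC _ _) _; apply: orth_sum_isometric.
  apply: term_unary; first by case: (k) kI.
  rewrite scaleQM; congr (_ * toQ2 _).
  by rewrite /z /t /unit_of /=; case: (k) kI => //= _; ring.
apply: isometric_trans (@term_binary (Term e true TypeII) _ q0 isT erefl) _.
exact/isometric_sym/binary_sign_isometric.
Qed.

Lemma convert_four e k m1 m2 m3 m4 : k != TypeII ->
  isometric
    (lattice_of [:: Term e m1 k; Term e m2 k; Term e m3 k; Term e m4 k])
    (lattice_of [:: Term e m1 (switch_kind k); Term e m2 (switch_kind k);
                    Term e m3 (switch_kind k); Term e m4 (switch_kind k)]).
Proof.
move=> kI; have k'I : switch_kind k != TypeII by case: (k) kI.
have [m mP] := collect_signs e m1 m2 m3 m4 kI.
apply: isometric_trans (mP k _) _; first by rewrite eqxx.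
apply: isometric_sym; apply: isometric_trans (mP (switch_kind k) _) _.
  by rewrite eqxx orbT.
apply: isometric_trans (three_equal_units _ _ k'I) _.
apply: isometric_sym; apply: isometric_trans (three_equal_units _ _ kI) _.
(* Both sides now start with the same type II term and differ by an exchange of labels between the
   other two terms. *)
rewrite switch_kindK; apply: orth_sum_isometric (isometric_refl _) _.
apply: (@iso2_cat _ _ _ _ [::]).
exact: (@relabel_pair_same (Term e true (switch_kind k)) (Term e m k) k'I kI).
Qed.

(** If [C] has terms x, y of consecutive scales, two flips through the same x and y switch the four
    labels, and their sign changes cancel. Otherwise [C] has a single scale and [convert_four]
    applies. *)
Lemma conversion_isometric n (s : n.-tuple term) (C A : {set 'I_n}) l :
    consecutive_type_I s C -> A \subset C -> #|A| = 4%N ->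
    (forall i, i \in A -> kind_of (tnth s i) = l) ->
  isometric (lattice_of s) (lattice_of (alter s set0 A)).
Proof.
move=> sC AC A4 Al; have [CI [ab ab_le abP]] := sC.
have size_A : size (enum A) = 4%N by rewrite -cardE.
have [a [b [c [d eA]]]] : exists a b c d, enum A = [:: a; b; c; d].
  by case: (enum A) size_A => [|a [|b [|c [|d []]]]] // _; exists a, b, c, d.
have A_in k : (k \in A) = (k \in [:: a; b; c; d]) by rewrite -eA mem_enum.
have uA : uniq [:: a; b; c; d] by rewrite -eA enum_uniq.
have [aA bA cA dA] : [/\ a \in A, b \in A, c \in A & d \in A].
  by rewrite !A_in !inE !eqxx ?orbT.
have AinC := subsetP AC.
have [[x [y [xC yC xy]]]|no_adj] := pselect (exists x y,
  [/\ x \in C, y \in C & expo (tnth s y) = expo (tnth s x) + 1]).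
  have -> : alter s set0 A = alter (alter s [set x; y] [set a; b]) [set x; y] [set c; d].
    have AE : A = [set a; b] :|: [set c; d].
      by apply/setP => k; rewrite A_in !inE !orbA.
    rewrite alter2 -?AE //.
    rewrite disjoint_subset; apply/subsetP => k.
    move: uA; rewrite /= !inE !negb_or !andbT.
    by move=> /and3P[/and3P[_ ac ad] /andP[bc bd] _] /orP[]/eqP ->; apply/andP.
  have [ab' cd'] : a != b /\ c != d.
    by move: uA; rewrite /= !inE !negb_or !andbT => /and3P[/and3P[]].
  apply: isometric_trans (flip_isometric sC _ _ xC yC ab' _ xy) _; try exact: AinC.
    by rewrite !Al.
  apply: (@flip_isometric _ _ C) => //; try exact: AinC.
  - exact: alter_consecutive.
  - rewrite !tnth_mktuple /= !(Al c) // !(Al d) //.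
    move: uA; rewrite /= !inE !negb_or !andbT.
    move=> /and3P[/and3P[_ ac ad] /andP[bc bd] _].
    by rewrite ![_ == a]eq_sym ![_ == b]eq_sym (negPf ac) (negPf ad) (negPf bc) (negPf bd).
  - by rewrite !tnth_mktuple.
have same : {in C &, forall i j, expo (tnth s i) = expo (tnth s j)}.
  suff le : {in C &, forall i j, expo (tnth s i) <= expo (tnth s j)}.
    by move=> i j iC jC; apply/eqP; rewrite eq_le !le.
  move=> i j iC jC; rewrite leNgt; apply/negP => ji; apply: no_adj.
  have /(abP _).1 iab : exists2 k, k \in C & expo (tnth s k) = expo (tnth s i) by exists i.
  have /(abP _).1 jab : exists2 k, k \in C & expo (tnth s k) = expo (tnth s j) by exists j.
  have [y yC yE] : exists2 y, y \in C & expo (tnth s y) = expo (tnth s j) + 1.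
    by apply/(abP _).2; lia.
  by exists j, y.
have lI : l != TypeII by have := CI a (AinC a aA); rewrite /type_I (Al a aA).
apply: (@local_isometric _ _ _ [:: a; b; c; d] uA) => [k kA|].
  by rewrite tnth_mktuple A_in (negPf kA) inE addbF; case: (tnth s k).
have termE k : k \in A -> tnth s k = Term (expo (tnth s a)) (minus (tnth s k)) l.
  move=> kA; rewrite -(Al k kA) (same a k) ?AinC //; by case: (tnth s k).
have termE' k : k \in A ->
    tnth (alter s set0 A) k = Term (expo (tnth s a)) (minus (tnth s k)) (switch_kind l).
  by move=> kA; rewrite tnth_mktuple kA inE addbF (Al k kA) (same a k) ?AinC.
rewrite [map _ _]/= [X in isometric _ (lattice_of X)]/=.
rewrite !termE' // (termE a) // (termE b) // (termE c) // (termE d) //=.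
exact: convert_four.
Qed.

(** * Fineness along the operations *)

Definition fine_tuple n (s : n.-tuple term) : Prop :=
  forall i j, expo (tnth s i) = expo (tnth s j) ->
    type_I (tnth s i) = type_I (tnth s j).

Lemma fine_symbol_tuple n (s : n.-tuple term) :
  fine_symbol (seq_mset s) <-> fine_tuple s.
Proof.
have in_s t : (t \in seq_mset s) = (t \in (s : seq term)).
  exact: perm_mem (perm_eq_seq_mset s) t.
split=> [sF i j ij|sF t u].
  have iS : tnth s i \in seq_mset s by rewrite in_s mem_tnth.
  have jS : tnth s j \in seq_mset s by rewrite in_s mem_tnth.
  have := sF _ _ iS jS; have := sF _ _ jS iS.
  rewrite ij; case: type_I; case: type_I => // H1 H2.
    by have := H2 isT erefl.
  by have := H1 isT erefl.
rewrite !in_s => /tnthP[i ->] /tnthP[j ->] iII ji.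
by rewrite -(sF i j).
Qed.

Lemma fine_tuple_same n (s t : n.-tuple term) :
    (forall i, expo (tnth t i) = expo (tnth s i)) ->
    (forall i, type_I (tnth t i) = type_I (tnth s i)) ->
  fine_tuple s -> fine_tuple t.
Proof. by move=> e_st I_st sF i j; rewrite !e_st !I_st; exact: sF. Qed.

Lemma sign_walking_isometric n (s t : n.-tuple term) : fine_tuple s ->
  sign_walking s t -> isometric (lattice_of s) (lattice_of t) /\ fine_tuple t.
Proof.
move=> sF [i [j [ij walk st]]]; split.
  exact: pair_isometric ij st (walk_pair_isometric (sF i j) walk).
have [ei ej Ii Ij] : [/\ expo (tnth t i) = expo (tnth s i),
    expo (tnth t j) = expo (tnth s j), type_I (tnth t i) = type_I (tnth s i)
  & type_I (tnth t j) = type_I (tnth s j)].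
  case: walk => [_ -> ->|_ _ -> ->|_ _ _ -> ->|_ _ _ -> ->]; split=> //;
    by rewrite /type_I /=; case: kind_of.
apply: (@fine_tuple_same _ s) => // k.
  by have [->//|ki] := eqVneq k i; have [->//|kj] := eqVneq k j; rewrite st.
by have [->//|ki] := eqVneq k i; have [->//|kj] := eqVneq k j; rewrite st.
Qed.

Lemma operation_isometric S T : fine_symbol S -> operation S T ->
  isometric (symbol_lattice S) (symbol_lattice T) /\ fine_symbol T.
Proof.
move=> SF [n [s [t [SE TE op]]]]; subst S T.
move/fine_symbol_tuple: SF => sF.
suff [st tF] : isometric (lattice_of s) (lattice_of t) /\ fine_tuple t.
  split; last exact/fine_symbol_tuple.
  apply: isometric_trans (symbol_lattice_seq _) _.
  exact: isometric_trans st (isometric_sym (symbol_lattice_seq _)).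
case: op => [walk|[C [p [[sC _] pC tE]]]|[C [A [l [[sC _] AC A4 Al tE]]]]].
- exact: sign_walking_isometric.
- have -> : t = relabel_tuple s p.
    by apply: eq_from_tnth => i; rewrite tE tnth_mktuple.
  split; first exact: relabel_isometric sC pC.
  apply: (@fine_tuple_same _ s) => // i; rewrite tnth_mktuple //.
  have [iC|iC] := boolP (i \in C); last by rewrite (out_perm pC).
  by case: sC => CI _; rewrite (CI i iC); exact/CI/perm_on_mem.
- have -> : t = alter s set0 A.
    apply: eq_from_tnth => i; rewrite tE tnth_mktuple inE addbF.
    by case: ifP => _ //; case: (tnth s i).
  split; first exact: conversion_isometric sC AC A4 Al.
  apply: (@fine_tuple_same _ s) => // i; rewrite tnth_mktuple //.
  by rewrite /type_I /=; case: ifP; case: kind_of.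
Qed.

Lemma obtained_isometric S T : fine_symbol S -> obtained_from S T ->
  isometric (symbol_lattice S) (symbol_lattice T) /\ fine_symbol T.
Proof.
move=> SF ST; elim: ST SF => [{}S {}T op|{}S|{}S U {}T _ IH1 _ IH2] SF.
- exact: operation_isometric.
- by split; first exact: isometric_refl.
- have [SU UF] := IH1 SF; have [UT TF] := IH2 UF.
  by split => //; exact: isometric_trans SU UT.
Qed.

(** * Gauss sums *)

Lemma Z2_nat_residue i k : (i%:R : Z2) k = (i %% 2 ^ k)%N.
Proof.
elim: i => [|i IHi]; first by rewrite mulr0n mod0n /= mod0n.
by rewrite -natr1 residueD IHi modnDml /= modnDmr addn1.
Qed.

Definition cong (V : lmodType Z2) k (x y : V) : Prop :=
  exists z, x = y + 2%:R ^+ k *: z.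

Lemma cong_refl (V : lmodType Z2) k (x : V) : cong k x x.
Proof. by exists 0; rewrite scaler0 addr0. Qed.

Lemma cong_trans (V : lmodType Z2) k (x y z : V) :
  cong k x y -> cong k y z -> cong k x z.
Proof. by move=> [u ->] [v ->]; exists (v + u); rewrite scalerDr addrA. Qed.

Lemma residue_pow2M (x : Z2) e k : (2%:R ^+ e * x) (e + k)%N = (2 ^ e * x k)%N.
Proof.
elim: e => [|e IHe]; first by rewrite expr0 mul1r mul1n.
by rewrite exprS -mulrA addSn residue_double IHe mulnA expnS.
Qed.

Lemma residue_pow2M0 (x : Z2) k : (2%:R ^+ k * x) k = 0%N.
Proof. by have := residue_pow2M x k 0; rewrite addn0 residue0 muln0. Qed.

Lemma Z2_dvd_pow2 (x : Z2) k : x k = 0%N -> exists z, x = 2%:R ^+ k * z.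
Proof.
move=> xk; pose u n := (x (k + n) %/ 2 ^ k)%N.
have k_dvd n : (2 ^ k %| x (k + n))%N by rewrite /dvdn residue_le ?leq_addr ?xk.
have uP n : (u n.+1 %% 2 ^ n = u n)%N.
  have p_gt0 : (0 < 2 ^ k)%N by rewrite expn_gt0.
  apply/eqP; rewrite -(eqn_pmul2l p_gt0) muln_modr /u ![(2 ^ k * _)%N]mulnC !divnK //.
  by rewrite mulnC -expnD addnS residueP.
exists (MkZ2 uP); apply: Z2_eq => n; have [kn|nk] := leqP k n.
  by rewrite -(subnKC kn) residue_pow2M /= /u mulnC divnK.
have n_le : (n <= k)%N := ltnW nk.
by rewrite -(residue_le x n_le) xk mod0n -(residue_le _ n_le) residue_pow2M0 mod0n.
Qed.

Lemma Z2_cong (x y : Z2) k : x k = y k -> cong k (x : Z2^o) y.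
Proof.
move=> xy; have [|z zE] := @Z2_dvd_pow2 (x - y) k.
  by rewrite residueD xy -residueD subrr /= mod0n.
by exists z; apply/eqP; rewrite addrC -subr_eq; apply/eqP; exact: zE.
Qed.

Lemma cong_residue (x y : Z2) k : cong k (x : Z2^o) y -> x k = y k.
Proof.
by move=> [z ->]; rewrite residueD residue_pow2M0 addn0 residue_mod.
Qed.

(** Takes the place of the quotient V / 2^k V: a sum over the quotient is a sum over any
    transversal. *)
Definition transversal (V : lmodType Z2) k (I : finType) (r : I -> V) : Prop :=
  forall x, exists2 i, cong k x (r i) & forall j, cong k x (r j) -> j = i.

Definition periodic (V : lmodType Z2) k (F : V -> algC) : Prop :=
  forall x y, cong k x y -> F x = F y.

Lemma transversal_sum (V : lmodType Z2) k (I J : finType) (r : I -> V) (r' : J -> V) F :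
    transversal k r -> transversal k r' -> periodic k F ->
  \sum_i F (r i) = \sum_j F (r' j).
Proof.
move=> rT r'T F_per.
have /choice[h hP] : forall i, exists j, cong k (r i) (r' j).
  by move=> i; have [j] := r'T (r i); exists j.
have /choice[h' h'P] : forall j, exists i, cong k (r' j) (r i).
  by move=> j; have [i] := rT (r' j); exists i.
have hK : cancel h h'.
  move=> i; have [i0 _ i0P] := rT (r i).
  rewrite [RHS](i0P i (cong_refl _ _)); apply: i0P.
  by apply: cong_trans (hP _) (h'P _).
have h'K : cancel h' h.
  move=> j; have [j0 _ j0P] := r'T (r' j).
  rewrite [RHS](j0P j (cong_refl _ _)); apply: j0P.
  by apply: cong_trans (h'P _) (hP _).
rewrite [RHS](reindex h); last by exists h' => i _; [exact: hK | exact: h'K].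
by apply: eq_bigr => i _; exact: F_per.
Qed.

Lemma nat_transversal k : transversal k (fun i : 'I_(2 ^ k) => (i%:R : Z2^o)).
Proof.
move=> x; have xk : (x k < 2 ^ k)%N.
  by rewrite -(residue_mod x k) ltn_mod expn_gt0.
exists (Ordinal xk) => [|j xj].
  by apply: Z2_cong; rewrite Z2_nat_residue /= residue_mod.
by apply: val_inj; rewrite /= (cong_residue xj) Z2_nat_residue modn_small.
Qed.

(** * Sums over L / 2^k L as isometry invariants *)

Definition integral_form (c : Q2) (L : lattice) : Prop :=
  forall x y : L, exists z, toQ2 z = c * lat_form x y.

(* The scaled form with values in Z_2; its value is junk when [integral_form] fails. *)
Definition sform (c : Q2) (L : lattice) (x y : L) : Z2 :=
  if pselect (exists z, toQ2 z = c * lat_form x y) is left zP then projT1 (cid zP) else 0.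

Lemma toQ2_inj : injective toQ2.
Proof. by move=> x y /eqP; rewrite tofrac_eq => /eqP. Qed.

Lemma sformP (c : Q2) (L : lattice) (x y : L) z : toQ2 z = c * lat_form x y -> sform c x y = z.
Proof.
move=> zE; rewrite /sform; case: pselect => [zP|[]]; last by exists z.
by case: cid => z' /= z'E; apply: toQ2_inj; rewrite z'E zE.
Qed.

Lemma sformE (c : Q2) (L : lattice) (x y : L) :
  integral_form c L -> toQ2 (sform c x y) = c * lat_form x y.
Proof. by move=> /(_ x y)[z zE]; rewrite (sformP zE). Qed.

Lemma sform_linear c (L : lattice) (z x y : L) a : integral_form c L ->
  sform c (a *: x + y) z = a * sform c x z + sform c y z.
Proof.
move=> L_int; apply: sformP.
by rewrite rmorphD rmorphM /= !sformE // lat_linear mulrDr mulrCA.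
Qed.

Lemma sform_sym c (L : lattice) (x y : L) : integral_form c L ->
  sform c x y = sform c y x.
Proof. by move=> L_int; apply: sformP; rewrite sformE // lat_sym. Qed.

(* A weight is a function on L / 2^k L defined uniformly for all lattices and
   multiplicative on orthogonal sums; its sum over L / 2^k L is then a
   multiplicative isometry invariant. *)
Record weight c k (w : forall L : lattice, L -> algC) : Prop := Weight {
  weight_periodic : forall L, integral_form c L -> periodic k (@w L);
  weight_isometric : forall (L M : lattice) (f : {linear L -> M}), bijective f ->
    (forall x y, lat_form (f x) (f y) = lat_form x y) ->
    integral_form c L -> forall x, w M (f x) = w L x;
  weight_orth : forall L M, integral_form c L -> integral_form c M ->
    forall x : orth_sum L M, w _ x = w L x.1 * w M x.2;
  weight_zero : forall x : zero_lattice, w _ x = 1 }.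

(** A relation rather than a function, so that each lattice may be summed over a transversal at
    hand; [total_unique] shows that the value does not depend on it. *)
Definition total k (w : forall L : lattice, L -> algC) (L : lattice) (v : algC) : Prop :=
  exists (I : finType) (r : I -> L), transversal k r /\ v = \sum_i w L (r i).

Lemma integral_isometric c L M : isometric L M -> integral_form c L -> integral_form c M.
Proof.
move=> /isometric_sym[f _ f_form] L_int x y; rewrite -f_form; exact: L_int.
Qed.

Lemma total_isometric c k w L M v : weight c k w -> isometric L M ->
  integral_form c L -> total k w L v -> total k w M v.
Proof.
move=> wW [f f_bij f_form] L_int [I [r [rT ->]]].
exists I, (f \o r); split.
  move=> y; have [f' fK f'K] := f_bij; have [i [z zE] iP] := rT (f' y).
  have yE : y = f (f' y) by rewrite f'K.
  exists i => [|j [u uE]].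
    by exists (f z); rewrite yE zE linearD linearZ.
  apply: iP; exists (f' u); apply: (bij_inj f_bij).
  by rewrite linearD linearZ !f'K.
by apply: eq_bigr => i _; rewrite /= (weight_isometric wW f_bij f_form L_int).
Qed.

Lemma total_unique c k w L v v' : weight c k w -> integral_form c L ->
  total k w L v -> total k w L v' -> v = v'.
Proof.
move=> wW L_int [I [r [rT ->]]] [J [r' [r'T ->]]].
exact: transversal_sum rT r'T (weight_periodic wW L_int).
Qed.

Lemma total_orth c k w L M v v' : weight c k w ->
    integral_form c L -> integral_form c M ->
  total k w L v -> total k w M v' -> total k w (orth_sum L M) (v * v').
Proof.
move=> wW L_int M_int [I [r [rT ->]]] [J [r' [r'T ->]]].
exists (I * J)%type, (fun u => (r u.1, r' u.2)); split.
  move=> [x y]; have [i [z zE] iP] := rT x; have [j [u uE] jP] := r'T y.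
  exists (i, j) => /= [|[i' j'] /= [[z' u'] [zE' uE']]].
    by exists (z, u); rewrite zE uE.
  by congr (_, _); [apply: iP; exists z' | apply: jP; exists u'].
rewrite mulr_suml; under eq_bigr do rewrite mulr_sumr.
rewrite pair_bigA /=.
by apply: eq_bigr => -[i j] _; rewrite (weight_orth wW L_int M_int).
Qed.

Lemma integral_orth c L M : integral_form c L -> integral_form c M ->
  integral_form c (orth_sum L M).
Proof.
move=> L_int M_int x y; have [z zE] := L_int x.1 y.1; have [u uE] := M_int x.2 y.2.
by exists (z + u); rewrite orth_formE mulrDr rmorphD /= zE uE.
Qed.

Lemma zero_lattice0 (x : zero_lattice) : x = 0.
Proof. by apply/rowP => -[]. Qed.

Lemma integral_zero c : integral_form c zero_lattice.
Proof.
by move=> x y; exists 0; rewrite rmorph0 (zero_lattice0 y) lat_form0 mulr0.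
Qed.

Lemma total_zero c k w : weight c k w -> total k w zero_lattice 1.
Proof.
move=> wW; exists unit, (fun=> 0); split.
  by move=> x; exists tt => [|[]//]; rewrite (zero_lattice0 x); exact: cong_refl.
by rewrite big_const card_unit /= addr0 (weight_zero wW).
Qed.

Lemma total_lattice_of c k w (s : seq term) (val : term -> algC) : weight c k w ->
    {in s, forall t, integral_form c (term_lattice t)} ->
    {in s, forall t, total k w (term_lattice t) (val t)} ->
  integral_form c (lattice_of s) /\ total k w (lattice_of s) (\prod_(t <- s) val t).
Proof.
move=> wW; elim: s => [|t s IHs] t_int t_tot.
  by rewrite big_nil; split; [exact: integral_zero | exact: total_zero wW].
have [|s_int s_tot] := IHs (fun u us => t_int u (mem_behead (s := t :: s) us)).
  by move=> u us; apply: t_tot; rewrite inE us orbT.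
have ts := mem_head t s.
rewrite big_cons; split; first exact: integral_orth (t_int t ts) s_int.
exact: total_orth wW (t_int t ts) s_int (t_tot t ts) s_tot.
Qed.

(* [root2 k] is a primitive 2^k-th root of unity. *)
Fixpoint root2 (k : nat) : algC :=
  if k is k'.+1 then (if k' is _.+1 then sqrtC (root2 k') else - 1) else 1.

Lemma root2S k : root2 k.+1 ^+ 2 = root2 k.
Proof.
case: k => [|k]; first by rewrite /= sqrrN expr1n.
by rewrite -[root2 k.+2]/(sqrtC (root2 k.+1)) sqrtCK.
Qed.

Lemma root2_pow2 k : root2 k ^+ (2 ^ k) = 1.
Proof. by elim: k => // k IHk; rewrite expnS exprM root2S. Qed.

Lemma root2_neq0 k : root2 k != 0.
Proof.
apply: contra_eq_neq (root2_pow2 k) => ->.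
by rewrite expr0n expn_eq0 /= eq_sym oner_eq0.
Qed.

Lemma root2_mod k m : root2 k ^+ (m %% 2 ^ k) = root2 k ^+ m.
Proof.
by rewrite [in RHS](divn_eq m (2 ^ k)) exprD mulnC exprM root2_pow2 expr1n mul1r.
Qed.

(** The additive character of Z_2 of level k, that is, exp (2 pi i x / 2^k) for the chosen root of
    unity. *)
Definition psi k (x : Z2) : algC := root2 k ^+ x k.

Lemma psiD k x y : psi k (x + y) = psi k x * psi k y.
Proof. by rewrite /psi residueD root2_mod exprD. Qed.

Lemma psi_pow2 e k x : psi (e + k) (2%:R ^+ e * x) = psi k x.
Proof.
rewrite /psi residue_pow2M exprM; congr (_ ^+ _).
by elim: e => [|e IHe]; rewrite ?expr1 // addSn expnS exprM root2S.
Qed.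

Lemma psi_pow2_id k x : psi k (2%:R ^+ k * x) = 1.
Proof. by rewrite /psi residue_pow2M0. Qed.

Lemma psi0 k : psi k 0 = 1.
Proof. by rewrite -(mulr0 (2%:R ^+ k)) psi_pow2_id. Qed.

Lemma psi_cong k (x y : Z2) : x k = y k -> psi k x = psi k y.
Proof. by rewrite /psi => ->. Qed.

Lemma psi_odd m : psi 1 (1 + 2%:R * m) = - 1.
Proof.
rewrite psiD -[2%:R]expr1 psi_pow2_id mulr1 /psi.
by rewrite (_ : (1 : Z2) 1%N = 1%N) ?expr1.
Qed.

(** * Gauss sums of rank one and two *)

Definition zsum k (h : Z2 -> algC) : algC := \sum_(i < 2 ^ k) h i%:R.

Definition periodicZ k (h : Z2 -> algC) : Prop := forall x y : Z2, x k = y k -> h x = h y.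

Lemma eq_zsum k h h' : h =1 h' -> zsum k h = zsum k h'.
Proof. by move=> hh; apply: eq_bigr => i _. Qed.

Lemma zsum_const k c : zsum k (fun=> c) = 2%:R ^+ k * c.
Proof. by rewrite /zsum sumr_const card_ord -natrX mulr_natl. Qed.

Lemma zsumZ k h c : zsum k (fun x => c * h x) = c * zsum k h.
Proof. by rewrite /zsum mulr_sumr. Qed.

Lemma zsum_double k h : periodicZ k h -> zsum k.+1 h = 2%:R * zsum k h.
Proof.
move=> h_per; rewrite /zsum expnS mul2n -addnn big_split_ord /=.
rewrite mulr_natl mulr2n; congr (_ + _); apply: eq_bigr => i _; apply: h_per.
by rewrite !Z2_nat_residue modnDl.
Qed.

Lemma zsum_pow2 d k h : periodicZ k h -> zsum (d + k) h = 2%:R ^+ d * zsum k h.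
Proof.
move=> h_per; elim: d => [|d IHd]; first by rewrite mul1r.
rewrite addSn zsum_double ?IHd ?exprS ?mulrA // => x y xy; apply: h_per.
by rewrite -(residue_le x (leq_addl d k)) xy residue_le ?leq_addl.
Qed.

Lemma zsum_parity k h :
  zsum k.+1 h = zsum k (fun x => h (2%:R * x)) + zsum k (fun x => h (1 + 2%:R * x)).
Proof.
rewrite /zsum -big_split /= expnS; elim: (2 ^ k)%N => [|m IHm].
  by rewrite muln0 !big_ord0.
rewrite mulnS !big_ord_recr /= IHm -addrA; congr (_ + (h _ + h _)).
  by rewrite natrM.
by rewrite mulrS natrM.
Qed.

Lemma zsum_shift k h c : periodicZ k h -> zsum k (fun x => h (x + c)) = zsum k h.
Proof.
move=> h_per; rewrite /zsum.
apply: (@transversal_sum Z2^o k _ _ (fun i : 'I_(2 ^ k) => (i%:R + c : Z2^o))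
  (fun i : 'I_(2 ^ k) => (i%:R : Z2^o)) h).
- move=> x; have [i [z xE] iP] := @nat_transversal k (x - c).
  exists i => [|j [u xuE]]; first by exists z; rewrite addrAC -xE subrK.
  by apply: iP; exists u; rewrite xuE addrAC addrK.
- exact: nat_transversal.
- by move=> x y xy; apply/h_per/cong_residue.
Qed.

(** A translation both preserves and negates the sum. The recursions for Gauss sums discard their
    odd arguments in this way. *)
Lemma zsum_antiperiod k h c : periodicZ k h -> (forall x, h (x + c) = - h x) ->
  zsum k h = 0.
Proof.
move=> h_per h_anti; have := zsum_shift c h_per.
rewrite (eq_zsum _ h_anti) {1}/zsum sumrN => /eqP.
by rewrite eq_sym -addr_eq0 -mulr2n mulrn_eq0 /= => /eqP.
Qed.

Definition gauss1 j (a : Z2) := zsum j (fun x => psi j (a * x ^+ 2)).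

Lemma cong_sub (x y : Z2) k : x k = y k -> exists z, x = y + 2%:R ^+ k * z.
Proof. by move=> /Z2_cong[z zE]; exists z. Qed.

Lemma sqr_residue (x y : Z2) a k : x k = y k -> (a * x ^+ 2) k = (a * y ^+ 2) k.
Proof. by move=> xy; rewrite !expr2 !residueM xy. Qed.

(** Adding 2^(j + 2) to an odd argument changes its square by an odd multiple of 2^(j + 3), half a
    period, so odd arguments cancel in pairs. Even arguments bring a factor 4, which lowers the
    level by two. *)
Lemma gauss1_rec j m : gauss1 j.+4 (1 + 2%:R * m) = 2%:R * gauss1 j.+2 (1 + 2%:R * m).
Proof.
set a := 1 + 2%:R * m; rewrite /gauss1 zsum_parity.
rewrite [X in _ + X](@zsum_antiperiod _ _ (2%:R ^+ j.+1)) ?addr0.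
- rewrite -zsum_double; last by move=> x y xy; apply/psi_cong/sqr_residue.
  apply: eq_zsum => x; rewrite -(psi_pow2 2 j.+2); congr psi; ring.
- move=> x y xy; apply: psi_cong.
  have [z ->] := cong_sub xy.
  have -> : a * (1 + 2%:R * (y + 2%:R ^+ j.+3 * z)) ^+ 2 =
     a * (1 + 2%:R * y) ^+ 2 + 2%:R ^+ j.+4 *
      (a * (z * 2%:R * (1 + 2%:R * y) + 2%:R ^+ j.+4 * z ^+ 2)).
    by rewrite !exprS; ring.
  by rewrite residueD residue_pow2M0 addn0 residue_mod.
- move=> x.
  have -> : a * (1 + 2%:R * (x + 2%:R ^+ j.+1)) ^+ 2 =
     a * (1 + 2%:R * x) ^+ 2 + (2%:R ^+ j.+3 * (1 + 2%:R * (m + a * x)) +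
      2%:R ^+ j.+4 * (a * 2%:R ^+ j)).
    by rewrite /a !exprS; ring.
  rewrite !psiD psi_pow2_id mulr1.
  by rewrite -[in psi _ (_ * (1 + _))](addn1 j.+3) psi_pow2 psi_odd mulrN1.
Qed.

Lemma zsum1 h : zsum 1 h = h 0 + h 1.
Proof. by rewrite /zsum !big_ord_recl big_ord0 /= addr0. Qed.

Lemma zsum0 h : zsum 0 h = h 0.
Proof. by rewrite /zsum !big_ord_recl big_ord0 /= addr0. Qed.

Lemma gauss1_2 a : gauss1 2 a = 2%:R * (1 + psi 2 a).
Proof.
rewrite /gauss1 zsum_parity !zsum1.
have -> : a * (2%:R * 0) ^+ 2 = 0 by ring.
have -> : a * (2%:R * 1) ^+ 2 = 2%:R ^+ 2 * a by ring.
have -> : a * (1 + 2%:R * 0) ^+ 2 = a by ring.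
have -> : a * (1 + 2%:R * 1) ^+ 2 = a + 2%:R ^+ 2 * (2%:R * a) by ring.
by rewrite psiD !psi_pow2_id psi0; ring.
Qed.

(** The four odd squares are 1 modulo 8, and the contributions of the even squares 0, 4, 0, 4
    cancel. *)
Lemma gauss1_3 m : gauss1 3 (1 + 2%:R * m) = 4%:R * psi 3 (1 + 2%:R * m).
Proof.
set a := 1 + 2%:R * m; rewrite /gauss1 zsum_parity.
rewrite [X in X + _](_ : _ = 0).
  rewrite add0r zsum_parity !zsum1.
  have per (z u : Z2) : psi 3 (z + 2%:R ^+ 3 * u) = psi 3 z.
    by rewrite psiD psi_pow2_id mulr1.
  have -> : a * (1 + 2%:R * (2%:R * 0)) ^+ 2 = a by ring.
  have -> : a * (1 + 2%:R * (2%:R * 1)) ^+ 2 = a + 2%:R ^+ 3 * (3%:R * a) by ring.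
  have -> : a * (1 + 2%:R * (1 + 2%:R * 0)) ^+ 2 = a + 2%:R ^+ 3 * a by ring.
  have -> : a * (1 + 2%:R * (1 + 2%:R * 1)) ^+ 2 = a + 2%:R ^+ 3 * (6%:R * a) by ring.
  by rewrite !per; ring.
rewrite zsum_parity !zsum1.
have -> : a * (2%:R * (2%:R * 0)) ^+ 2 = 0 by ring.
have -> : a * (2%:R * (2%:R * 1)) ^+ 2 = 2%:R ^+ 3 * (2%:R * a) by ring.
have -> : a * (2%:R * (1 + 2%:R * 0)) ^+ 2 = 2%:R ^+ 2 * (1 + 2%:R * m) by rewrite /a; ring.
have -> : a * (2%:R * (1 + 2%:R * 1)) ^+ 2 =
    2%:R ^+ 3 * (4%:R * a) + 2%:R ^+ 2 * (1 + 2%:R * m) by rewrite /a; ring.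
rewrite psiD !psi_pow2_id psi0 (psi_pow2 2 1) psi_odd; ring.
Qed.

(** The origin of the vanishing at type I terms of scale 2^K: in the sum of level K + 1 exactly one
    level is left to them. *)
Lemma gauss1_1 m : gauss1 1 (1 + 2%:R * m) = 0.
Proof.
rewrite /gauss1 zsum1; have -> : (1 + 2%:R * m) * 0 ^+ 2 = 0 by ring.
by rewrite expr1n mulr1 psi_odd psi0 subrr.
Qed.

Definition receiver t : nat := if kind_of t is Receiver then 1 else 0.

Lemma unit_of_odd t : exists m : Z2, (unit_of t)%:~R = 1 + 2%:R * m.
Proof.
rewrite /unit_of; case: (kind_of t) (minus t) => -[].
- by exists (- 2%:R); ring.
- by exists 0; ring.
- by exists (- 2%:R); ring.
- by exists 0; ring.
- by exists 1; ring.
- by exists (- 1); ring.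
Qed.

Lemma psi1_1 : psi 1 1 = - 1.
Proof. by rewrite -[RHS](psi_odd 0); congr psi; ring. Qed.

(** Modulo 4 only the label is visible: the unit is 1 for givers and - 1 for receivers. *)
Lemma psi_unit_2 t : psi 2 (unit_of t)%:~R = psi 2 1 * (- 1) ^+ receiver t.
Proof.
rewrite /unit_of /receiver; case: (kind_of t) (minus t) => -[]; rewrite ?expr0 ?mulr1 //.
- rewrite [X in psi _ X = _](_ : _ = 1 + 2%:R ^+ 1 * (1 + 2%:R * 0)); last by ring.
  by rewrite psiD (psi_pow2 1 1) psi_odd expr1.
- rewrite [X in psi _ X = _](_ : _ = 1 + 2%:R ^+ 1 * (1 + 2%:R * (- 2%:R)) + 2%:R ^+ 2 * 1);
    last by ring.
  by rewrite !psiD (psi_pow2 1 1) psi_pow2_id mulr1 psi_odd expr1.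
Qed.

Lemma psi2_1 : psi 2 1 = root2 2.
Proof. by rewrite /psi (_ : (1 : Z2) 2%N = 1%N) ?expr1. Qed.

Lemma iota_sqr : (- root2 2) ^+ 2 = - 1.
Proof. by rewrite sqrrN root2S. Qed.

(** Modulo 8 the unit is 1 - 2 (r + 2 m), with r = 1 for receivers and m = 1 for minus signs, and
    the value of [psi 3] at - 2 is [- root2 2]. *)
Lemma psi_unit_3 t :
  psi 3 (unit_of t)%:~R = psi 3 1 * (- root2 2) ^+ (receiver t + 2 * minus t).
Proof.
have i2 : psi 2 1 = root2 2 := psi2_1.
have i4 (z : Z2) : psi 3 (2%:R ^+ 2 * z) = psi 1 z := psi_pow2 2 1 z.
have i1 (z : Z2) : psi 3 (2%:R ^+ 1 * z) = psi 2 z := psi_pow2 1 2 z.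
rewrite exprD exprM iota_sqr /unit_of /receiver.
case: (kind_of t) (minus t) => -[]; rewrite ?expr0 ?expr1 ?mulr1 ?mul1r //.
- rewrite [X in psi _ X = _](_ : _ = 1 + 2%:R ^+ 2 * (1 + 2%:R * (- 1))); last by ring.
  by rewrite psiD i4 psi_odd.
- rewrite [X in psi _ X = _](_ : _ = 1 + 2%:R ^+ 2 * (1 + 2%:R * (- 1))); last by ring.
  by rewrite psiD i4 psi_odd.
- rewrite [X in psi _ X = _](_ : _ = 1 + 2%:R ^+ 1 * 1); last by ring.
  by rewrite psiD i1 i2 mulrN1 opprK.
- rewrite [X in psi _ X = _](_ : _ = 1 + 2%:R ^+ 1 * 1 + 2%:R ^+ 2 * (1 + 2%:R * (- 1)));
    last by ring.
  by rewrite !psiD i1 i4 psi_odd i2 mulrN1 mulrN.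
Qed.

Lemma gauss1_3_1 : gauss1 3 1 = 4%:R * psi 3 1.
Proof. by have := gauss1_3 0; rewrite mulr0 addr0. Qed.

Lemma gauss1_rec_1 j : gauss1 j.+4 1 = 2%:R * gauss1 j.+2 1.
Proof. by have := gauss1_rec j 0; rewrite mulr0 addr0. Qed.

(** Level 2 sees the unit modulo 4 and level 3 sees it modulo 8; further levels repeat these two. As
    the exponent matters modulo 4, the sign counts for odd j only, and the linear form [minus t * j]
    makes consecutive levels easy to compare. *)
Lemma gauss1_phase t j : gauss1 j.+2 (unit_of t)%:~R =
  gauss1 j.+2 1 * (- root2 2) ^+ (receiver t + 2 * (minus t * j)).
Proof.
have [m mE] := unit_of_odd t.
(* The recursion moves by two levels, so two consecutive levels are carried through the
   induction. *)
suff : (gauss1 j.+2 (unit_of t)%:~R =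
      gauss1 j.+2 1 * (- root2 2) ^+ (receiver t + 2 * (minus t * j))) /\
   (gauss1 j.+3 (unit_of t)%:~R =
      gauss1 j.+3 1 * (- root2 2) ^+ (receiver t + 2 * (minus t * j.+1))) by case.
elim: j => [|j [IH2 IH3]].
  split.
    rewrite !gauss1_2 muln0 addn0 psi_unit_2 psi2_1 /receiver.
    case: (kind_of t); rewrite ?expr0 ?expr1 ?mulr1 //.
    have i2 : root2 2 ^+ 2 = - 1 by rewrite root2S.
    have -> : 2%:R * (1 + root2 2) * - root2 2 = 2%:R * (- root2 2 - root2 2 ^+ 2) by ring.
    by rewrite i2; ring.
  by rewrite mE gauss1_3 gauss1_3_1 -mE psi_unit_3 muln1 mulrA.
split=> //; rewrite mE gauss1_rec -mE IH2 gauss1_rec_1.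
have -> : (receiver t + 2 * (minus t * j.+2) =
    receiver t + 2 * (minus t * j) + 2 * (2 * minus t))%N.
  by lia.
rewrite (exprD _ (receiver t + _)%N) [X in _ = _ * (_ * X)]exprM iota_sqr.
by rewrite exprM sqrrN expr1n expr1n mulr1 mulrA.
Qed.

Lemma gauss1_neq0 j : gauss1 j.+2 1 != 0.
Proof.
suff : gauss1 j.+2 1 != 0 /\ gauss1 j.+3 1 != 0 by case.
elim: j => [|j [IH2 IH3]]; split => //.
- rewrite gauss1_2 psi2_1 mulf_neq0 ?pnatr_eq0 // addr_eq0.
  apply: contra_eq_neq (root2S 1) => iE.
  by rewrite -[root2 2]opprK -iE sqrrN expr1n /= -addr_eq0 -mulr2n pnatr_eq0.
- by rewrite gauss1_3_1 mulf_neq0 ?pnatr_eq0 // /psi expf_neq0 // root2_neq0.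
- by rewrite gauss1_rec_1 mulf_neq0 ?pnatr_eq0.
Qed.

(** The summand uses half of the norm 2 (x y + m (x^2 + y^2)) of a type II term. This is why type II
    terms sit one level lower than type I terms in the phases. *)
Definition gauss2 (m : bool) j : algC :=
  zsum j (fun x => zsum j (fun y => psi j (x * y + m%:R * (x ^+ 2 + y ^+ 2)))).

Lemma psiD_id k x z : psi k (x + 2%:R ^+ k * z) = psi k x.
Proof. by rewrite psiD psi_pow2_id mulr1. Qed.

Lemma psiD_half k x z m :
  psi k.+1 (x + (2%:R ^+ k * (1 + 2%:R * m) + 2%:R ^+ k.+1 * z)) = - psi k.+1 x.
Proof.
rewrite !psiD psi_pow2_id mulr1.
by rewrite -[in psi _ (_ * (1 + _))](addn1 k) psi_pow2 psi_odd mulrN1.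
Qed.

Lemma zsum_exchange k l (h : Z2 -> Z2 -> algC) :
  zsum k (fun x => zsum l (fun y => h x y)) = zsum l (fun y => zsum k (fun x => h x y)).
Proof. exact: exchange_big. Qed.

Lemma zsumD k h h' : zsum k (fun x => h x + h' x) = zsum k h + zsum k h'.
Proof. exact: big_split. Qed.

(** For x odd, a shift of y by 2^(j + 1) changes the sign; for x even and y odd, a shift of x does.
    Only pairs of even arguments remain, and they lower the level by two. *)
Lemma gauss2_rec m j : gauss2 m j.+2 = 4%:R * gauss2 m j.
Proof.
rewrite /gauss2 zsum_parity [X in _ + X](_ : _ = 0) ?addr0; last first.
  rewrite (@eq_zsum _ _ (fun=> 0)) ?zsum_const ?mulr0 // => x.
  apply: (@zsum_antiperiod _ _ (2%:R ^+ j.+1)).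
    move=> y y' /cong_sub[z ->].
    set c := 1 + 2%:R * x.
    have -> : c * (y' + 2%:R ^+ j.+2 * z) + m%:R * (c ^+ 2 + (y' + 2%:R ^+ j.+2 * z) ^+ 2) =
      c * y' + m%:R * (c ^+ 2 + y' ^+ 2) + 2%:R ^+ j.+2 *
        (c * z + m%:R * (2%:R * y' * z + 2%:R ^+ j.+2 * z ^+ 2)).
      by rewrite !exprS; ring.
    exact: psiD_id.
  move=> y; rewrite -(psiD_half _ _ (m%:R * (y + 2%:R ^+ j)) x); congr psi.
  by rewrite !exprS; ring.
under eq_zsum do rewrite zsum_parity.
rewrite zsumD [X in _ + X](_ : _ = 0) ?addr0; last first.
  rewrite zsum_exchange (@eq_zsum _ _ (fun=> 0)) ?zsum_const ?mulr0 // => y.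
  apply: (@zsum_antiperiod _ _ (2%:R ^+ j)).
    move=> x x' /cong_sub[z ->].
    set c := 1 + 2%:R * y.
    have -> : 2%:R * (x' + 2%:R ^+ j.+1 * z) * c +
        m%:R * ((2%:R * (x' + 2%:R ^+ j.+1 * z)) ^+ 2 + c ^+ 2) =
      2%:R * x' * c + m%:R * ((2%:R * x') ^+ 2 + c ^+ 2) + 2%:R ^+ j.+2 *
        (c * z + m%:R * (4%:R * x' * z + 2%:R * 2%:R ^+ j.+1 * z ^+ 2)).
      by rewrite !exprS; ring.
    exact: psiD_id.
  move=> x; rewrite -(psiD_half _ _ (m%:R * (2%:R * x + 2%:R ^+ j)) y); congr psi.
  by rewrite !exprS; ring.
have E x y : psi j.+2 (2%:R * x * (2%:R * y) + m%:R * ((2%:R * x) ^+ 2 + (2%:R * y) ^+ 2)) =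
    psi j (x * y + m%:R * (x ^+ 2 + y ^+ 2)).
  by rewrite -(psi_pow2 2 j); congr psi; ring.
under eq_zsum do under eq_zsum do rewrite E.
have per (x x' y y' : Z2) : x j = x' j -> y j = y' j ->
    psi j (x * y + m%:R * (x ^+ 2 + y ^+ 2)) = psi j (x' * y' + m%:R * (x' ^+ 2 + y' ^+ 2)).
  move=> xx' yy'; apply: psi_cong.
  by rewrite !residueD !residueM !residueD !expr2 !residueM xx' yy'.
rewrite zsum_double; last first.
  by move=> x x' xx'; apply: eq_zsum => y; exact: per.
under eq_zsum => x.
  rewrite zsum_double; last by move=> y y' yy'; exact: per.
  over.
by rewrite zsumZ mulrA -natrM.
Qed.

Lemma gauss2E m j : gauss2 m j = 2%:R ^+ j * (- 1) ^+ (m * j).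
Proof.
suff : gauss2 m j = 2%:R ^+ j * (- 1) ^+ (m * j) /\
  gauss2 m j.+1 = 2%:R ^+ j.+1 * (- 1) ^+ (m * j.+1) by case.
elim: j => [|j [IH IH1]]; last first.
  split=> //; rewrite gauss2_rec IH.
  rewrite (_ : m * j.+2 = m * j + 2 * m)%N; last by lia.
  by rewrite [X in _ = _ * X]exprD [X in _ = _ * (_ * X)]exprM sqrrN !expr1n mulr1 !exprS; ring.
split.
  by rewrite /gauss2 !zsum0 muln0 mulr1 /psi residue0.
rewrite /gauss2 !zsum1 muln1.
have -> : 0 * 0 + m%:R * (0 ^+ 2 + 0 ^+ 2) = 0 :> Z2 by ring.
have -> : 0 * 1 + m%:R * (0 ^+ 2 + 1 ^+ 2) = m%:R :> Z2 by ring.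
have -> : 1 * 0 + m%:R * (1 ^+ 2 + 0 ^+ 2) = m%:R :> Z2 by ring.
have -> : 1 * 1 + m%:R * (1 ^+ 2 + 1 ^+ 2) = 1 + 2%:R * m%:R :> Z2 by ring.
rewrite psi_odd psi0; case: m => /=; last by rewrite psi0; ring.
by rewrite mulr1n psi1_1; ring.
Qed.

(** * Two weights and their totals on single terms *)

Definition gauss_weight c k (L : lattice) (x : L) : algC := psi k (sform c x x).

(** Its total counts the vectors of L / 2^k L that are orthogonal to L modulo 2^k, from which the
    dimension of each scale is recovered. *)
Definition radical_weight c k (L : lattice) (x : L) : algC :=
  `[< forall y, sform c x y k = 0%N >]%:R.

Lemma sform_isometric c (L M : lattice) (f : {linear L -> M}) :
    (forall x y, lat_form (f x) (f y) = lat_form x y) -> integral_form c L ->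
  forall x y, sform c (f x) (f y) = sform c x y.
Proof. by move=> f_form L_int x y; apply: sformP; rewrite sformE // f_form. Qed.

Lemma sform_orth c L M (x y : orth_sum L M) : integral_form c L -> integral_form c M ->
  sform c x y = sform c x.1 y.1 + sform c x.2 y.2.
Proof.
move=> L_int M_int; apply: sformP.
by rewrite orth_formE mulrDr rmorphD /= !sformE.
Qed.

Lemma sform0 c (L : lattice) (x : L) : sform c x 0 = 0.
Proof. by apply: sformP; rewrite lat_form0 rmorph0 mulr0. Qed.

Lemma Z2_0_residue k : (0 : Z2) k = 0%N.
Proof. by rewrite -(mulr0 (2%:R ^+ k)) residue_pow2M0. Qed.

Lemma gauss_weightP c k : weight c k (gauss_weight c k).
Proof.
split=> [L L_int x y [z ->]|L M f _ f_form L_int x|L M L_int M_int x|x].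
- rewrite /gauss_weight addrC sform_linear // [sform c y _]sform_sym // sform_linear //.
  by rewrite -[RHS](psiD_id k _ (sform c z (2%:R ^+ k *: z + y) + sform c z y)); congr psi; ring.
- by rewrite /gauss_weight (sform_isometric f_form).
- by rewrite /gauss_weight sform_orth // psiD.
- by rewrite /gauss_weight (zero_lattice0 x) sform0 psi0.
Qed.

Lemma radical_weightP c k : weight c k (radical_weight c k).
Proof.
split=> [L L_int x y [z ->]|L M f f_bij f_form L_int x|L M L_int M_int x|x].
- rewrite /radical_weight; congr ((_ : bool)%:R); apply: asbool_equiv_eq.
  split=> H u; rewrite -{}[RHS](H u) addrC sform_linear // residueD;
    by rewrite residue_pow2M0 add0n residue_mod.
- rewrite /radical_weight; congr ((_ : bool)%:R); apply: asbool_equiv_eq.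
  have [f' fK f'K] := f_bij.
  split=> H u; first by rewrite -(sform_isometric f_form).
  by rewrite -(f'K u) (sform_isometric f_form).
- rewrite /radical_weight -natrM mulnb; congr ((_ : bool)%:R).
  apply/asboolP/andP => [H|[/asboolP H /asboolP H'] u].
    split; apply/asboolP => u.
      have <- := H (u, 0); rewrite sform_orth //.
      by rewrite (sform0 c x.2 : sform c x.2 (u, 0).2 = 0) addr0.
    have <- := H (0, u); rewrite sform_orth //.
    by rewrite (sform0 c x.1 : sform c x.1 (0, u).1 = 0) add0r.
  by rewrite sform_orth // residueD H H' mod0n.
- rewrite /radical_weight (_ : `[< _ >] = true) //; apply/asboolP => u.
  by rewrite (zero_lattice0 u) sform0 Z2_0_residue.
Qed.

Lemma rv1_transversal k :
  transversal k (fun i : 'I_(2 ^ k) => (rv1 i%:R : 'rV[Z2]_1)).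
Proof.
elim/rv1_ind => p; have [i [z zE] iP] := @nat_transversal k p.
exists i => [|j [u uE]].
  by exists (rv1 z); rewrite zE -[_ + _ *: z]addrC -[in RHS]addrC -rv1_linear.
apply: iP; exists (e0 u); have := congr1 e0 uE.
by rewrite addrC e0_linear !e0_rv1 addrC.
Qed.

Lemma rv2_transversal k : transversal k
  (fun ij : 'I_(2 ^ k) * 'I_(2 ^ k) => (rv2 ij.1%:R ij.2%:R : 'rV[Z2]_2)).
Proof.
elim/rv2_ind => p q.
have [i [z zE] iP] := @nat_transversal k p.
have [j [u uE] jP] := @nat_transversal k q.
exists (i, j) => [|[i' j'] [v vE]].
  exists (rv2 z u); rewrite zE uE -[_ + _ *: z]addrC -[_ + _ *: u]addrC -[in RHS]addrC.
  by rewrite -rv2_linear.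
congr (_, _).
  apply: iP; exists (b0 v); have := congr1 b0 vE.
  by rewrite addrC b0_linear !b0_rv2 addrC.
apply: jP; exists (b1 v); have := congr1 b1 vE.
by rewrite addrC b1_linear !b1_rv2 addrC.
Qed.

Section TermTotals.
Variables (c q : Q2) (e : nat).
Hypothesis cq : c * q = toQ2 (2%:R ^+ e).

Lemma unary_sform a (qa : q * toQ2 a != 0) :
  integral_form c (unary qa) /\
  forall x y : unary qa, sform c x y = 2%:R ^+ e * (a * (e0 x * e0 y)).
Proof.
have E (x y : unary qa) :
    toQ2 (2%:R ^+ e * (a * (e0 x * e0 y))) = c * lat_form x y.
  by rewrite unary_form scaleQM [RHS]mulrA cq -rmorphM.
by split=> [x y|x y]; [exists (2%:R ^+ e * (a * (e0 x * e0 y))) | exact: sformP].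
Qed.

Lemma binary_sform m (q0 : q != 0) :
  integral_form c (binary m q0) /\
  forall x y : binary m q0, sform c x y = 2%:R ^+ e *
    (b0 x * b1 y + b1 x * b0 y + 2%:R * (m%:R * (b0 x * b0 y + b1 x * b1 y))).
Proof.
have E (x y : binary m q0) : toQ2 (2%:R ^+ e *
    (b0 x * b1 y + b1 x * b0 y + 2%:R * (m%:R * (b0 x * b0 y + b1 x * b1 y))))
    = c * lat_form x y.
  rewrite binary_form [RHS]mulrA cq -rmorphM; congr (toQ2 (_ * (_ + _))).
  move: (b0 x) (b0 y) (b1 x) (b1 y) => x0 y0 x1 y1 {x y}.
  by case: m => /=; rewrite ?mulr1n ?mulr0n; ring.
split=> [x y|x y]; last exact: sformP.
by exists (2%:R ^+ e * (b0 x * b1 y + b1 x * b0 y + 2%:R * (m%:R * (b0 x * b0 y + b1 x * b1 y)))).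
Qed.

Lemma unary_gauss_total k a (qa : q * toQ2 a != 0) :
  total k (gauss_weight c k) (unary qa)
    (if (e <= k)%N then 2%:R ^+ e * gauss1 (k - e) a else 2%:R ^+ k).
Proof.
have [_ sE] := unary_sform qa.
exists 'I_(2 ^ k), (fun i : 'I_(2 ^ k) => (rv1 i%:R : 'rV[Z2]_1)).
split; first exact: rv1_transversal.
transitivity (zsum k (fun x => psi k (2%:R ^+ e * (a * x ^+ 2)))); last first.
  by apply: eq_bigr => i _; rewrite /gauss_weight sE e0_rv1 expr2.
case: leqP => [ek|ke].
  rewrite -[k](subnKC ek) addKn /gauss1 -zsum_pow2.
    by apply: eq_zsum => x; rewrite psi_pow2.
  by move=> x y xy; exact/psi_cong/sqr_residue.
rewrite (@eq_zsum _ _ (fun=> 1)) ?zsum_const ?mulr1 // => x.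
by rewrite -(subnKC (ltnW ke)) exprD -mulrA psi_pow2_id.
Qed.

Lemma binary_gauss_total k m (q0 : q != 0) :
  total k.+1 (gauss_weight c k.+1) (binary m q0)
    (if (e <= k)%N then 4%:R ^+ e.+1 * gauss2 m (k - e) else 4%:R ^+ k.+1).
Proof.
have [_ sE] := binary_sform m q0.
exists ('I_(2 ^ k.+1) * 'I_(2 ^ k.+1))%type,
  (fun ij : 'I_(2 ^ k.+1) * 'I_(2 ^ k.+1) => (rv2 ij.1%:R ij.2%:R : 'rV[Z2]_2)).
split; first exact: rv2_transversal.
transitivity (zsum k.+1 (fun x => zsum k.+1 (fun y =>
   psi k.+1 (2%:R ^+ e.+1 * (x * y + m%:R * (x ^+ 2 + y ^+ 2)))))); last first.
  rewrite /zsum pair_bigA; apply: eq_bigr => -[i j] _ /=.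
  by rewrite /gauss_weight sE !coordE; congr psi; rewrite exprS; ring.
case: leqP => [ek|ke].
  rewrite -[k](subnKC ek) addKn -addSn; move: (k - e)%N => d.
  have per (x x' y y' : Z2) : x d = x' d -> y d = y' d ->
      psi d (x * y + m%:R * (x ^+ 2 + y ^+ 2)) =
      psi d (x' * y' + m%:R * (x' ^+ 2 + y' ^+ 2)).
    move=> xx' yy'; apply: psi_cong.
    by rewrite !residueD !residueM !residueD !expr2 !residueM xx' yy'.
  under eq_zsum do under eq_zsum do rewrite psi_pow2.
  rewrite zsum_pow2; last by move=> x x' xx'; apply: eq_zsum => y; exact: per.
  under eq_zsum => x.
    rewrite zsum_pow2; last by move=> y y' yy'; exact: per.
    over.
  by rewrite zsumZ mulrA -exprMn -natrM.
have E x y : psi k.+1 (2%:R ^+ e.+1 * (x * y + m%:R * (x ^+ 2 + y ^+ 2))) = 1.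
  by rewrite -(subnKC (leqW ke)) exprD -mulrA psi_pow2_id.
under eq_zsum do under eq_zsum do rewrite E.
under eq_zsum do rewrite zsum_const mulr1.
by rewrite zsum_const -exprMn -natrM.
Qed.

Lemma zsum_residue_eq0 k :
  zsum k (fun x : Z2 => ((2%:R ^+ e * x) k == 0%N)%:R) = 2%:R ^+ minn e k.
Proof.
have [ek|ke] := leqP e k.
  have E (x : Z2) : ((2%:R ^+ e * x) k == 0%N) = (x (k - e)%N == 0%N).
    by rewrite -{1}(subnKC ek) residue_pow2M muln_eq0 expn_eq0.
  under eq_zsum do rewrite E.
  rewrite -{1}(subnKC ek) zsum_pow2 => [|x y -> //].
  rewrite [X in _ * X](_ : _ = 1) ?mulr1 // /zsum.
  have p_gt0 : (0 < 2 ^ (k - e))%N by rewrite expn_gt0.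
  rewrite (eq_bigr (fun i : 'I_(2 ^ (k - e)) => (val i == 0%N)%:R)) => [|i _].
    rewrite (bigD1 (Ordinal p_gt0)) //= big1 ?addr0 // => i.
    by rewrite -val_eqE /= => /negPf ->.
  by rewrite Z2_nat_residue modn_small.
rewrite (@eq_zsum _ _ (fun=> 1)) ?zsum_const ?mulr1 // => x.
by rewrite -(subnKC (ltnW ke)) exprD -mulrA residue_pow2M0.
Qed.

Lemma residue_mul0 (x y : Z2) k : x k = 0%N -> (x * y) k = 0%N.
Proof. by rewrite residueM => ->; rewrite mul0n mod0n. Qed.

Lemma unary_radical_total k a (qa : q * toQ2 a != 0) : a \is a GRing.unit ->
  total k (radical_weight c k) (unary qa) (2%:R ^+ minn e k).
Proof.
move=> a_unit; have [_ sE] := unary_sform qa.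
exists 'I_(2 ^ k), (fun i : 'I_(2 ^ k) => (rv1 i%:R : 'rV[Z2]_1)).
split; first exact: rv1_transversal.
rewrite -zsum_residue_eq0; apply: eq_bigr => i _.
congr ((_ : bool)%:R); apply/eqP/asboolP => [ei y|/(_ (rv1 a^-1))].
  rewrite sE e0_rv1 (_ : _ * _ = 2%:R ^+ e * i%:R * (a * e0 y)); last by ring.
  exact: residue_mul0.
by rewrite sE !e0_rv1 (mulrCA a) divrr ?mulr1.
Qed.

Lemma binary_radical_total k m (q0 : q != 0) :
  total k (radical_weight c k) (binary m q0) (4%:R ^+ minn e k).
Proof.
have [_ sE] := binary_sform m q0.
exists ('I_(2 ^ k) * 'I_(2 ^ k))%type,
  (fun ij : 'I_(2 ^ k) * 'I_(2 ^ k) => (rv2 ij.1%:R ij.2%:R : 'rV[Z2]_2)).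
split; first exact: rv2_transversal.
transitivity (zsum k (fun x : Z2 => zsum k (fun y : Z2 =>
   ((2%:R ^+ e * x) k == 0%N)%:R * ((2%:R ^+ e * y) k == 0%N)%:R))).
  under eq_zsum do rewrite zsumZ zsum_residue_eq0 mulrC.
  by rewrite zsumZ zsum_residue_eq0 -exprMn -natrM.
rewrite /zsum pair_bigA; apply: eq_bigr => -[i j] _ /=.
rewrite -natrM mulnb; congr ((_ : bool)%:R).
apply/andP/asboolP => [[/eqP ei /eqP ej] y|H].
  rewrite sE !coordE (_ : _ * _ = 2%:R ^+ e * i%:R * (b1 y + 2%:R * m%:R * b0 y)
     + 2%:R ^+ e * j%:R * (b0 y + 2%:R * m%:R * b1 y)); last by ring.
  by rewrite residueD (@residue_mul0 (_ * i%:R) _ _ ei) (@residue_mul0 (_ * j%:R) _ _ ej) mod0n.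
(* The pairing matrix, with 2 m on the diagonal and 1 elsewhere, has determinant 3 or - 1, a unit.
   Orthogonality to the two basis vectors therefore forces both coordinates times 2^e to vanish
   modulo 2^k. *)
have [k3 k3E] : exists k3 : Z2, 3%:R * k3 = 1.
  by exists 3%:R^-1; rewrite divrr ?Z2_unit3.
have [H0 H1] : (2%:R ^+ e * (j%:R + 2%:R * m%:R * i%:R) : Z2) k = 0%N /\
    (2%:R ^+ e * (i%:R + 2%:R * m%:R * j%:R) : Z2) k = 0%N.
  by split; [rewrite -[RHS](H (rv2 1 0)) | rewrite -[RHS](H (rv2 0 1))];
    rewrite sE !coordE; congr residue; ring.
case: (m) H0 H1 => H0 H1.
  have E (u v : Z2) : (2%:R ^+ e * (v + 2%:R * 1%:R * u)) k = 0%N ->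
     (2%:R ^+ e * (u + 2%:R * 1%:R * v)) k = 0%N -> (2%:R ^+ e * u) k = 0%N.
    move=> K0 K1; rewrite (_ : _ * u = (2%:R ^+ e * (v + 2%:R * 1%:R * u)) * (2%:R * k3)
      + (2%:R ^+ e * (u + 2%:R * 1%:R * v)) * - k3).
      by rewrite residueD (residue_mul0 _ K0) (residue_mul0 _ K1) mod0n.
    transitivity (2%:R ^+ e * (3%:R * k3 * u)); last by ring.
    by rewrite k3E mul1r.
  by split; apply/eqP; [exact: E H0 H1 | exact: E H1 H0].
have {}H0 : (2%:R ^+ e * j%:R : Z2) k = 0%N.
  by rewrite -[RHS]H0; congr residue; rewrite mulr0n; ring.
have {}H1 : (2%:R ^+ e * i%:R : Z2) k = 0%N.
  by rewrite -[RHS]H1; congr residue; rewrite mulr0n; ring.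
by split; apply/eqP; [exact: H1 | exact: H0].
Qed.

End TermTotals.

(** * The invariants read off a list of terms *)

Section Invariants.
Variable M : int.

Definition shift : Q2 := 2%:R ^ M.
(** The exponent of the scale once the form is multiplied by 2^M. It is meaningful when [expo t + M]
    is nonnegative, which is assumed where totals are computed. *)
Definition lev (t : term) : nat := absz (expo t + M).
Definition dim_term (t : term) : nat := if type_I t then 1 else 2.

Lemma shift_scale t : 0 <= expo t + M -> shift * scale t = toQ2 (2%:R ^+ lev t).
Proof.
move=> t_ge0; rewrite /shift /scale -expfzDr ?Q2_nat_neq0 // addrC.
by rewrite -[expo t + M]gez0_abs // -exprnP rmorphXn rmorph_nat.
Qed.

(* The Gauss sum of level [K.+1] of a term is [gauss_base] times a power of
   - i with exponent [phase]: the base depends only on the scale and the type, and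
   vanishes exactly for type I terms of scale 2^K. *)
Definition gauss_base K (b : bool) e : algC :=
  if b then (if (e <= K.+1)%N then 2%:R ^+ e * gauss1 (K.+1 - e) 1 else 2%:R ^+ K.+1)
  else (if (e <= K)%N then 4%:R ^+ e.+1 * 2%:R ^+ (K - e) else 4%:R ^+ K.+1).

Definition phase K t : nat :=
  if type_I t then
    (if (lev t < K)%N then (receiver t + 2 * (minus t * (K.-1 - lev t)))%N else 0%N)
  else (2 * (minus t * (K - lev t)))%N.

Lemma scale_unit_neq0 t : scale t * toQ2 (unit_of t)%:~R != 0.
Proof.
rewrite mulf_neq0 ?scale_neq0 // tofrac_eq0 Z2_neq0_unit //.
by have [m ->] := unit_of_odd t; exact: Z2_odd_unit.
Qed.

Lemma term_iso t : type_I t -> isometric (unary (scale_unit_neq0 t)) (term_lattice t).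
Proof. by move=> tI; apply/isometric_sym; exact: term_unary. Qed.

Lemma term_iso_II t : ~~ type_I t ->
  isometric (binary (minus t) (scale_neq0 t)) (term_lattice t).
Proof. by move=> tI; apply/isometric_sym; exact: term_binary. Qed.

Lemma term_integral t : 0 <= expo t + M -> integral_form shift (term_lattice t).
Proof.
move=> /shift_scale ct; have [tI|tI] := boolP (type_I t).
  by apply: integral_isometric (term_iso tI) _; have [] := unary_sform ct (scale_unit_neq0 t).
apply: integral_isometric (term_iso_II tI) _.
by have [] := binary_sform ct (minus t) (scale_neq0 t).
Qed.

Lemma term_gauss K t : 0 <= expo t + M ->
  total K.+1 (gauss_weight shift K.+1) (term_lattice t)
    (gauss_base K (type_I t) (lev t) * (- root2 2) ^+ phase K t).
Proof.
move=> /shift_scale ct; rewrite /phase /gauss_base; have [tI|tI] := boolP (type_I t).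
  apply: (total_isometric (gauss_weightP _ _) (term_iso tI)).
    by have [] := unary_sform ct (scale_unit_neq0 t).
  have := unary_gauss_total ct K.+1 (scale_unit_neq0 t).
  congr total; have [tK|tK] := leqP (lev t) K.+1; last first.
    by rewrite [(lev t < K)%N](_ : _ = false) ?mulr1 //; lia.
  rewrite -mulrA; congr (_ * _).
  have [m mE] := unit_of_odd t.
  have [tK'|tK'|->] := ltngtP (lev t) K; last first.
  - rewrite subSnn mulr1 mE gauss1_1.
    by have := gauss1_1 0; rewrite mulr0 addr0.
  - have -> : (K.+1 - lev t = 0)%N by lia.
    by rewrite mulr1 /gauss1 !zsum0 /psi !residue0.
  - have -> : (K.+1 - lev t = (K.-1 - lev t).+2)%N by lia.
    exact: gauss1_phase.
apply: (total_isometric (gauss_weightP _ _) (term_iso_II tI)).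
  by have [] := binary_sform ct (minus t) (scale_neq0 t).
have := binary_gauss_total ct K (minus t) (scale_neq0 t).
congr total; have [tK|tK] := leqP (lev t) K.
  by rewrite gauss2E mulrA [in RHS]exprM iota_sqr.
by rewrite (_ : K - lev t = 0)%N ?muln0 ?mulr1 //; lia.
Qed.

Lemma term_radical k t : 0 <= expo t + M ->
  total k (radical_weight shift k) (term_lattice t)
    (2%:R ^+ (dim_term t * minn (lev t) k)).
Proof.
move=> /shift_scale ct; rewrite /dim_term; have [tI|tI] := boolP (type_I t).
  apply: (total_isometric (radical_weightP _ _) (term_iso tI)).
    by have [] := unary_sform ct (scale_unit_neq0 t).
  rewrite mul1n; apply: unary_radical_total => //.
  by have [m ->] := unit_of_odd t; exact: Z2_odd_unit.
apply: (total_isometric (radical_weightP _ _) (term_iso_II tI)).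
  by have [] := binary_sform ct (minus t) (scale_neq0 t).
have := binary_radical_total ct k (minus t) (scale_neq0 t).
by rewrite exprM (_ : 2%:R ^+ 2 = 4%:R) //; ring.
Qed.

Lemma gauss_base_eq0 K b e : (gauss_base K b e == 0) = b && (e == K).
Proof.
have two0 n : 2%:R ^+ n != 0 :> algC by rewrite expf_neq0 ?pnatr_eq0.
have four0 n : 4%:R ^+ n != 0 :> algC by rewrite expf_neq0 ?pnatr_eq0.
rewrite /gauss_base; case: b => /=; last first.
  by case: ifP => _; apply/negbTE; rewrite ?mulf_neq0.
have [eK|eK] := leqP e K.+1; last first.
  by rewrite (negPf (two0 _)); apply/esym/negbTE; rewrite gtn_eqF // ltnW.
rewrite mulf_eq0 (negPf (two0 _)) /=.
have [eK'|eK'|->] := ltngtP e K; last first.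
- by rewrite subSnn; have := gauss1_1 0; rewrite mulr0 addr0 => ->; rewrite eqxx.
- have -> : (K.+1 - e = 0)%N by lia.
  by rewrite /gauss1 zsum0 /psi residue0 oner_eq0.
- have -> : (K.+1 - e = (K.-1 - e).+2)%N by lia.
  exact/negbTE/gauss1_neq0.
Qed.

Lemma iota_pow_neq0 n : (- root2 2) ^+ n != 0.
Proof. by rewrite expf_neq0 // oppr_eq0 root2_neq0. Qed.

Lemma iota_pow_inj m n : (- root2 2) ^+ m = (- root2 2) ^+ n -> m = n %[mod 4].
Proof.
have iE : (- root2 2) ^+ 2 = - 1 := iota_sqr.
have i4 : (- root2 2) ^+ 4 = 1 by rewrite (exprM _ 2 2) iE sqrrN expr1n.
have N1 : - 1 != 1 :> algC by rewrite eq_sym -subr_eq0 opprK -mulr2n pnatr_eq0.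
have iN1 : - root2 2 != 1.
  by apply: contra_eq_neq iE => ->; rewrite expr1n eq_sym.
have iNN1 : - root2 2 != - 1.
  by apply: contra_eq_neq iE => ->; rewrite sqrrN expr1n eq_sym.
wlog mn : m n / (m <= n)%N => [H|].
  move=> mnE; have [mn|nm] := leqP m n; first exact: H.
  by apply: esym; apply: (H n m); [exact: ltnW | exact: esym].
move=> mnE; have : (- root2 2) ^+ (n - m) = 1.
  apply: (mulfI (iota_pow_neq0 m)).
  by rewrite mulr1 -exprD subnKC.
rewrite {1}(divn_eq (n - m) 4) exprD mulnC exprM i4 expr1n mul1r => r1.
have r0 : ((n - m) %% 4 = 0)%N.
  have : ((n - m) %% 4 < 4)%N by rewrite ltn_mod.
  case: ((n - m) %% 4)%N r1 => [//|[|[|[|//]]]].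
  - by rewrite expr1 => /eqP; rewrite (negPf iN1).
  - by rewrite iE => /eqP; rewrite (negPf N1).
  - rewrite exprS iE mulrN1 => /eqP; rewrite eqr_oppLR (negPf iNN1) //.
by apply/eqP; rewrite eq_sym eqn_mod_dvd // /dvdn r0.
Qed.

Section Pair.
Variables s t : seq term.
Hypothesis s_ge0 : {in s, forall x, 0 <= expo x + M}.
Hypothesis t_ge0 : {in t, forall x, 0 <= expo x + M}.
Hypothesis st : isometric (lattice_of s) (lattice_of t).

Lemma total_invariant k w (val : term -> algC) : weight shift k w ->
    (forall x, 0 <= expo x + M -> total k w (term_lattice x) (val x)) ->
  \prod_(x <- s) val x = \prod_(x <- t) val x.
Proof.
move=> wW val_tot.
have [||s_int s_tot] := total_lattice_of (s := s) (val := val) wW.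
- by move=> x /s_ge0; exact: term_integral.
- by move=> x /s_ge0; exact: val_tot.
have [||t_int t_tot] := total_lattice_of (s := t) (val := val) wW.
- by move=> x /t_ge0; exact: term_integral.
- by move=> x /t_ge0; exact: val_tot.
have s_tot' := total_isometric wW st s_int s_tot.
exact: total_unique wW t_int s_tot' t_tot.
Qed.

Lemma radical_invariant k :
  (\sum_(x <- s) dim_term x * minn (lev x) k = \sum_(x <- t) dim_term x * minn (lev x) k)%N.
Proof.
have := total_invariant (radical_weightP shift k) (term_radical k).
have E (u : seq term) : \prod_(x <- u) 2%:R ^+ (dim_term x * minn (lev x) k) =
    (2 ^ (\sum_(x <- u) dim_term x * minn (lev x) k))%:R :> algC.
  by rewrite prodrXr natrX.
by rewrite !E => /eqP; rewrite eqr_nat eqn_exp2l // => /eqP.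
Qed.

Lemma type_I_invariant K :
  has (fun x => type_I x && (lev x == K)) s = has (fun x => type_I x && (lev x == K)) t.
Proof.
have := total_invariant (gauss_weightP shift K.+1) (term_gauss K).
have E (u : seq term) :
    (\prod_(x <- u) (gauss_base K (type_I x) (lev x) * (- root2 2) ^+ phase K x) == 0) =
    has (fun x => type_I x && (lev x == K)) u.
  elim: u => [|x u IHu]; first by rewrite big_nil oner_eq0.
  by rewrite big_cons !mulf_eq0 gauss_base_eq0 (negPf (iota_pow_neq0 _)) orbF IHu.
by move=> /(congr1 (fun z => z == 0)); rewrite !E.
Qed.

(** Equal keys give equal products of bases. When no type I term has level K this product is nonzero
    and cancels, which leaves the powers of - i. *)
Lemma phase_invariant K :
    [seq (lev x, type_I x) | x <- s] = [seq (lev x, type_I x) | x <- t] ->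
    ~~ has (fun x => type_I x && (lev x == K)) s ->
  (\sum_(x <- s) phase K x = \sum_(x <- t) phase K x %[mod 4])%N.
Proof.
move=> st_keys s_K.
have := total_invariant (gauss_weightP shift K.+1) (term_gauss K).
rewrite !big_split /=.
pose g (x : nat * bool) := gauss_base K x.2 x.1.
have E (u : seq term) : \prod_(x <- u) gauss_base K (type_I x) (lev x) =
   \prod_(y <- [seq (lev x, type_I x) | x <- u]) g y.
  by rewrite big_map.
rewrite !E -st_keys -!E.
rewrite !prodrXr => /mulfI H; apply/iota_pow_inj/H.
rewrite prodf_seq_neq0; apply/allP => x xs /=.
rewrite gauss_base_eq0; apply: contra s_K => xK.
by apply/hasP; exists x.
Qed.

End Pair.
End Invariants.

(** * Connecting two symbols of the same lattice *)

Definition aligned n (s t : n.-tuple term) : Prop :=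
  forall i, expo (tnth t i) = expo (tnth s i) /\ type_I (tnth t i) = type_I (tnth s i).

(** The bound 1 instead of 0 leaves level 0 empty, which provides a boundary below the lowest
    compartment. *)
Lemma shift_exists (s : seq term) : exists M : int, {in s, forall x, 1 <= expo x + M}.
Proof.
elim: s => [|x s [M MP]]; first by exists 0.
exists (`|M| + `|expo x| + 1) => y; rewrite inE => /predU1P[->|/MP]; lia.
Qed.

Lemma lev_expo M x y : 1 <= expo x + M -> 1 <= expo y + M ->
  lev M x = lev M y -> expo x = expo y.
Proof. by rewrite /lev; lia. Qed.

(** Differencing the radical invariant twice in k gives the total dimension of each level. By
    fineness a level has a single type, detected by the vanishing of a Gauss sum, so its number of
    terms is this dimension divided by 1 or 2. *)
Lemma keys_perm M (s t : seq term) :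
    {in s, forall x, 1 <= expo x + M} -> {in t, forall x, 1 <= expo x + M} ->
    {in s &, forall x y, expo x = expo y -> type_I x = type_I y} ->
    {in t &, forall x y, expo x = expo y -> type_I x = type_I y} ->
    isometric (lattice_of s) (lattice_of t) ->
  perm_eq [seq (lev M x, type_I x) | x <- s] [seq (lev M x, type_I x) | x <- t].
Proof.
move=> s_ge1 t_ge1 sF tF st.
have s_ge0 : {in s, forall x, 0 <= expo x + M} by move=> x /s_ge1; lia.
have t_ge0 : {in t, forall x, 0 <= expo x + M} by move=> x /t_ge1; lia.
have rad := radical_invariant s_ge0 t_ge0 st.
have gt k : (\sum_(x <- s) dim_term x * (k < lev M x) =
    \sum_(x <- t) dim_term x * (k < lev M x))%N.
  have E (u : seq term) : (\sum_(x <- u) dim_term x * minn (lev M x) k.+1 =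
     \sum_(x <- u) dim_term x * minn (lev M x) k + \sum_(x <- u) dim_term x * (k < lev M x))%N.
    by rewrite -big_split /=; apply: eq_bigr => x _; rewrite -mulnDr; congr (_ * _)%N; lia.
  by have := rad k.+1; rewrite !E rad => /addnI.
have dim_lev e : (\sum_(x <- s) dim_term x * (lev M x == e.+1) =
    \sum_(x <- t) dim_term x * (lev M x == e.+1))%N.
  have E (u : seq term) : (\sum_(x <- u) dim_term x * (e < lev M x) =
     \sum_(x <- u) dim_term x * (lev M x == e.+1) + \sum_(x <- u) dim_term x * (e.+1 < lev M x))%N.
    by rewrite -big_split /=; apply: eq_bigr => x _; rewrite -mulnDr; congr (_ * _)%N; lia.
  by have := gt e; rewrite !E gt => /addIn.
have van e := type_I_invariant s_ge0 t_ge0 st e.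
apply/allP => -[e b] _; apply/eqP; rewrite !count_map.
case: e => [|e].
  have Z (u : seq term) : {in u, forall x, 1 <= expo x + M} ->
      count (preim (fun x => (lev M x, type_I x)) (pred1 (0%N, b))) u = 0%N.
    move=> u_ge1; apply/eqP; rewrite -leqn0 leqNgt -has_count.
    apply/hasPn => x /u_ge1 x_ge1 /=; rewrite xpair_eqE negb_and.
    by apply/orP; left; rewrite /lev; lia.
  by rewrite !Z.
pose h := has (fun x => type_I x && (lev M x == e.+1)) s.
have hE (u : seq term) : {in u, forall x, 1 <= expo x + M} ->
    {in u &, forall x y, expo x = expo y -> type_I x = type_I y} ->
    has (fun x => type_I x && (lev M x == e.+1)) u = h ->
    {in u, forall x, lev M x = e.+1 -> type_I x = h}.
  move=> u_ge1 uF uh x xu xe; rewrite -uh; apply/idP/hasP.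
    by move=> xI; exists x => //; rewrite xI xe eqxx.
  move=> [y yu /andP[yI /eqP ye]]; rewrite (uF x y) //.
  by apply: (@lev_expo M); rewrite ?u_ge1 // xe.
have countE (u : seq term) : {in u, forall x, lev M x = e.+1 -> type_I x = h} ->
    count (preim (fun x => (lev M x, type_I x)) (pred1 (e.+1, b))) u =
      (if b == h then count (fun x => lev M x == e.+1) u else 0%N) /\
    (\sum_(x <- u) dim_term x * (lev M x == e.+1) =
      (if h then 1 else 2) * count (fun x => lev M x == e.+1) u)%N.
  move=> uh; split.
    have [->|bh] := eqVneq b h.
      apply: eq_in_count => x xu /=; rewrite xpair_eqE.
      by case: eqP => //= xe; rewrite (uh x xu xe) eqxx.
    apply/eqP; rewrite -leqn0 leqNgt -has_count; apply/hasPn => x xu /=.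
    rewrite xpair_eqE; case: eqP => //= xe.
    by rewrite (uh x xu xe) eq_sym.
  rewrite -sum1_count big_distrr /= [RHS]big_mkcond /= !big_seq.
  apply: eq_bigr => x xu; case: eqP => [xe|_]; last by rewrite muln0.
  by rewrite /dim_term (uh x xu xe).
have [s1 s2] := countE s (hE s s_ge1 sF erefl).
have [t1 t2] := countE t (hE t t_ge1 tF (esym (van _))).
rewrite s1 t1; case: eqP => // _.
have := dim_lev e; rewrite s2 t2 => /eqP.
by rewrite eqn_pmul2l => [/eqP|]; last by case: ifP.
Qed.

(** The terms of [T] are listed in the order that matches those of [S] in scale and type. Only signs
    and labels then remain to be compared. *)
Lemma align_symbols S T : fine_symbol S -> fine_symbol T ->
    isometric (symbol_lattice S) (symbol_lattice T) ->
  exists n (s t : n.-tuple term) (M : int),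
    [/\ S = seq_mset s, T = seq_mset t, aligned s t,
        forall i, 1 <= expo (tnth s i) + M & isometric (lattice_of s) (lattice_of t)].
Proof.
move=> SF TF ST.
have [M MP] := shift_exists (enum_mset S ++ enum_mset T).
have s_ge1 : {in enum_mset S, forall x, 1 <= expo x + M}.
  by move=> x xS; apply: MP; rewrite mem_cat xS.
have t_ge1 : {in enum_mset T, forall x, 1 <= expo x + M}.
  by move=> x xS; apply: MP; rewrite mem_cat xS orbT.
have F U : fine_symbol U ->
    {in enum_mset U &, forall x y, expo x = expo y -> type_I x = type_I y}.
  move=> UF x y xU yU xy.
  have := UF x y xU yU; have := UF y x yU xU; rewrite xy.
  case: (type_I x) (type_I y) => -[] // H1 H2.
    by have := H1 isT erefl.
  by have := H2 isT erefl.
have keys := keys_perm s_ge1 t_ge1 (F S SF) (F T TF) ST.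
pose key x := (lev M x, type_I x).
pose x0 := Term 0 false TypeII.
have [Is Is_perm IsE] := perm_iotaP (key x0) keys.
have sizeT : size (enum_mset T) = size (enum_mset S).
  by have := perm_size keys; rewrite !size_map.
pose t' := [seq nth x0 (enum_mset T) i | i <- Is].
have t'T : perm_eq t' (enum_mset T).
  rewrite -[X in perm_eq _ X](mkseq_nth x0); apply: perm_map.
  by rewrite size_map in Is_perm.
have key_t' : map key t' = map key (enum_mset S).
  rewrite IsE -map_comp; apply/eq_in_map => i iIs /=.
  rewrite (nth_map x0) //.
  by move: iIs; rewrite (perm_mem Is_perm) mem_iota size_map add0n.
have size_t' : size t' == size (enum_mset S) by rewrite (perm_size t'T) sizeT.
pose s := in_tuple (enum_mset S); pose t := Tuple size_t'.
have TE : T = seq_mset t.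
  by rewrite -[LHS]seq_mset_id; apply/eq_seq_msetP; rewrite perm_sym.
have ge1 i : 1 <= expo (tnth s i) + M by apply: s_ge1; exact: mem_tnth.
have key_tnth i : key (tnth t i) = key (tnth s i).
  rewrite !(tnth_nth x0) /= -(nth_map x0 (key x0)) ?(eqP size_t') //.
  by rewrite key_t' (nth_map x0).
exists (size (enum_mset S)), s, t, M; split=> //.
- by rewrite seq_mset_id.
- move=> i; have [lev_i ty_i] := key_tnth i; split=> //.
  apply: (@lev_expo M) => //; apply: t_ge1.
  by rewrite -(perm_mem t'T) (mem_tnth i t).
- exact: isometric_trans ST (isometric_sym (lattice_of_perm t'T)).
Qed.

(** * Constraints on the signs and labels of two aligned symbols *)

Section Combinatorics.
Variables (M : int) (n : nat).
Implicit Types s t : n.-tuple term.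

Local Notation ev s i := (lev M (tnth s i)).
Local Notation sg s i := (minus (tnth s i)).
Local Notation rc s i := (receiver (tnth s i)).
Local Notation ty s i := (type_I (tnth s i)).

Definition comparable_tuples s t : Prop :=
  [/\ fine_tuple s, aligned s t, forall i, 1 <= expo (tnth s i) + M
    & isometric (lattice_of s) (lattice_of t)].

Definition type_at s e : bool := [exists i, ty s i && (ev s i == e)].

(** The half of the theorem already proved supplies the isometry between [s'] and [t], so the
    invariants can be used again after the step. *)
Lemma comparable_step s t s' : comparable_tuples s t -> aligned s s' ->
    [\/ sign_walking s s', giver_permutation s s' | giver_conversion s s'] ->
  comparable_tuples s' t /\ obtained_from (seq_mset s) (seq_mset s').
Proof.
move=> [sF st s_ge1 iso] ss' op.
have op' : operation (seq_mset s) (seq_mset s') by exists n, s, s'.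
split; last exact: rt_step.
have [ss'_iso _] := operation_isometric ((fine_symbol_tuple s).2 sF) op'.
split.
- by apply: (fine_tuple_same _ _ sF) => i; have [] := ss' i.
- by move=> i; have [-> ->] := ss' i; exact: st.
- by move=> i; have [-> _] := ss' i.
- apply: isometric_trans iso; apply: isometric_trans (isometric_sym (symbol_lattice_seq _)) _.
  by apply: isometric_trans (isometric_sym ss'_iso) _; exact: symbol_lattice_seq.
Qed.

Lemma aligned_lev s t i : aligned s t -> ev t i = ev s i.
Proof. by move=> /(_ i)[e_st _]; rewrite /lev e_st. Qed.

Lemma type_atN s e i : ~~ type_at s e -> ty s i -> ev s i != e.
Proof. by move=> /existsPn/(_ i); case: (ty s i). Qed.

Lemma fine_lev s i j : fine_tuple s -> (forall k, 1 <= expo (tnth s k) + M) ->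
  ev s i = ev s j -> ty s i = ty s j.
Proof. by move=> sF s_ge1 ij; apply: sF; exact: (@lev_expo M). Qed.

Lemma phase_tuple s t K : comparable_tuples s t -> ~~ type_at s K ->
  (\sum_i phase M K (tnth s i) = \sum_i phase M K (tnth t i) %[mod 4])%N.
Proof.
move=> [sF st s_ge1 iso] sK.
have := @phase_invariant M s t _ _ iso K _ _; rewrite !big_tuple; apply.
- by move=> x /tnthP[i ->]; apply: le_trans (s_ge1 i).
- by move=> x /tnthP[i ->]; have [-> _] := st i; apply: le_trans (s_ge1 i).
- rewrite -(map_tnth_enum s) -(map_tnth_enum t) -!map_comp.
  by apply: eq_map => i /=; rewrite -(aligned_lev i st); have [_ ->] := st i.
- by apply/hasPn => x /tnthP[i ->]; apply/negP => ix; case/existsP: sK; exists i.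
Qed.

(** A type I term of level K is excluded because the step to level K + 1 adds its number of
    receivers instead of its sign. *)
Lemma phase_succ K x : ~~ (type_I x && (lev M x == K)) ->
  phase M K.+1 x = (phase M K x + 2 * (minus x * (lev M x <= K)))%N.
Proof.
rewrite /phase; case: (type_I x) => /= [xK|_].
  have [xK'|xK'|xK'] := ltngtP (lev M x) K; last by rewrite xK' eqxx in xK.
    by rewrite ltnS ltnW //=; case: (minus x); lia.
  by rewrite ltnS leqNgt xK' /=; lia.
by case: (minus x); lia.
Qed.

Lemma sum_parity (F G : 'I_n -> nat) (i : 'I_n) :
  (forall j, j != i -> F j = G j) -> odd (F i) != odd (G i) ->
  odd (\sum_j F j) != odd (\sum_j G j).
Proof.
move=> FG Fi; rewrite (bigD1 i) //= [in X in _ != X](bigD1 i) //=.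
by rewrite (eq_bigr G) // !oddD; case: odd Fi; case: odd; case: odd.
Qed.

(** Otherwise the phases of levels K and K + 1 are both invariants modulo 4. Their difference is
    twice the number of minus signs up to level K, whose parity would agree for [s] and [t],
    although they differ there at [i] only. *)
Lemma lone_difference s t i K : comparable_tuples s t ->
    sg s i != sg t i -> (ev s i <= K)%N ->
    (forall j, j != i -> (ev s j <= K)%N -> sg s j = sg t j) ->
  type_at s K || type_at s K.+1.
Proof.
move=> st i_diff iK agree; apply: contraT; rewrite negb_or => /andP[sK sK1].
have [_ al _ _] := st.
have := phase_tuple st sK1; have := phase_tuple st sK.
have E (u : n.-tuple term) : aligned s u -> (\sum_j phase M K.+1 (tnth u j) =
    \sum_j phase M K (tnth u j) + 2 * \sum_j (sg u j * (ev s j <= K)))%N.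
  move=> su; rewrite big_distrr -big_split /=; apply: eq_bigr => j _.
  rewrite phase_succ ?(aligned_lev j su) //; apply/andP => -[uI uj].
  have [_ uE] := su j.
  by have := type_atN sK (i := j); rewrite -uE uI uj => /(_ isT).
have odd_diff : odd (\sum_j (sg s j * (ev s j <= K)))%N != odd (\sum_j (sg t j * (ev s j <= K)))%N.
  apply: (@sum_parity _ _ i) => [j ji|].
    by case: (leqP (ev s j) K) => jK; rewrite ?muln0 // (agree j).
  by rewrite iK !muln1 !oddb.
have ss : aligned s s by [].
rewrite (E s ss) (E t al).
move: (\sum_j (sg s j * _))%N (\sum_j (sg t j * _))%N odd_diff => A B AB.
move: (\sum_j phase M K (tnth s j))%N (\sum_j phase M K (tnth t j))%N => P Q PQ PQ2.
have : (A %% 2 = B %% 2)%N by lia.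
by rewrite !modn2; case: (odd A) (odd B) AB => -[].
Qed.

(** [a] and [K] are the nearest levels without type I terms on either side of [i]; level 0 and a
    level above all terms show that they exist. *)
Lemma compartment_bounds s i : (forall j, 1 <= expo (tnth s j) + M) -> ty s i ->
  exists a K, [/\ (a < ev s i < K)%N, ~~ type_at s a, ~~ type_at s K
    & forall e, (a < e < K)%N -> type_at s e].
Proof.
move=> s_ge1 iI.
have ev_gt0 j : (0 < ev s j)%N by have := s_ge1 j; rewrite /lev; lia.
have s0 : ~~ type_at s 0.
  by apply/existsPn => j; rewrite negb_and -lt0n ev_gt0 orbT.
have [B BP] : exists B, forall j, (ev s j < B)%N.
  exists (\max_j ev s j).+1 => j; rewrite ltnS; exact: leq_bigmax.
have [a /andP[ai sa] a_max] := @ex_maxnP (fun a => (a <= ev s i)%N && ~~ type_at s a) (ev s i)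
  (ex_intro _ 0%N s0) (fun a => @proj1 _ _ \o andP).
have sB : ~~ type_at s B.
  by apply/existsPn => j; rewrite negb_and neq_ltn BP orbT.
have [K /andP[iK sK] K_min] := @ex_minnP (fun K => (ev s i <= K)%N && ~~ type_at s K)
  (ex_intro _ B (introT andP (conj (ltnW (BP i)) sB))).
have si : type_at s (ev s i) by apply/existsP; exists i; rewrite iI eqxx.
exists a, K; split=> //.
  apply/andP; split; rewrite ltn_neqAle ?ai ?iK andbT.
    by apply: contraNneq sa => ->.
  by apply: contraNneq sK => <-.
move=> e /andP[ae eK]; apply: contraT => se.
have [ei|ie] := leqP e (ev s i).
  by have := a_max e; rewrite ei se => /(_ isT); rewrite leqNgt ae.
by have := K_min e; rewrite (ltnW ie) se => /(_ isT); rewrite leqNgt eK.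
Qed.

Definition compartment_set s a K : {set 'I_n} := [set j | ty s j && (a < ev s j < K)%N].

Lemma compartment_setP s i a K : (forall j, 1 <= expo (tnth s j) + M) ->
    ty s i -> (a < ev s i < K)%N -> ~~ type_at s a -> ~~ type_at s K ->
    (forall e, (a < e < K)%N -> type_at s e) ->
  compartment s (compartment_set s a K).
Proof.
move=> s_ge1 iI /andP[ai iK] sa sK s_in.
have evE j : (ev s j)%:Z = expo (tnth s j) + M by have := s_ge1 j; rewrite /lev; lia.
split.
  split; first by move=> j; rewrite inE => /andP[].
  exists (a.+1%:Z - M, K.-1%:Z - M) => [/=|e /=]; first by have := evE i; lia.
  split=> [[j]|e_in].
    by rewrite inE => /andP[_ aK] <-; have := evE j; lia.
  have eM : e + M = (absz (e + M))%:Z by lia.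
  have /existsP[j /andP[jI /eqP je]] : type_at s (absz (e + M)).
    by apply: s_in; lia.
  exists j; first by rewrite inE jI je; lia.
  by have := evE j; lia.
move=> D [DI [[lo hi] /= lohi DP]] sub.
have iD : i \in D by apply: (subsetP sub); rewrite inE iI ai.
have range j : j \in D -> lo <= expo (tnth s j) <= hi.
  by move=> jD; apply/DP; exists j.
have i_range := range i iD.
apply/eqP; rewrite eqEsubset sub andbT; apply/subsetP => j jD.
have j_range := range j jD.
(* The scales of [D] form an interval, so a term of [D] out of bounds would force a type I term at
   level [a] or [K]. *)
rewrite inE DI //=; apply/andP; split; rewrite ltnNge; apply/negP => far.
  have /DP[l lD lE] : lo <= a%:Z - M <= hi by have := evE i; have := evE j; lia.
  by have /eqP[] := type_atN sa (DI l lD); have := evE l; lia.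
have /DP[l lD lE] : lo <= K%:Z - M <= hi by have := evE i; have := evE j; lia.
by have /eqP[] := type_atN sK (DI l lD); have := evE l; lia.
Qed.

(** Below [a] the labels of [s] and [t] may differ, so the phase of level a is subtracted from that
    of level K. Over the natural numbers this is done by adding the phase of level a of the other
    tuple; outside the compartment the two crossed sums agree. *)
Lemma compartment_invariant s t a K : comparable_tuples s t -> (a < K)%N ->
    ~~ type_at s a -> ~~ type_at s K ->
    (forall x, (ev s x < K)%N -> ~~ (ty s x && (a < ev s x)%N) -> sg s x = sg t x) ->
  (\sum_(x in compartment_set s a K) (rc s x + 2 * (sg s x * (K.-1 - ev s x))) =
   \sum_(x in compartment_set s a K) (rc t x + 2 * (sg t x * (K.-1 - ev s x))) %[mod 4])%N.
Proof.
move=> st aK sa sK agree; have [_ al _ _] := st.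
have := phase_tuple st sK; have := phase_tuple st sa.
have E (u v : n.-tuple term) : aligned s u -> aligned s v ->
    (forall x, (ev s x < K)%N -> ~~ (ty s x && (a < ev s x)%N) -> sg u x = sg v x) ->
   (\sum_x phase M K (tnth u x) + \sum_x phase M a (tnth v x) =
    \sum_(x in compartment_set s a K) (rc u x + 2 * (sg u x * (K.-1 - ev s x)))
    + \sum_(x | x \notin compartment_set s a K) (phase M K (tnth u x) + phase M a (tnth v x)))%N.
  move=> su sv _; rewrite -big_split (bigID (mem (compartment_set s a K))) /=.
  congr (_ + _)%N; apply: eq_bigr => x; rewrite inE => /andP[xI /andP[ax xK]].
  have [_ uI] := su x; have [_ vI] := sv x.
  rewrite /phase uI vI xI (aligned_lev x su) (aligned_lev x sv) xK.
  by rewrite [(_ < a)%N](_ : _ = false) ?addn0 //; lia.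
have ss : aligned s s by [].
have Es := E s t ss al agree.
have Et := E t s al ss (fun x xK xC => esym (agree x xK xC)).
have C : (\sum_(x | x \notin compartment_set s a K) (phase M K (tnth s x) + phase M a (tnth t x)) =
  \sum_(x | x \notin compartment_set s a K) (phase M K (tnth t x) + phase M a (tnth s x)))%N.
  apply: eq_bigr => x; rewrite inE => xC.
  have [_ tI] := al x.
  rewrite /phase tI (aligned_lev x al).
  have := agree x; have := type_atN sa (i := x); move: xC.
  case: (ty s x) => /= [xC|_].
    move=> /(_ isT) xa agree_x.
    have [xK|Kx] := ltnP (ev s x) K; last first.
      by rewrite [(_ < a)%N](_ : _ = false) //; lia.
    have xa' : (ev s x < a)%N by move: xa; lia.
    by rewrite xa' agree_x //; lia.
  move=> _ /= agree_x; have [xK|Kx] := ltnP (ev s x) K; first by rewrite agree_x //; lia.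
  have -> : (K - ev s x = 0)%N by lia.
  have -> : (a - ev s x = 0)%N by lia.
  by rewrite !muln0.
rewrite C in Es.
move: (\sum_(x | _) _)%N Es Et => c Es Et.
lia.
Qed.

End Combinatorics.

(** * The descent: signs, then labels *)

Section Connection.
Variables (M : int) (n B : nat) (t : n.-tuple term).
Implicit Types s : n.-tuple term.

Local Notation ev s i := (lev M (tnth s i)).
Local Notation sg s i := (minus (tnth s i)).
Local Notation rc s i := (receiver (tnth s i)).
Local Notation ty s i := (type_I (tnth s i)).
Local Notation kd s i := (kind_of (tnth s i)).

Definition sign_defect s : nat := \sum_i ((sg s i != sg t i) * (B - ev s i))%N.

Definition update2 s i j (f : term -> term) : n.-tuple term :=
  [tuple if (k == i) || (k == j) then f (tnth s k) else tnth s k | k < n].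

Lemma update2L s i j f : tnth (update2 s i j f) i = f (tnth s i).
Proof. by rewrite tnth_mktuple eqxx. Qed.

Lemma update2R s i j f : tnth (update2 s i j f) j = f (tnth s j).
Proof. by rewrite tnth_mktuple eqxx orbT. Qed.

Lemma update2N s i j f k : k != i -> k != j -> tnth (update2 s i j f) k = tnth s k.
Proof. by move=> ki kj; rewrite tnth_mktuple (negPf ki) (negPf kj). Qed.

(** The walk corrects [i]. It also corrects [j], or may spoil it at a higher level, where a wrong
    sign weighs less. *)
Lemma walk_step s i j f : comparable_tuples M s t -> i != j ->
    (forall x, [/\ expo (f x) = expo x, type_I (f x) = type_I x & minus (f x) = ~~ minus x]) ->
    walk_pair (tnth s i) (tnth s j) (f (tnth s i)) (f (tnth s j)) ->
    (ev s i < B)%N -> sg s i != sg t i -> sg s j != sg t j \/ (ev s i < ev s j)%N ->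
  exists s', [/\ comparable_tuples M s' t, obtained_from (seq_mset s) (seq_mset s')
    & (sign_defect s' < sign_defect s)%N].
Proof.
move=> st ij f_term walk iB i_diff j_far.
pose s' := update2 s i j f.
have ss' : aligned s s'.
  by move=> k; rewrite tnth_mktuple; case: ifP => // _; have [-> ->] := f_term (tnth s k).
have s'E := (update2L s i j f, update2R s i j f).
have walk' : sign_walking s s'.
  by exists i, j; split; rewrite ?s'E // => k; exact: update2N.
have [st' obt] := comparable_step st ss' (Or31 _ _ walk').
exists s'; split=> //; rewrite /sign_defect.
have ji : j != i by rewrite eq_sym.
rewrite (bigD1 i) // (bigD1 j) // [in X in (_ < X)%N](bigD1 i) // [in X in (_ < X)%N](bigD1 j) //=.
rewrite !(aligned_lev _ _ ss') !s'E.
have [_ _ ->] := f_term (tnth s i); have [_ _ ->] := f_term (tnth s j).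
rewrite (eq_bigr (fun k => (sg s k != sg t k) * (B - ev s k))%N) => [|k /andP[ki kj]].
  move: (\sum_(k | _) _)%N => R.
  have -> : (~~ sg s i != sg t i) = false by move: i_diff; case: (sg s i) (sg t i) => -[].
  rewrite i_diff mul0n mul1n; case: j_far => [j_diff|ij_lev].
    have -> : (~~ sg s j != sg t j) = false by move: j_diff; case: (sg s j) (sg t j) => -[].
    by rewrite mul0n; lia.
  by case: (sg s j) (sg t j) => -[] /=; lia.
by rewrite (aligned_lev _ _ ss') update2N.
Qed.

Lemma negate_term x :
  [/\ expo (negate x) = expo x, type_I (negate x) = type_I x & minus (negate x) = ~~ minus x].
Proof. by []. Qed.

Lemma switch_negate_term x : [/\ expo (switch_label (negate x)) = expo x,
  type_I (switch_label (negate x)) = type_I x & minus (switch_label (negate x)) = ~~ minus x].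
Proof. by split=> //; rewrite /type_I /=; case: kind_of. Qed.

Lemma swap_step s i j a K : comparable_tuples M s t ->
    compartment s (compartment_set M s a K) ->
    i \in compartment_set M s a K -> j \in compartment_set M s a K ->
  comparable_tuples M (relabel_tuple s (tperm i j)) t /\
  obtained_from (seq_mset s) (seq_mset (relabel_tuple s (tperm i j))).
Proof.
move=> st sC iC jC; have pC := perm_on_tperm iC jC.
apply: (comparable_step st); last first.
  apply: Or32; exists (compartment_set M s a K), (tperm i j); split=> // k.
  by rewrite tnth_mktuple.
move=> k; split; first by rewrite tnth_mktuple.
rewrite type_I_relabel; move: iC jC; rewrite !inE => /andP[iI _] /andP[jI _].
by case: tpermP => [->|->|//]; rewrite iI jI.
Qed.

Lemma relabel_sign_defect s p : sign_defect (relabel_tuple s p) = sign_defect s.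
Proof. by apply: eq_bigr => k _; rewrite tnth_mktuple. Qed.

Lemma adjacent_walk_step s i j : comparable_tuples M s t -> i != j -> ty s i ->
    kd s i = kd s j -> ev s j = (ev s i).+1 -> (ev s i < B)%N -> sg s i != sg t i ->
  exists s', [/\ comparable_tuples M s' t, obtained_from (seq_mset s) (seq_mset s')
    & (sign_defect s' < sign_defect s)%N].
Proof.
move=> st ij iI kij ij_ev iB i_diff.
apply: (walk_step st ij switch_negate_term) => //; last by right; rewrite ij_ev.
apply: WalkLabels => //; have [_ _ s_ge1 _] := st.
by have := s_ge1 i; have := s_ge1 j; move: ij_ev; rewrite /lev; lia.
Qed.

Lemma kind_dichotomy (k k1 k2 : kind) : k != TypeII -> k1 != TypeII -> k2 != TypeII ->
  k1 != k2 -> k = k1 \/ k = k2.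
Proof. by case: k k1 k2 => [] [] [] //; auto. Qed.

(** A walk needs equal labels at i and j. If they differ, the label of a third term of the
    compartment can be moved to one of them. When i and j are alone in their compartment, the
    invariant shows that the sign at i was not wrong. *)
Lemma adjacent_step s i j : comparable_tuples M s t -> ty s i -> ty s j ->
    ev s j = (ev s i).+1 -> (ev s i < B)%N -> sg s i != sg t i ->
    (forall k, k != i -> (ev s k <= ev s i)%N -> sg s k = sg t k) ->
  exists s', [/\ comparable_tuples M s' t, obtained_from (seq_mset s) (seq_mset s')
    & (sign_defect s' < sign_defect s)%N].
Proof.
move=> st iI jI ij_ev iB i_diff agree.
have ij : i != j by apply: contra_eqN ij_ev => /eqP <-; lia.
have [sF al s_ge1 _] := st.
have [kij|kij] := eqVneq (kd s i) (kd s j).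
  exact: adjacent_walk_step st ij iI kij ij_ev iB i_diff.
have [a [K [/andP[ai iK] sa sK s_in]]] := compartment_bounds s_ge1 iI.
have aiK : (a < ev s i < K)%N by rewrite ai.
have sC := compartment_setP s_ge1 iI aiK sa sK s_in.
have jK : (ev s j < K)%N by move: (type_atN sK jI) iK; rewrite ij_ev; clear; lia.
have iC : i \in compartment_set M s a K by rewrite inE iI aiK.
have jC : j \in compartment_set M s a K by rewrite inE jI jK ij_ev ltnS ltnW.
have [l lC|no_l] := pickP (mem (compartment_set M s a K :\ i :\ j)).
  move: lC; rewrite !inE => /and4P[lj li lI laK].
  have lC : l \in compartment_set M s a K by rewrite inE lI.
  have swapped x y : x \in compartment_set M s a K -> y \in compartment_set M s a K ->
      kd s (tperm x y i) = kd s (tperm x y j) -> ty s (tperm x y i) ->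
      exists s', [/\ comparable_tuples M s' t, obtained_from (seq_mset s) (seq_mset s')
        & (sign_defect s' < sign_defect s)%N].
    move=> xC yC kxy tyx; have [st1 obt1] := swap_step st sC xC yC.
    set s1 := relabel_tuple s (tperm x y) in st1 obt1.
    have [|||||s2 [st2 obt2 defect2]] := @adjacent_walk_step s1 i j st1 ij;
      rewrite /s1 ?tnth_mktuple //.
    exists s2; split=> //; first exact: rt_trans obt1 obt2.
    by rewrite relabel_sign_defect in defect2.
  have [li_kind|lj_kind] := kind_dichotomy lI iI jI kij.
    by apply: (swapped l j) => //; rewrite ?tpermR (tpermD li) ?li_kind // eq_sym.
  by apply: (swapped l i) => //; rewrite tpermR ?(tpermD lj ij).
have CE : compartment_set M s a K = [set i; j].
  apply/setP => l; have := no_l l; rewrite /= !inE.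
  have [-> _|li] := eqVneq l i; first by rewrite iI aiK.
  have [-> _|lj] := eqVneq l j; first by rewrite jI jK ij_ev ltnS ltnW.
  by rewrite /= => ->.
have KE : K = (ev s i).+2.
  apply/eqP; rewrite eqn_leq; apply/andP; split; last by rewrite -ij_ev.
  rewrite leqNgt; apply/negP => far.
  have a2 : (a < (ev s i).+2 < K)%N by rewrite far andbT ltnS (leq_trans (ltnW ai)).
  have /existsP[l /andP[lI /eqP lE]] := s_in _ a2.
  have : l \in compartment_set M s a K by rewrite inE lI lE.
  rewrite CE !inE => /orP[]/eqP lij; move: lE; rewrite lij ?ij_ev; clear; lia.
(* The sign of [i] has weight 1 and that of [j], at level K - 1, has weight 0. As [s] has one
   receiver here, a wrong sign at [i] would require three receivers modulo 4 among the two terms of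
   [t]. *)
have := compartment_invariant st (ltn_trans ai iK) sa sK.
rewrite CE !big_setU1 ?inE // !big_set1 => inv.
have {inv} := inv _; rewrite KE ij_ev /=.
rewrite subSnn subnn !muln0 !muln1 !addn0 => inv.
have : (rc s i + 2 * sg s i + rc s j = rc t i + 2 * sg t i + rc t j %[mod 4])%N.
  apply: inv => x xK xC; apply: agree.
    by apply: contraNneq xC => ->; rewrite iI.
  have x_ev : (ev s x <= ev s j)%N by rewrite ij_ev.
  rewrite -ltnS -ij_ev ltn_neqAle x_ev andbT; apply: contraNneq xC => xj_ev.
  by rewrite (fine_lev sF s_ge1 xj_ev) jI xj_ev ij_ev ltnS ltnW.
have : (rc s i + rc s j = 1)%N.
  by move: iI jI kij; rewrite /type_I /receiver; case: (kd s i) (kd s j) => [] [].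
have : (rc t i <= 1)%N by rewrite /receiver; case: (kd t i).
have : (rc t j <= 1)%N by rewrite /receiver; case: (kd t j).
move: (rc s i) (rc s j) (rc t i) (rc t j) => x y z u.
by case: (sg s i) (sg t i) i_diff => -[] //= _; clear; lia.
Qed.

(** Take a wrong sign of lowest level e, alone at its level. If level e + 1 is occupied,
    [lone_difference] excludes that both levels have type II, and the other cases allow a walk. If
    it is empty, the same lemma at e and e + 1 gives type I at levels e and e + 2, and a walk over a
    factor 4. *)
Lemma sign_step s i : comparable_tuples M s t -> (forall k, (ev s k < B)%N) ->
    sg s i != sg t i ->
  exists s', [/\ comparable_tuples M s' t, obtained_from (seq_mset s) (seq_mset s')
    & (sign_defect s' < sign_defect s)%N].
Proof.
move=> st sB i_diff0.
case: (@arg_minnP _ i (fun k => sg s k != sg t k) (fun k => ev s k) i_diff0).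
move=> {i_diff0} {}i i_diff i_min.
have [sF al s_ge1 _] := st.
have evE k : (ev s k)%:Z = expo (tnth s k) + M by have := s_ge1 k; rewrite /lev; lia.
have [/existsP[j /and3P[ji j_diff /eqP je]]|none] :=
    boolP [exists j, [&& j != i, sg s j != sg t j & ev s j == ev s i]].
  have ij : i != j by rewrite eq_sym.
  apply: (walk_step (j := j) st ij negate_term) => //; last by left.
  by apply: WalkSame => //; have := evE i; have := evE j; lia.
have agree k : k != i -> (ev s k <= ev s i)%N -> sg s k = sg t k.
  move=> ki; rewrite leq_eqVlt => /orP[ke|k_lt]; apply/eqP; apply: contraT => k_diff.
    by case/existsP: none; exists k; rewrite ki k_diff.
  by have := i_min k k_diff; rewrite leqNgt k_lt.
have si : ty s i = type_at M s (ev s i).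
  apply/idP/existsP => [iI|[k /andP[kI /eqP ke]]]; first by exists i; rewrite iI eqxx.
  by rewrite -(fine_lev sF s_ge1 ke).
have [/existsP[j /eqP je]|no_j] := boolP [exists j, ev s j == (ev s i).+1].
  have ij : i != j by apply: contra_eqN je => /eqP <-; lia.
  have sj : ty s j = type_at M s (ev s i).+1.
    apply/idP/existsP => [jI|[k /andP[kI /eqP ke]]]; first by exists j; rewrite jI je eqxx.
    by rewrite -(fine_lev sF s_ge1 (etrans ke (esym je))).
  have [ij_ty|ij_ty] := eqVneq (ty s i) (ty s j); last first.
    apply: (walk_step (j := j) st ij negate_term) => //; last by right; rewrite je.
    by apply: WalkTypes => //; have := evE i; have := evE j; lia.
  have [iI|iII] := boolP (ty s i).
    by apply: (adjacent_step st iI _ je) => //; rewrite -ij_ty.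
  have := lone_difference st i_diff (leqnn _) agree.
  by rewrite -si -sj -ij_ty (negPf iII).
have no_type : type_at M s (ev s i).+1 = false.
  apply/existsP => -[k /andP[_ ke]]; case/existsP: no_j; by exists k.
have iI : ty s i.
  have := lone_difference st i_diff (leqnn _) agree.
  by rewrite no_type orbF si.
have agree' k : k != i -> (ev s k <= (ev s i).+1)%N -> sg s k = sg t k.
  move=> ki; rewrite leq_eqVlt => /orP[ke|]; last exact: agree.
  by case/existsP: no_j; exists k.
have := lone_difference st i_diff (leqnSn _) agree'.
rewrite no_type /= => /existsP[j /andP[jI /eqP je]].
have ij : i != j by apply: contra_eqN je => /eqP <-; lia.
apply: (walk_step (j := j) st ij negate_term) => //; last by right; rewrite je leqW.
by apply: WalkFour => //; have := evE i; have := evE j; lia.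
Qed.

Lemma sign_connection s : comparable_tuples M s t -> (forall k, (ev s k < B)%N) ->
  exists s', [/\ comparable_tuples M s' t, obtained_from (seq_mset s) (seq_mset s')
    & forall i, sg s' i = sg t i].
Proof.
have [d] := ubnP (sign_defect s); elim: d s => // d IHd s s_d st sB.
have [/forallP agree|/forallPn[i i_diff]] := boolP [forall i, sg s i == sg t i].
  by exists s; split=> [//||i]; [exact: rt_refl | exact/eqP/agree].
have [s1 [st1 obt1 defect1]] := sign_step st sB i_diff.
have [|k|s2 [st2 obt2 agree2]] := IHd s1 _ st1; first exact: leq_trans defect1 _.
  have [_ al _ _] := st; have [_ al1 _ _] := st1.
  by rewrite -(aligned_lev M k al1) (aligned_lev M k al).
by exists s2; split=> //; exact: rt_trans obt1 obt2.
Qed.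

(** Two opposite mismatches in the compartment are repaired by a transposition. If all mismatches go
    the same way, the numbers of receivers of [s] and [t] differ by the number of mismatches; it is
    then a multiple of 4, and four of them are converted at once. *)
Lemma label_step s i : comparable_tuples M s t -> (forall k, sg s k = sg t k) ->
    kd s i != kd t i ->
  exists s', [/\ comparable_tuples M s' t, obtained_from (seq_mset s) (seq_mset s'),
    forall k, sg s' k = sg t k
    & (#|[set k | kd s' k != kd t k]| < #|[set k | kd s k != kd t k]|)%N].
Proof.
move=> st agree i_diff; have [sF al s_ge1 _] := st.
have kd_ty k : (kd t k != TypeII) = (kd s k != TypeII) by have [_] := al k.
have iI : ty s i.
  apply: contraT; rewrite negbK => /eqP ki.
  by move: i_diff; have := kd_ty i; rewrite ki eqxx => /negbFE/eqP ->; rewrite eqxx.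
have [a [K [aiK sa sK s_in]]] := compartment_bounds s_ge1 iI.
have sC := compartment_setP s_ge1 iI aiK sa sK s_in.
set C := compartment_set M s a K in sC.
have iC : i \in C by rewrite inE iI.
have aK : (a < K)%N by case/andP: aiK; exact: ltn_trans.
have [/existsP[j /and3P[jC /eqP sj /eqP tj]]|none] :=
    boolP [exists j, [&& j \in C, kd s j == kd t i & kd t j == kd s i]].
  have [st1 obt1] := swap_step st sC iC jC.
  exists (relabel_tuple s (tperm i j)); split=> //.
    by move=> k; rewrite tnth_mktuple agree.
  apply/proper_card/properP; split.
    apply/subsetP => k; rewrite !inE tnth_mktuple /=.
    case: tpermP => [->|->|//]; first by rewrite sj eqxx.
    by rewrite tj eqxx.
  by exists i; rewrite !inE // tnth_mktuple /= tpermL sj eqxx.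
pose A := [set k in C | kd s k != kd t k].
have CI k : k \in C -> kd s k != TypeII by rewrite inE => /andP[].
have A_kind k : k \in A -> kd s k = kd s i /\ kd t k = kd t i.
  rewrite inE => /andP[kC k_diff].
  have skI := CI k kC; have siI := CI i iC.
  have tkI : kd t k != TypeII by rewrite kd_ty.
  have tiI : kd t i != TypeII by rewrite kd_ty.
  move/existsPn/(_ k): none; rewrite kC /=.
  move: k_diff i_diff skI siI tkI tiI.
  by case: (kd s k) (kd t k) (kd s i) (kd t i) => [] [] [] [].
have iA : i \in A by rewrite inE iC.
have := compartment_invariant st aK sa sK (fun x _ _ => agree x).
rewrite -/C => inv.
have {}inv : (\sum_(x in C) rc s x = \sum_(x in C) rc t x %[mod 4])%N.
  have E (u : n.-tuple term) : (forall x, sg u x = sg t x) ->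
      (\sum_(x in C) (rc u x + 2 * (sg u x * (K.-1 - ev s x))) =
       \sum_(x in C) rc u x + \sum_(x in C) 2 * (sg t x * (K.-1 - ev s x)))%N.
    by move=> ut; rewrite -big_split; apply: eq_bigr => x _; rewrite ut.
  move: inv; rewrite (E s) // (E t) //; clear.
  move: (\sum_(x in C) 2 * _)%N (\sum_(x in C) rc s x)%N (\sum_(x in C) rc t x)%N => X Y Z.
  by lia.
have A4 : (4 %| #|A|)%N.
  have split_sum (u : n.-tuple term) : (\sum_(x in C) rc u x =
      \sum_(x in A) rc u x + \sum_(x in C | x \notin A) rc u x)%N.
    rewrite (bigID (mem A)) /=; congr (_ + _)%N; apply: eq_bigl => x.
    have -> : (x \in A) = (x \in C) && (kd s x != kd t x) by rewrite inE.
    by case: (x \in C).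
  have sA : (\sum_(x in A) rc s x = #|A| * rc s i)%N.
    rewrite (eq_bigr (fun=> rc s i)) ?sum_nat_const // => x /A_kind[sx _].
    by rewrite /receiver sx.
  have tA : (\sum_(x in A) rc t x = #|A| * rc t i)%N.
    rewrite (eq_bigr (fun=> rc t i)) ?sum_nat_const // => x /A_kind[_ tx].
    by rewrite /receiver tx.
  have same : (\sum_(x in C | x \notin A) rc s x = \sum_(x in C | x \notin A) rc t x)%N.
    apply: eq_bigr => x /andP[xC]; rewrite inE xC negbK => /eqP sx.
    by rewrite /receiver sx.
  move: inv; rewrite !split_sum sA tA same.
  move: (\sum_(x in C | _) _)%N => R.
  have : (rc s i + rc t i = 1)%N.
    have siI := CI i iC; have tiI : kd t i != TypeII by rewrite kd_ty.
    by move: i_diff siI tiI; rewrite /receiver; case: (kd s i) (kd t i) => [] [].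
  by move: (rc s i) (rc t i) #|A| => [|[|//]] [|[|//]] // A_card _; clear; lia.
have A_ge4 : (4 <= #|A|)%N.
  by apply: dvdn_leq => //; rewrite card_gt0; apply/set0Pn; exists i.
have [r [r_uniq r_size rA]] := card_geqP A_ge4.
pose A' := [set x in r].
have A'4 : #|A'| = 4%N by rewrite cardsE (card_uniqP r_uniq).
have A'A : A' \subset A by apply/subsetP => x; rewrite inE => /rA.
have A'C : A' \subset C.
  by apply: subset_trans A'A _; apply/subsetP => x; rewrite inE => /andP[].
pose s' := alter s set0 A'.
have s'E k : tnth s' k = if k \in A' then switch_label (tnth s k) else tnth s k.
  by rewrite tnth_mktuple inE addbF; case: ifP => _ //; case: (tnth s k).
have ss' : aligned s s'.
  move=> k; rewrite s'E; case: ifP => //= kA'; split=> //.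
  by rewrite /type_I /=; case: kind_of.
have conv : giver_conversion s s'.
  exists C, A', (kd s i); split=> // k kA'.
  by have [] := A_kind k (subsetP A'A k kA').
have [st1 obt1] := comparable_step st ss' (Or33 _ _ conv).
have s'_kind k : k \in A' -> kd s' k = kd t k.
  move=> kA'; have kA := subsetP A'A k kA'.
  rewrite s'E kA' /=; move: (kA); rewrite inE => /andP[kC k_diff].
  have skI := CI k kC; have tkI : kd t k != TypeII by rewrite kd_ty.
  by move: k_diff skI tkI; case: (kd s k) (kd t k) => [] [].
exists s'; split=> //.
  by move=> k; rewrite s'E; case: ifP => _ /=; exact: agree.
apply/proper_card/properP; split.
  apply/subsetP => k; rewrite !inE.
  have [kA'|kA'] := boolP (k \in A'); first by rewrite s'_kind // eqxx.
  by rewrite s'E (negPf kA').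
have [x xA'] : exists x, x \in A' by apply/set0Pn; rewrite -card_gt0 A'4.
exists x; last by rewrite inE s'_kind // eqxx.
by have := subsetP A'A x xA'; rewrite !inE => /andP[].
Qed.

Lemma label_connection s : comparable_tuples M s t -> (forall k, sg s k = sg t k) ->
  obtained_from (seq_mset s) (seq_mset t).
Proof.
have [d] := ubnP #|[set k | kd s k != kd t k]|; elim: d s => // d IHd s s_d st agree.
have [/forallP same|/forallPn[i i_diff]] := boolP [forall i, kd s i == kd t i].
  have -> : s = t; last exact: rt_refl.
  apply: eq_from_tnth => i; have [_ /(_ i)[ei _] _ _] := st.
  move: ei (agree i) (eqP (same i)).
  by case: (tnth s i) (tnth t i) => [e m k] [e' m' k'] /= -> -> ->.
have [s1 [st1 obt1 agree1 less]] := label_step st agree i_diff.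
apply: rt_trans obt1 _; apply: IHd => //.
exact: leq_trans less _.
Qed.

End Connection.

Lemma isometric_obtained S T : fine_symbol S -> fine_symbol T ->
  isometric (symbol_lattice S) (symbol_lattice T) -> obtained_from S T.
Proof.
move=> SF TF ST; have [n [s [t [M [SE TE st s_ge1 iso]]]]] := align_symbols SF TF ST.
subst S T; have sF := (fine_symbol_tuple s).1 SF.
have comp : comparable_tuples M s t by split.
have sB k : (lev M (tnth s k) < (\max_j lev M (tnth s j)).+1)%N.
  by rewrite ltnS; exact: leq_bigmax.
have [s' [comp' obt agree]] := sign_connection comp sB.
apply: rt_trans obt _; exact: label_connection comp' agree.
Qed.

Theorem theorem2p4 (S T : {mset term}%mset) (fineS : fine_symbol S)
    (fineT : fine_symbol T) :
  isometric (symbol_lattice S) (symbol_lattice T) <-> obtained_from S T.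
Proof.
split; first exact: isometric_obtained.
by move=> /(obtained_isometric fineS)[].
Qed.
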